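(* Every countable rayless graph admits a well-balanced orientation.
   Context: Graphs may have parallel edges but no loops; countable means countably many vertices and edges; a ray is a one-way infinite path and rayless means containing no ray. $\lambda(x,y)$ ($\vec\lambda(x,y)$) is the maximum number of pairwise edge-disjoint (directed) $x$–$y$ paths, $\infty$ if unbounded. An orientation is well-balanced if for all distinct vertices $x,y$: $\vec\lambda(x,y)\ge\lfloor\lambda(x,y)/2\rfloor$ when $\lambda(x,y)<\infty$ and $\vec\lambda(x,y)=\infty$ when $\lambda(x,y)=\infty$. *)

(* Defs.v *)
From mathcomp Require Import all_boot all_order.
From mathcomp Require Import boolp classical_sets functions cardinality.

Set Implicit Arguments.
Unset Strict Implicit.
Unset Printing Implicit Defensive.

Local Open Scope classical_set_scope.

(** Parallel edges are distinct elements of [edge] with the same set of ends;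
    [ends_pair] excludes loops. *)
Record multigraph := Multigraph {
  vertex : choiceType;
  edge : choiceType;
  ends : edge -> set vertex;
  ends_pair : forall e, exists x y, x <> y /\ ends e = [set x; y]
}.

Definition countable_graph (G : multigraph) : Prop :=
  countable [set: vertex G] /\ countable [set: edge G].

Definition joins (G : multigraph) (e : edge G) (u v : vertex G) : Prop :=
  ends e = [set u; v].

(** The edges of a ray need not be required distinct, since its vertices are. *)
Record is_ray (G : multigraph) (v : nat -> vertex G) (e : nat -> edge G) :
    Prop := IsRay {
  ray_inj : injective v;
  ray_step : forall n, joins (e n) (v n) (v n.+1)
}.

Definition rayless (G : multigraph) : Prop :=
  ~ exists (v : nat -> vertex G) (e : nat -> edge G), is_ray v e.

Record orientation (G : multigraph) := Orientation {
  arc_tail : edge G -> vertex G;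
  arc_head : edge G -> vertex G;
  arc_ends : forall e, joins e (arc_tail e) (arc_head e)
}.

Definition darc (G : multigraph) (o : orientation G)
    (e : edge G) (u v : vertex G) : Prop :=
  arc_tail o e = u /\ arc_head o e = v.

Section Paths.
Variables (V E : choiceType) (step : E -> V -> V -> Prop).

(** The path x e1 v1 ... en vn is given by its first vertex x and the list
    [:: (e1, v1); ...; (en, vn)]. *)
Fixpoint is_walk (x : V) (p : seq (E * V)) : Prop :=
  if p is (e, v) :: p' then step e x v /\ is_walk v p' else True.

Definition path_edges (p : seq (E * V)) : seq E := map fst p.

Definition is_path (x y : V) (p : seq (E * V)) : Prop :=
  [/\ is_walk x p, last x (map snd p) = y & uniq (x :: map snd p)].

Definition edge_disjoint_paths (x y : V) (n : nat) (P : 'I_n -> seq (E * V)) :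
    Prop :=
  (forall i, is_path x y (P i)) /\
  (forall i j, i != j ->
     forall e, e \in path_edges (P i) -> e \notin path_edges (P j)).

Definition disjoint_path_numbers (x y : V) : set nat :=
  [set n | exists P : 'I_n -> seq (E * V), edge_disjoint_paths x y P].

End Paths.

Variant enat := Fin of nat | Infty.

Definition enat_le (a b : enat) : Prop :=
  match a, b with
  | _, Infty => True
  | Fin m, Fin n => m <= n
  | Infty, Fin _ => False
  end.

Definition is_max (A : set nat) (n : nat) : Prop :=
  A n /\ forall m, A m -> m <= n.

(** Meaningful for nonempty [A] only: the maximum of [A], or infinity if [A] is
    unbounded; see [emax_fin] and [emax_infty]. *)
Definition emax (A : set nat) : enat :=
  if pselect (exists n, is_max A n) is left h then Fin (projT1 (cid h))
  else Infty.

Lemma emax_fin (A : set nat) n : emax A = Fin n <-> is_max A n.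
Proof.
rewrite /emax; case: pselect => [h|h]; last first.
  by split=> // hn; case: h; exists n.
case: (cid h) => m [Am mA] /=; split=> [[<-]//|[An nA]].
by congr Fin; apply/eqP; rewrite eqn_leq nA ?mA.
Qed.

Lemma emax_infty (A : set nat) : A !=set0 ->
  emax A = Infty <-> forall k, exists2 n, A n & k < n.
Proof.
move=> [a Aa]; split=> [|ub]; last first.
  case E : (emax A) => [n|//]; have [_ nA] := (emax_fin A n).1 E.
  by have [m /nA] := ub n; rewrite leqNgt => /negP.
move=> Ainf k; apply: contrapT => nub.
have Ak m : A m -> m <= k.
  by move=> Am; rewrite leqNgt; apply/negP => km; apply: nub; exists m.
have Ab m : `[< A m >] -> m <= k by move=> /asboolP/Ak.
have exA : exists m, `[< A m >] by exists a; apply/asboolP.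
have [m /asboolP Am mmax] := ex_maxnP exA Ab.
have := (emax_fin A m).2; rewrite Ainf => h; suff /h : is_max A m by [].
by split=> // i Ai; apply/mmax/asboolP.
Qed.

Definition lambda (G : multigraph) (x y : vertex G) : enat :=
  emax (disjoint_path_numbers (@joins G) x y).

Definition dlambda (G : multigraph) (o : orientation G) (x y : vertex G) :
    enat :=
  emax (disjoint_path_numbers (darc o) x y).

Lemma disjoint_path_numbers0 (V E : choiceType) (step : E -> V -> V -> Prop)
  (x y : V) : disjoint_path_numbers step x y 0.
Proof. by exists (fun=> [::]); split=> -[]. Qed.

Definition well_balanced (G : multigraph) (o : orientation G) : Prop :=
  forall x y : vertex G, x <> y ->
    match lambda x y with
    | Fin k => enat_le (Fin (k %/ 2)) (dlambda o x y)
    | Infty => dlambda o x y = Infty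
    end.

(* Main.v *)
Require Import Defs.
From mathcomp Require Import all_boot zify.
From mathcomp Require Import boolp.

(** Say that two vertices are similar if no finite cut separates them. The
    quotient by similarity is rayless and has finite local connectivities, and
    raylessness makes all its blocks finite. Orienting each block by
    Nash-Williams' strong orientation theorem takes care of every vertex set
    [X] that is a union of similarity classes, and it continues to do so when
    blocks are reversed as a whole. This freedom is used to join the vertices of
    each class by infinitely many disjoint families of directed links through
    blocks lying below that class in the block tree, in both directions; here
    raylessness guarantees that the links can be found and countability that
    they can be chosen one after the other. If now [X] splits a class and has
    only finitely many outgoing arcs, then some link avoids all of these arcs,
    which forces [X] to split a class further down in the block tree. Repeating
    this yields a ray in the quotient. Hence a set splitting a class has
    infinitely many outgoing arcs, and Menger's theorem concludes. *)

(** Everything is phrased by cuts: [conn_ge] and [atleast] count edges across vertex sets, and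
    edge-disjoint paths enter only at the very end. Infinite connectivity is then just the bound for
    every [k]. Reversing a block is free because its condition at [X] becomes the one at the
    complement of [X] with the two vertices exchanged. The obstacle is that the quotient forgets how
    a similarity class is held together: a directed path of the quotient through a contracted class
    need not lift to the graph. Links for a class are therefore sought in the graph in which all
    other classes stay contracted, and the debt is paid by descent: a link from [X] to its
    complement that uses no out-arc of [X] must meet a contracted class that [X] splits. Only edges
    inside the class and blocks below it may serve as links, as otherwise the descent could return;
    the one block towards the root is finite and can be spared. Since the groups of links are
    pairwise disjoint, no block is asked for two opposite directions. *)

Set Implicit Arguments.
Unset Strict Implicit.
Unset Printing Implicit Defensive.

(* [lia] slows down a lot on irrelevant boolean hypotheses and local definitions. *)
Ltac nlia :=
  repeat match goal with
  | H : ?T |- _ =>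
    match type of T with Prop =>
      lazymatch T with
      | is_true (leq _ _) => fail
      | @eq nat _ _ => fail
      | not (@eq nat _ _) => fail
      | and (is_true (leq _ _)) (is_true (leq _ _)) => fail
      | _ => clear H
      end
    end
  end;
  repeat match goal with x := _ |- _ => subst x end; lia.

(** * Splitting off in finite multigraphs *)

Section Cuts.
Variable V : finType.
Implicit Types (es : seq (V * V)) (X Y Z A B : {set V}) (x y z v : V).

Definition sep X (e : V * V) : bool := (e.1 \in X) != (e.2 \in X).
Definition dcut es X : nat := count (sep X) es.
Definition linking A B (e : V * V) : bool :=
  (e.1 \in A) && (e.2 \in B) || (e.1 \in B) && (e.2 \in A).
Definition dbet es A B : nat := count (linking A B) es.

Lemma dcutC es X : dcut es (~: X) = dcut es X.
Proof. by apply: eq_count => e; rewrite /sep !inE; do 2!case: (_ \in X). Qed.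

Lemma dcut_perm es es' X : perm_eq es es' -> dcut es X = dcut es' X.
Proof. by move=> /permP; apply. Qed.

Lemma dcut0 es : dcut es set0 = 0.
Proof. by elim: es => //= e es; rewrite /dcut /= /sep !inE. Qed.

Lemma dcutT es : dcut es setT = 0.
Proof. by rewrite -dcutC setCT dcut0. Qed.

Lemma dcut_cat es es' X : dcut (es ++ es') X = dcut es X + dcut es' X.
Proof. exact: count_cat. Qed.

(** The defect is kept as an exact term, since the extremal cases below are decided by the edges it
    counts. *)
Lemma dcut_submodI es X Y :
  dcut es X + dcut es Y = dcut es (X :&: Y) + dcut es (X :|: Y)
    + 2 * dbet es (X :\: Y) (Y :\: X).
Proof.
rewrite /dcut /dbet; elim: es => [|[a b] es] //=.
rewrite /sep /linking /= !inE.
case: (a \in X); case: (b \in X); case: (a \in Y); case: (b \in Y) => /=; nlia.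
Qed.

Lemma dcut_submodD es X Y :
  dcut es X + dcut es Y = dcut es (X :\: Y) + dcut es (Y :\: X)
    + 2 * dbet es (X :&: Y) (~: (X :|: Y)).
Proof.
rewrite /dcut /dbet; elim: es => [|[a b] es] //=.
rewrite /sep /linking /= !inE.
case: (a \in X); case: (b \in X); case: (a \in Y); case: (b \in Y) => /=; nlia.
Qed.

Lemma dcutU_disj es A B : [disjoint A & B] ->
  dcut es (A :|: B) + 2 * dbet es A B = dcut es A + dcut es B.
Proof.
move=> /pred0P dAB; have {}dAB v : (v \in A) && (v \in B) = false by apply: dAB.
rewrite /dcut /dbet; elim: es => [|[a b] es] //=.
rewrite /sep /linking /= !inE; have := dAB a; have := dAB b.
case: (a \in A); case: (b \in A); case: (a \in B); case: (b \in B) => //=; nlia.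
Qed.

Lemma dbetC es A B : dbet es A B = dbet es B A.
Proof. by apply: eq_count => e; rewrite /linking orbC. Qed.

Lemma dbet_setC es A : dbet es A (~: A) = dcut es A.
Proof.
apply: eq_count => e; rewrite /linking /sep !inE.
by do 2!case: (_ \in A).
Qed.

Lemma dbet_subset es A B B' : B \subset B' -> dbet es A B <= dbet es A B'.
Proof.
move=> /subsetP sB; apply: sub_count => e; rewrite /linking.
by case/orP => /andP[h1 h2]; [rewrite h1 (sB _ h2)|rewrite (sB _ h1) h2 orbT].
Qed.

Lemma dbetU es A B B' : [disjoint A & B] -> [disjoint A & B'] -> [disjoint B & B'] ->
  dbet es A (B :|: B') = dbet es A B + dbet es A B'.
Proof.
move=> /pred0P d1 /pred0P d2 /pred0P d3.
rewrite /dbet; elim: es => [|[a b] es] //=.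
rewrite /linking /= !inE.
move: (d1 a) (d1 b) (d2 a) (d2 b) (d3 a) (d3 b) => /=.
case: (a \in A); case: (b \in A); case: (a \in B); case: (b \in B);
case: (a \in B'); case: (b \in B') => //=; nlia.
Qed.

(** A sunflower with core [X :&: Y]: an edge leaving the core ends in at most
    one petal, hence is counted once or three times on the right. *)
Lemma dcut_sunflower es X Y (W : {set V}) :
  (forall w, (w \in X) && (w \in W) = (w \in X) && (w \in Y)) ->
  (forall w, (w \in Y) && (w \in W) = (w \in X) && (w \in Y)) ->
  dcut es (X :&: Y) + 2 * dbet es (X :&: Y) (~: (X :|: Y :|: W))
   = dbet es (X :&: Y) (~: (X :|: Y)) + dbet es (X :&: W) (~: (X :|: W))
     + dbet es (Y :&: W) (~: (Y :|: W)).
Proof.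
move=> iXW iYW; rewrite /dcut /dbet; elim: es => [|[a b] l] //=.
rewrite /sep /linking /= !inE.
move: (iXW a) (iXW b) (iYW a) (iYW b) => {iXW iYW}.
case: (a \in X); case: (b \in X); case: (a \in Y); case: (b \in Y);
case: (a \in W); case: (b \in W) => //= _ _ _ _; nlia.
Qed.

Lemma dbet_mem es A B a b : (a, b) \in es \/ (b, a) \in es ->
  a \in A -> b \in B -> 0 < dbet es A B.
Proof.
move=> h aA bB; rewrite /dbet -has_count; apply/hasP.
by case: h => h; [exists (a, b)|exists (b, a)] => //; rewrite /linking /= aA bB ?orbT.
Qed.

(** The demand on the cut [X]: all cuts meet their demands exactly when no pair of terminals in [U]
    falls below its prescribed connectivity [rho]. *)
Definition maxreq (rho : V -> V -> nat) (U X : {set V}) :=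
  \max_(x in U :&: X) \max_(y in U :\: X) rho x y.

Section MaxReq.
Variables (rho : V -> V -> nat) (U : {set V}).
Hypothesis rhoC : forall x y, rho x y = rho y x.

Lemma maxreq_ge X x y : x \in U -> x \in X -> y \in U -> y \notin X ->
  rho x y <= maxreq rho U X.
Proof.
move=> xU xX yU yX.
rewrite /maxreq (bigD1 x) ?inE ?xU //= leq_max (bigD1 y) ?inE ?yU ?yX //=.
by rewrite leq_max leqnn.
Qed.

Lemma maxreq_le X n :
  (forall x y, x \in U -> x \in X -> y \in U -> y \notin X -> rho x y <= n) ->
  maxreq rho U X <= n.
Proof.
move=> h; apply/bigmax_leqP => x; rewrite inE => /andP[xU xX].
by apply/bigmax_leqP => y; rewrite inE => /andP[yX yU]; apply: h.
Qed.

Lemma maxreq_att X : maxreq rho U X = 0 \/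
  exists x y, [/\ x \in U, x \in X, y \in U, y \notin X & maxreq rho U X = rho x y].
Proof.
case: (posnP (maxreq rho U X)) => [->|h]; [by left|right].
have [e|[x0 x0P]] := set_0Vmem (U :&: X).
  by move: h; rewrite /maxreq e big_set0.
have := @eq_bigmax_cond _ (mem (U :&: X)) (fun x => \max_(y in U :\: X) rho x y).
case; first by apply/card_gt0P; exists x0.
move=> x xP ex; move: h; rewrite /maxreq ex => h.
have [e|[y0 y0P]] := set_0Vmem (U :\: X).
  by move: h; rewrite e big_set0.
have := @eq_bigmax_cond _ (mem (U :\: X)) (rho x).
case; first by apply/card_gt0P; exists y0.
move=> y yP ey; move: xP yP; rewrite !inE => /andP[xU xX] /andP[yX yU].
by exists x, y; split.
Qed.

Lemma maxreqC X : maxreq rho U (~: X) = maxreq rho U X.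
Proof.
apply/eqP; rewrite eqn_leq; apply/andP; split; apply: maxreq_le => x y;
  rewrite ?inE ?negbK => xU xX yU yX; rewrite rhoC; apply: maxreq_ge => //.
  by rewrite inE.
by rewrite inE negbK.
Qed.

(** Skew supermodularity. Take a pair attaining the demand of [X] and one attaining that of [Y].
    Wherever their four ends lie among the four corners, the two pairs are separated by two opposite
    corners, one pair by each. *)
Lemma maxreq_skew X Y :
  maxreq rho U X + maxreq rho U Y
    <= maxreq rho U (X :&: Y) + maxreq rho U (X :|: Y) \/
  maxreq rho U X + maxreq rho U Y
    <= maxreq rho U (X :\: Y) + maxreq rho U (Y :\: X).
Proof.
have ge (S : {set V}) x y : x \in U -> y \in U -> x \in S -> y \notin S ->
    rho x y <= maxreq rho U S /\ rho y x <= maxreq rho U S.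
  by move=> xU yU xS yS; rewrite [rho y x]rhoC; split; apply: maxreq_ge.
have ge1 x y : x \in U -> y \in U -> x \in X -> x \in Y -> ~~ ((y \in X) && (y \in Y)) ->
    rho x y <= maxreq rho U (X :&: Y) /\ rho y x <= maxreq rho U (X :&: Y).
  by move=> xU yU xX xY yXY; apply: ge; rewrite ?inE ?xX.
have ge2 x y : x \in U -> y \in U -> x \in X -> x \notin Y -> ~~ ((y \in X) && (y \notin Y)) ->
    rho x y <= maxreq rho U (X :\: Y) /\ rho y x <= maxreq rho U (X :\: Y).
  by move=> xU yU xX xY yXY; apply: ge; rewrite ?inE ?xX ?xY // andbC.
have ge3 x y : x \in U -> y \in U -> x \notin X -> x \in Y -> ~~ ((y \notin X) && (y \in Y)) ->
    rho x y <= maxreq rho U (Y :\: X) /\ rho y x <= maxreq rho U (Y :\: X).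
  by move=> xU yU xX xY yXY; apply: ge; rewrite ?inE ?xX ?xY.
have ge4 x y : x \in U -> y \in U -> x \notin X -> x \notin Y -> ((y \in X) || (y \in Y)) ->
    rho x y <= maxreq rho U (X :|: Y) /\ rho y x <= maxreq rho U (X :|: Y).
  move=> xU yU xX xY yXY; rewrite and_comm; apply: ge; rewrite ?inE //.
  by rewrite negb_or xX.
have [->|[x [x' [xU xX x'U x'X ->]]]] := maxreq_att X.
  have [->|[y [y' [yU yY y'U y'Y ->]]]] := maxreq_att Y; first by left.
  rewrite add0n; case yX: (y \in X).
    left; case: (ge1 y y') => //; last by move=> h _; apply: leq_trans (leq_addr _ _).
    by rewrite negb_and y'Y orbT.
  right; case: (ge3 y y'); rewrite ?yX // ?(negbTE y'Y) ?andbF // => h _.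
  exact: leq_trans (leq_addl _ _).
have [->|[y [y' [yU yY y'U y'Y ->]]]] := maxreq_att Y.
  rewrite addn0; case xY: (x \in Y).
    left; case: (ge1 x x') => //; first by rewrite (negbTE x'X).
    by move=> h _; apply: leq_trans (leq_addr _ _).
  right; case: (ge2 x x'); rewrite ?xY // ?(negbTE x'X) //= => h _.
  exact: leq_trans (leq_addr _ _).
move: (ge1 x x' xU x'U) (ge1 y y' yU y'U) (ge2 x x' xU x'U) (ge2 y' y y'U yU)
      (ge3 x' x x'U xU) (ge3 y y' yU y'U) (ge4 x' x x'U xU) (ge4 y' y y'U yU).
move: xX x'X yY y'Y => xX /negbTE x'X yY /negbTE y'Y.
rewrite xX x'X yY y'Y /= => {ge1 ge2 ge3 ge4}.
case: (x \in Y); case: (x' \in Y); case: (y \in X); case: (y' \in X) => /= a1 a2 a3 a4 a5 a6 a7 a8;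
repeat match goal with
 | h : is_true true -> _ |- _ => specialize (h isT)
 | h : is_true false -> _ |- _ => clear h
 end; nlia.
Qed.

End MaxReq.

(** A junk value if [x = y]. *)
Definition lam es x y :=
  dcut es [arg min_(Y < [set x] | (x \in Y) && (y \notin Y)) dcut es Y].

Lemma lam_att es x y : x != y ->
  exists Y, [/\ x \in Y, y \notin Y & dcut es Y = lam es x y].
Proof.
move=> xy; rewrite /lam; case: arg_minnP; first by rewrite !inE eqxx eq_sym.
by move=> Y /andP[xY yY] _; exists Y.
Qed.

Lemma lam_le es x y Y : x \in Y -> y \notin Y -> lam es x y <= dcut es Y.
Proof.
move=> xY yY; rewrite /lam; case: arg_minnP; last by move=> Z _; apply; rewrite xY.
by rewrite !inE eqxx; apply: contra yY => /eqP->.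
Qed.

Lemma lamC es x y : lam es x y = lam es y x.
Proof.
have [->//|xy] := eqVneq x y.
have le a b : a != b -> lam es a b <= lam es b a.
  move=> ab; have ba : b != a by rewrite eq_sym.
  have [Y [bY aY <-]] := lam_att es ba.
  by rewrite -(dcutC _ Y); apply: lam_le; rewrite inE ?negbK.
by apply/eqP; rewrite eqn_leq !le // eq_sym.
Qed.

Lemma lam_ge es x y n : x != y ->
  (forall Y, x \in Y -> y \notin Y -> n <= dcut es Y) -> n <= lam es x y.
Proof. by move=> xy h; have [Y [xY yY <-]] := lam_att es xy; apply: h. Qed.

Lemma lam_ultra es x y w : x != y -> lam es x w <= lam es x y \/ lam es w y <= lam es x y.
Proof.
move=> xy; have [Y [xY yY <-]] := lam_att es xy.
by case wY: (w \in Y); [right|left]; apply: lam_le; rewrite ?wY.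
Qed.

Lemma maxreq_lam_le es U X : maxreq (lam es) U X <= dcut es X.
Proof. by apply: maxreq_le => x y _ xX _ yX; apply: lam_le. Qed.

Definition nbr es z s := (s != z) && (((z, s) \in es) || ((s, z) \in es)).

Lemma nbr_dbet es z s A : nbr es z s -> s \in A -> 0 < dbet es [set z] A.
Proof.
move=> /andP[_ /orP h] sA; apply: (@dbet_mem _ _ _ z s) => //.
by rewrite inE.
Qed.

Lemma dbet_nbr es z A : z \notin A -> 0 < dbet es [set z] A ->
  exists2 s, s \in A & nbr es z s.
Proof.
move=> zA; rewrite -has_count => /hasP[[a b] ab]; rewrite /linking /= !inE.
case/orP=> /andP[].
  move=> /eqP az bA; exists b => //; rewrite /nbr -{2}az ab andbT.
  by apply: contraNneq zA => <-.
move=> aA /eqP bz; exists a => //; rewrite /nbr -{3}bz ab orbT andbT.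
by apply: contraNneq zA => <-.
Qed.

End Cuts.

(** * The minimal case of Mader's theorem *)

Section MaderCore.
Variables (V : finType) (es : seq (V * V)) (U : {set V}) (z : V).
Implicit Types (X Y A F S : {set V}) (s u v : V).
Let d := dcut es.
Let R := maxreq (lam es) U.
Let dz (A : {set V}) := dbet es [set z] A.
Hypothesis zU : z \notin U.
Hypothesis no_bridge : forall X : {set V}, d X <> 1.
Hypothesis dz_gt1 : 1 < d [set z].
Hypothesis dz_neq3 : d [set z] <> 3.
Hypothesis tight_small : forall F : {set V}, z \notin F -> d F = R F -> #|F| <= 1.

(** Dangerous sets: splitting off two edges from [z] into such a set would push its cut below its
    demand. *)
Let dang (X : {set V}) := (z \notin X) && (d X <= (R X).+1).

Hypothesis blocked : forall s u, nbr es z s -> nbr es z u -> s != u ->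
  exists X, [/\ dang X, s \in X & u \in X].
Hypothesis blocked2 : forall s, nbr es z s -> 1 < dz [set s] ->
  exists2 X, dang X & s \in X.

Let RC X : R (~: X) = R X. Proof. exact: maxreqC (lamC es) _. Qed.
Let Rle X : R X <= d X. Proof. exact: maxreq_lam_le. Qed.

Let RUz X : z \notin X -> R (z |: X) = R X.
Proof.
move=> zX; apply/eqP; rewrite eqn_leq; apply/andP; split; apply: maxreq_le => x y xU xX yU yX;
  apply: maxreq_ge => //; move: xX yX; rewrite !inE.
- by case/orP=> [/eqP e|//]; rewrite e (negbTE zU) in xU.
- by move=> _ /norP[].
- by move=> ->; rewrite orbT.
- by move=> _ yX; rewrite (negbTE yX) orbF; apply: contraNneq zU => <-.
Qed.

Let dUz X : z \notin X -> d (z |: X) + 2 * dz X = d [set z] + d X.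
Proof. by move=> zX; apply: dcutU_disj; rewrite disjoints1. Qed.

(** Adding [z] keeps the demand of a dangerous set, so it lowers the cut by at most one. Hence such
    a set receives hardly more than half of the edges at [z]. *)
Let dang_dz X : dang X -> 2 * dz X <= (d [set z]).+1.
Proof.
move=> /andP[zX h]; have := dUz zX; have := Rle (z |: X); rewrite RUz //; nlia.
Qed.

Let tight_set1 F s : z \notin F -> s \in F -> d F <= R F -> F = [set s].
Proof.
move=> zF sF h; have /tight_small : d F = R F by apply/eqP; rewrite eqn_leq h Rle.
move=> /(_ zF) c; apply/esym/eqP; rewrite eqEcard sub1set sF cards1.
exact: c.
Qed.

Let maximal (X : {set V}) := dang X /\ forall X', dang X' -> X \subset X' -> X' = X.

Let ex_maximal A : dang A -> exists2 X, maximal X & A \subset X.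
Proof.
move=> dA; have [X mX AX] := maxset_exists (P := dang) dA; exists X => //.
by split; [exact: maxsetp mX|move=> X' dX' sX; exact: (maxsetsup mX)].
Qed.

Let alpha (X Y : {set V}) := [/\ d (X :&: Y) = R (X :&: Y), d X = (R X).+1, d Y = (R Y).+1
  & dbet es (X :\: Y) (Y :\: X) = 0].
Let beta (X Y : {set V}) := [/\ d (X :\: Y) = R (X :\: Y), d (Y :\: X) = R (Y :\: X),
  d X = (R X).+1, d Y = (R Y).+1 & dbet es (X :&: Y) (~: (X :|: Y)) = 1].

(** By maximality the union is not dangerous, and the edge [zs] leaves the intersection. This uses
    up all slack in the two submodular identities, so in either alternative of [maxreq_skew]
    equality holds throughout. *)
Let uncross X Y s : nbr es z s -> s \in X -> s \in Y -> maximal X -> dang Y ->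
  ~~ (Y \subset X) -> alpha X Y \/ beta X Y.
Proof.
move=> zs sX sY [dX mX] dY YX.
have dXY : ~~ dang (X :|: Y).
  apply: contra YX => h; have /setUidPl e := mX _ h (subsetUl _ _).
  exact: e.
case/andP: (dX) => zX hX; case/andP: (dY) => zY hY.
have hU : (R (X :|: Y)).+1 < d (X :|: Y).
  by move: dXY; rewrite /dang !inE (negbTE zX) (negbTE zY) /= -ltnNge.
have out : 0 < dbet es (X :&: Y) (~: (X :|: Y)).
  case/andP: zs => _ /orP h; apply: (@dbet_mem _ _ _ _ s z).
  - by case: h; [right|left].
  - by rewrite !inE sX.
  - by rewrite !inE negb_or zX.
have := dcut_submodI es X Y; have := dcut_submodD es X Y; rewrite -/d => e1 e2.
have := Rle (X :&: Y); have := Rle (X :\: Y); have := Rle (Y :\: X) => r1 r2 r3.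
have [h|h] := maxreq_skew U (lamC es) X Y; [left|right]; rewrite -/R in h.
  by split; nlia.
by split; nlia.
Qed.

(** The start is chosen to control the case [alpha] of [uncross]. That case makes [s] tight, so that
    only the second clause remains: all neighbours of [z] are tight and [s] has least degree. *)
Let good_start s := nbr es z s /\
  (R [set s] < d [set s] \/
   forall v, nbr es z v -> d [set v] = R [set v] /\ d [set s] <= d [set v]).

Let ex_good : exists s, good_start s.
Proof.
have [s0 _ zs0] : exists2 s, s \in ~: [set z] & nbr es z s.
  by apply: dbet_nbr; rewrite ?inE ?eqxx // dbet_setC -/d; nlia.
have [/existsP[s /andP[zs h]]|] := boolP [exists s, nbr es z s && (R [set s] < d [set s])].
  by exists s; split=> //; left.
rewrite negb_exists => /forallP h.
have [s zs ms] := @arg_minnP _ s0 (nbr es z) (fun s => d [set s]) zs0.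
exists s; split=> //; right=> v zv; split; last exact: ms.
by have := h v; rewrite zv /= -leqNgt => hv; apply/eqP; rewrite eqn_leq hv Rle.
Qed.

Let dS_split s S : s \in S -> d S + 2 * dbet es [set s] (S :\ s) = d [set s] + d (S :\ s).
Proof.
move=> sS; rewrite -[in d S](setD1K sS); apply: dcutU_disj.
by rewrite disjoints1 !inE eqxx.
Qed.

(** If the demand of [S] survives the removal of [s], the rest of [S] is tight, hence a single
    vertex. Otherwise this demand is due to [s] alone. A minimum cut between [u] and the outer
    terminal is then tight, so it isolates that terminal, which is too small a cut for [s], or it
    isolates [u], against the least degree of [s]. *)
Let alpha_side s S u : (forall v, nbr es z v -> d [set v] = R [set v] /\ d [set s] <= d [set v]) ->
  nbr es z s -> s \in S -> z \notin S -> d S = (R S).+1 -> nbr es z u -> u \in S -> u != s ->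
  2 * dbet es [set s] (S :\ s) < d [set s] ->
  S :\ s = [set u] /\ (2 * dbet es [set s] (S :\ s)).+1 = d [set s].
Proof.
move=> allt zs sS zS dS zu uS us small.
have uQ : u \in S :\ s by rewrite !inE us.
have zQ : z \notin S :\ s by rewrite !inE (negbTE zS) andbF.
have e := dS_split sS.
have [RQ|RQ] := leqP (R S) (R (S :\ s)).
  have := Rle (S :\ s) => h.
  by split; [apply: tight_set1 => //; nlia|nlia].
exfalso.
have [R0|[x [y0 [xU xS y0U y0S RS]]]] := maxreq_att (lam es) U S.
  by move: RQ; rewrite /R R0.
rewrite -/R in RS.
have RQlt q : q \in S :\ s -> q \in U -> lam es q y0 < R S.
  move=> qQ qU; apply: leq_ltn_trans RQ; apply: maxreq_ge => //.
  by rewrite !inE (negbTE y0S) andbF.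
have xs : x = s.
  apply/eqP/negPn/negP => xs; have := RQlt x; rewrite !inE xs xS RS ltnn => /(_ isT xU).
  by [].
subst x.
have [ts mins] := allt s zs.
have sy0 : s != y0 by apply: contraNneq y0S => <-.
have lesd : lam es s y0 <= d [set s] by apply: lam_le; rewrite !inE // eq_sym.
have dsRS : d [set s] <= R S.
  have [R0|[a [s' [aU]]]] := maxreq_att (lam es) U [set s].
    by rewrite ts /R R0.
  rewrite inE => /eqP-> s'U; rewrite inE => s's Rs; rewrite -/R in Rs.
  rewrite ts Rs leqNgt; apply/negP => lt.
  case s'S: (s' \in S); last first.
    by have := maxreq_ge (lam es) xU sS s'U (negbT s'S); rewrite -/R leqNgt lt.
  have s'Q : s' \in S :\ s by rewrite !inE s's.
  have h := RQlt s' s'Q s'U.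
  have s'y0 : s' != y0 by apply: contraNneq y0S => <-.
  have [h'|h'] := lam_ultra es s s'y0.
    by move: h'; rewrite lamC => h'; nlia.
  by nlia.
have [tu minu] := allt u zu.
have uU : u \in U.
  have [R0|[a [b [aU]]]] := maxreq_att (lam es) U [set u]; last by rewrite inE => /eqP<-.
  have : 0 < d [set u].
    rewrite /d -dbet_setC; case/andP: zu => uz /orP h; apply: (@dbet_mem _ _ _ _ u z).
    - by case: h; [right|left].
    - by rewrite inE.
    - by rewrite !inE eq_sym.
  by rewrite tu /R R0.
have uy0 : u != y0 by apply: contraNneq y0S => <-.
have [F [uF y0F dF]] := lam_att es uy0.
have ltu := RQlt u uQ uU.
have RF : d F <= R F by rewrite /d dF; apply: maxreq_ge.
case zF: (z \in F).
  have e1 : ~: F = [set y0].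
    by apply: tight_set1; rewrite ?inE ?zF // /d dcutC RC.
  have : lam es s y0 <= d F.
    rewrite /d -dcutC e1 -dcutC; apply: lam_le; rewrite !inE ?negbK //.
  by rewrite /d dF; nlia.
have e1 : F = [set u] by apply: tight_set1; rewrite ?zF.
by have := minu; rewrite /d -e1 dF; nlia.
Qed.

Let conclude (X Y : {set V}) := exists p u, [/\ X :\: Y = [set p], Y :\: X = [set u]
  & dbet es (X :&: Y) (~: (X :|: Y)) = 1].

(** In the case [alpha] the intersection is [{s}] and some edge of [s] leaves the union, so one
    petal receives less than half of the edges at [s]. By [alpha_side] it misses half by as little
    as possible, which leaves less than half for the other petal too, and a single edge for the
    outside. *)
Let uncross_beta X Y s u1 u2 : good_start s -> s \in X -> s \in Y -> maximal X -> dang Y ->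
  nbr es z u1 -> u1 \in X -> u1 != s -> nbr es z u2 -> u2 \in Y -> u2 \notin X -> conclude X Y.
Proof.
move=> [zs gs] sX sY mX dY zu1 u1X u1s zu2 u2Y u2X.
have YX : ~~ (Y \subset X) by apply/subsetPn; exists u2.
have XY : ~~ (X \subset Y).
  apply: contra YX => h; by rewrite (mX.2 _ dY h).
case/andP: (mX.1) => zX _; case/andP: (dY) => zY _.
have [al|be] := uncross zs sX sY mX dY YX; last first.
  case: be => t1 t2 _ _ e; have [p pX] := subsetPn XY; move=> pY.
  exists p, u2; split=> //; apply: tight_set1; rewrite ?t1 ?t2 ?inE ?(negbTE zX) ?(negbTE zY) ?andbF //.
    by rewrite pY.
  by rewrite u2X.
case: al => t1 dX dY1 b0.
have es1 : X :&: Y = [set s].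
  by apply: tight_set1; rewrite ?t1 ?inE ?(negbTE zX) ?sX.
have ts : d [set s] = R [set s] by rewrite -es1.
case: gs => [|gs]; first by rewrite ts ltnn.
have u2s : u2 != s by apply: contraNneq u2X => ->.
have eXY : X :\: Y = X :\ s by rewrite -es1 setDIr setDv set0U.
have eYX : Y :\: X = Y :\ s by rewrite -es1 setDIr setDv setU0.
have ed : d [set s] = dbet es [set s] (X :\ s) + dbet es [set s] (Y :\ s)
    + dbet es [set s] (~: (X :|: Y)).
  rewrite /d -dbet_setC.
  have -> : ~: [set s] = ((X :\ s) :|: (Y :\ s)) :|: ~: (X :|: Y).
    apply/setP => v; rewrite !inE; case: eqP => [->|]; rewrite ?sX //=.
    by case: (v \in X); case: (v \in Y).
  rewrite !dbetU //; rewrite ?disjoints1 ?inE ?eqxx ?sX //.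
    rewrite -setI_eq0; apply/eqP/setP => v; rewrite !inE.
    have /setP/(_ v) := es1; rewrite !inE.
    by case: (v == s); case: (v \in X); case: (v \in Y).
  rewrite -setI_eq0; apply/eqP/setP => v; rewrite !inE.
  by case: (v == s); case: (v \in X); case: (v \in Y).
have out : 0 < dbet es [set s] (~: (X :|: Y)).
  case/andP: zs => _ /orP h; apply: (@dbet_mem _ _ _ _ s z).
  - by case: h; [right|left].
  - by rewrite !inE.
  - by rewrite !inE negb_or zX.
have sideX := alpha_side gs zs sX zX dX zu1 u1X u1s.
have sideY := alpha_side gs zs sY zY dY1 zu2 u2Y u2s.
have [lX|lX] := ltnP (2 * dbet es [set s] (X :\ s)) (d [set s]).
  have [eX hX] := sideX lX; have [|eY hY] := sideY; first by nlia.
  by exists u1, u2; rewrite eXY eYX eX eY es1; split=> //; nlia.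
have [|eY hY] := sideY; first by nlia.
by have [|eX hX] := sideX; [nlia|exists u1, u2; rewrite eXY eYX eX eY es1; split=> //; nlia].
Qed.

(** Three maximal dangerous sets through [s] would form a sunflower whose core is cut off by one
    edge. So two of them cover all neighbours of [z]; their petals receive equally many edges from
    [z], and the set blocking the two petal vertices limits this number to one. Then [z] has degree
    three. *)
Lemma mader_core : False.
Proof.
have [s gs] := ex_good; have zs := gs.1.
have s_z : s != z by case/andP: zs.
have [u1 zu1 u1s] : exists2 u, nbr es z u & u != s.
  have [h|h] := posnP (dbet es [set z] (~: [set z; s])).
    have e : d [set z] = dz [set s].
      rewrite /d -dbet_setC.
      have -> : ~: [set z] = [set s] :|: ~: [set z; s].
        apply/setP => v; rewrite !inE; case: (eqVneq v s) => [->|_]; rewrite ?s_z //=.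
        by rewrite orbF.
      by rewrite dbetU ?h ?addn0 // disjoints1 !inE ?eqxx ?orbT // eq_sym.
    have [X dX sX] := blocked2 zs (leq_trans dz_gt1 (eq_leq e)).
    have := dang_dz dX; have := @dbet_subset _ es [set z] [set s] X.
    rewrite sub1set sX -/(dz _) -/(dz _) => /(_ isT); nlia.
  have [||u uP zu] := @dbet_nbr _ es z (~: [set z; s]) => //; first by rewrite !inE eqxx.
  by exists u => //; move: uP; rewrite !inE => /norP[].
have su1 : s != u1 by rewrite eq_sym.
have [A [dA sA u1A]] := blocked zs zu1 su1.
have [X mX AX] := ex_maximal dA.
have sX := subsetP AX _ sA; have u1X := subsetP AX _ u1A.
case/andP: (mX.1) => zX _.
have [u zu uX] : exists2 u, nbr es z u & u \notin X.
  have := dang_dz mX.1 => h.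
  have e : d [set z] = dz X + dz (~: (z |: X)).
    rewrite /d -dbet_setC.
    have -> : ~: [set z] = X :|: ~: (z |: X).
      apply/setP => v; rewrite !inE; case: (eqVneq v z) => [->|_] /=; rewrite ?(negbTE zX) //.
      by rewrite orbN.
    rewrite dbetU // ?disjoints1 ?inE ?eqxx //.
    rewrite -setI_eq0; apply/eqP/setP => v; rewrite !inE.
    by case: (v \in X); rewrite ?orbT ?andbF.
  have [||u uP zu] := @dbet_nbr _ es z (~: (z |: X)); rewrite ?inE ?eqxx // -/(dz _).
    nlia.
  by exists u => //; move: uP; rewrite !inE => /norP[].
have us : s != u by apply: contraNneq uX => <-.
have [B [dB sB uB]] := blocked zs zu us.
have [Y mY BY] := ex_maximal dB.
have sY := subsetP BY _ sB; have uY := subsetP BY _ uB.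
case/andP: (mY.1) => zY _.
have us' : u != s by rewrite eq_sym.
have [p [u' [eXY eYX out1]]] := uncross_beta gs sX sY mX mY.1 zu1 u1X u1s zu uY uX.
have uu' : u' = u by apply/eqP; rewrite eq_sym -in_set1 -eYX inE uX.
subst u'.
have szK (K O : {set V}) : s \in K -> z \in O -> 0 < dbet es K O.
  move=> sK zO; case/andP: zs => _ /orP h; apply: (@dbet_mem _ _ _ _ s z) => //.
  by case: h; [right|left].
have [v /andP[zv /andP[vX vY]]|allN] := pickP (fun v => nbr es z v && ((v \notin X) && (v \notin Y))).
  have vs : s != v by apply: contraNneq vX => <-.
  have [C [dC sC vC]] := blocked zs zv vs.
  have [W mW CW] := ex_maximal dC.
  have sW := subsetP CW _ sC; have vW := subsetP CW _ vC.
  have [p' [v' [eXW eWX out2]]] := uncross_beta gs sX sW mX mW.1 zu1 u1X u1s zv vW vX.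
  have [u'' [v'' [eYW eWY out3]]] := uncross_beta gs sY sW mY mW.1 zu uY us' zv vW vY.
  have v'v : v' = v by apply/eqP; rewrite eq_sym -in_set1 -eWX inE vX.
  have v''v : v'' = v by apply/eqP; rewrite eq_sym -in_set1 -eWY inE vY.
  subst v' v''; case/andP: (mW.1) => zW _.
  have pP : (p \in X) && (p \notin Y) by rewrite andbC; have := set11 p; rewrite -eXY inE.
  case/andP: pP => pX pY.
  have pW : p \notin W.
    apply/negP => pW; have : p \in W :\: Y by rewrite inE pY.
    by rewrite eWY inE => /eqP e; rewrite -e pX in vX.
  have pp' : p' = p by apply/eqP; rewrite eq_sym -in_set1 -eXW inE pW.
  subst p'.
  have iXW w : (w \in X) && (w \in W) = (w \in X) && (w \in Y).
    case wX: (w \in X) => //=.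
    case wW: (w \in W); case wY: (w \in Y) => //.
      have : w \in W :\: Y by rewrite inE wY.
      by rewrite eWY inE => /eqP e; rewrite -e wX in vX.
    have : w \in X :\: W by rewrite inE wW.
    by rewrite eXW inE => /eqP e; rewrite -e wY in pY.
  have iYW w : (w \in Y) && (w \in W) = (w \in X) && (w \in Y).
    case wY: (w \in Y); rewrite ?andbF //= ?andbT.
    case wW: (w \in W); case wX: (w \in X) => //.
      have : w \in W :\: X by rewrite inE wX.
      by rewrite eWX inE => /eqP e; rewrite -e wY in vY.
    by have := iXW w; rewrite wX wW wY.
  have hout : 0 < dbet es (X :&: Y) (~: (X :|: Y :|: W)).
    by apply: szK; rewrite !inE ?sX // !negb_or zX zY.
  have hK : 0 < d (X :&: Y) by rewrite /d -dbet_setC; apply: szK; rewrite !inE ?sX // (negbTE zX).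
  apply: (no_bridge (X := X :&: Y)).
  have := dcut_sunflower es iXW iYW; rewrite -/d out1 out2 out3; nlia.
have dzK : dz (X :&: Y) = 1.
  apply/eqP; rewrite eqn_leq; apply/andP; split; last first.
    by rewrite /dz dbetC; apply: szK; rewrite !inE ?sX.
  rewrite -out1 /dz dbetC; apply: dbet_subset; rewrite sub1set !inE negb_or zX; exact: zY.
have dzX : dz X = 1 + dz [set p].
  rewrite -dzK -eXY /dz -dbetU ?disjoints1 ?inE ?(negbTE zX) ?andbF //.
    by rewrite setID.
  by rewrite -setI_eq0; apply/eqP/setP => w; rewrite !inE; case: (w \in X); case: (w \in Y).
have dzY : dz Y = 1 + dz [set u].
  rewrite -dzK -eYX /dz -dbetU ?disjoints1 ?inE ?(negbTE zY) ?(negbTE zX) ?andbF //.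
    by rewrite setIC setID.
  by rewrite -setI_eq0; apply/eqP/setP => w; rewrite !inE; case: (w \in X); case: (w \in Y).
have eu : d [set z] = 1 + dz [set p] + dz [set u].
  have -> : d [set z] = dz (X :|: Y).
    rewrite /d -dbet_setC; apply: eq_in_count => -[a b] ab.
    have nn w : nbr es z w -> (w \in X) || (w \in Y).
      by move=> zw; have := allN w; rewrite zw /= -negb_or => /negbFE.
    rewrite /linking /= !inE.
    case: (eqVneq a z) => [az|az]; case: (eqVneq b z) => [bz|bz] //=; rewrite ?andbF //=.
    - by rewrite az bz (negbTE zX) (negbTE zY).
    - by rewrite orbF nn // /nbr bz -az ab.
    - by rewrite andbT nn // /nbr az -bz ab orbT.
  have -> : X :|: Y = X :|: (Y :\: X) by apply/setP => w; rewrite !inE; case: (w \in X).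
  rewrite /dz dbetU ?disjoints1 ?inE ?(negbTE zX) ?(negbTE zY) // -/(dz _); last first.
    by rewrite -setI_eq0; apply/eqP/setP => w; rewrite !inE; case: (w \in X); case: (w \in Y).
  by rewrite eYX dzX.
have := dang_dz mX.1; have := dang_dz mY.1; rewrite dzX dzY => h1 h2.
have cu : 0 < dz [set u] by apply: nbr_dbet zu _; rewrite inE.
have pX : p \in X by have := set11 p; rewrite -eXY inE => /andP[].
have zp : nbr es z p.
  have [||q] := @dbet_nbr _ es z [set p]; last by rewrite inE => /eqP->.
  - by rewrite inE; apply: contraNneq zX => ->.
  - by rewrite -/(dz _); nlia.
have pu : p != u by apply: contraNneq uX => <-.
have [W [dW pW uW]] := blocked zp zu pu.
have := dang_dz dW; have : dz [set p] + dz [set u] <= dz W.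
  rewrite /dz -dbetU ?disjoints1 ?inE //.
  - by apply: dbet_subset; apply/subsetP => w; rewrite !inE => /orP[] /eqP->.
  - by apply: contraNneq zX => ->.
  - by rewrite eq_sym; case/andP: zu.
by nlia.
Qed.

End MaderCore.

(** * Contractions *)

Section Contraction.
Variables (V V' : finType) (f : V -> V').
Implicit Types (es : seq (V * V)) (U X : {set V}) (Z : {set V'}).

Definition map_edge (e : V * V) : V' * V' := (f e.1, f e.2).
Definition map_edges es := map map_edge es.

Lemma dcut_map es Z : dcut (map_edges es) Z = dcut es (f @^-1: Z).
Proof. by rewrite /dcut count_map; apply: eq_count => e; rewrite /sep /= !inE. Qed.

Lemma lam_map es x y : f x != f y -> lam es x y <= lam (map_edges es) (f x) (f y).
Proof.
move=> fxy; have [Y [xY yY <-]] := lam_att (map_edges es) fxy.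
by rewrite dcut_map; apply: lam_le; rewrite inE.
Qed.

(** Cuts of the contraction are cuts of the original graph, so connectivities can only grow. The
    function [phi] allows for connectivities rounded down to even numbers. *)
Lemma maxreq_map es U Z (phi : nat -> nat) : {homo phi : m n / m <= n} ->
  maxreq (fun x y => phi (lam es x y)) U (f @^-1: Z)
    <= maxreq (fun x y => phi (lam (map_edges es) x y)) (f @: U) Z.
Proof.
move=> phi_homo; apply: maxreq_le => x y xU; rewrite inE => xZ yU; rewrite inE => yZ.
apply: leq_trans (phi_homo _ _ (lam_map _ _)) _; first by apply: contraNneq yZ => <-.
by apply: maxreq_ge => //; apply: imset_f.
Qed.

End Contraction.

(** The point [None] stands for the contracted set [F]. *)
Notation contr F := (option {v | v \notin F}).
Definition ctr (V : finType) (F : {set V}) (v : V) : contr F := insub v.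

Section Ctr.
Variables (V : finType) (F : {set V}).
Implicit Types (X : {set V}) (v w : V).

Lemma ctr_in v : v \in F -> ctr F v = None.
Proof. by move=> vF; rewrite /ctr insubN // negbK. Qed.

Lemma ctr_out v w : v \notin F -> ctr F v = ctr F w -> v = w.
Proof.
move=> vF; rewrite /ctr insubT; case: insubP => [w' wF e1 [e]|//].
by rewrite -e1 -e.
Qed.

Lemma card_contr : #|{: contr F}| = (#|~: F|).+1.
Proof. by rewrite card_option card_sig; congr _.+1; apply: eq_card => v; rewrite !inE. Qed.

Lemma ctr_saturated X : F \subset X \/ [disjoint F & X] ->
  ctr F @^-1: (ctr F @: X) = X.
Proof.
move=> h; apply/setP => v; rewrite inE; apply/imsetP/idP => [[w wX e]|vX]; last by exists v.
have [vF|vF] := boolP (v \in F); last by rewrite (ctr_out vF e).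
case: h => [/subsetP h|/pred0P h]; first exact: h.
have [wF|wF] := boolP (w \in F); first by have := h w; rewrite /= wF wX.
by rewrite -(ctr_out wF (esym e)).
Qed.

Lemma ctr_preim1 v : v \notin F -> ctr F @^-1: [set ctr F v] = [set v].
Proof.
move=> vF; apply/setP => w; rewrite !inE; apply/eqP/eqP => [e|->//].
exact/esym/(ctr_out vF).
Qed.

End Ctr.

Lemma perm_map_cons (T T' : eqType) (g : T -> T') l a l' :
  perm_eq (map g l) (a :: l') -> exists b l'', [/\ perm_eq l (b :: l''), g b = a
    & perm_eq (map g l'') l'].
Proof.
move=> h; have : a \in map g l by rewrite (perm_mem h) mem_head.
case/mapP => b bl e; exists b, (rem b l); split=> //; first exact: perm_to_rem.
rewrite -(perm_cons a) {1}e -map_cons perm_sym (perm_trans _ (perm_map g (perm_to_rem bl))) //.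
by rewrite perm_sym.
Qed.

Lemma count_gt1_perm (T : eqType) (p : pred T) l : 1 < count p l ->
  exists e1 e2 l', [/\ perm_eq l [:: e1, e2 & l'], p e1 & p e2].
Proof.
move=> h; have /hasP[e1 e1l p1] : has p l by rewrite has_count; lia.
have P1 := perm_to_rem e1l; move: h; rewrite (permP P1) /= p1 add1n ltnS => h.
have /hasP[e2 e2l p2] : has p (rem e1 l) by rewrite has_count.
exists e1, e2, (rem e2 (rem e1 l)); split=> //.
by rewrite (perm_trans P1) // perm_cons; apply: perm_to_rem.
Qed.

Definition edge_at (V : eqType) (z s : V) (e : V * V) :=
  (s != z) && ((e == (z, s)) || (e == (s, z))).

(** Replacing [zs] and [zu] by [su] lowers, by two, just the cuts with [s] and [u] on one side and
    [z] on the other. The strict bound by the successor is the room needed for this; complements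
    take care of sets containing [z]. *)
Definition splits_off (V : finType) (es : seq (V * V)) (U : {set V}) z s u :=
  forall X : {set V}, z \notin X -> s \in X -> u \in X ->
    (maxreq (lam es) U X).+1 < dcut es X.

(** Mader's splitting-off theorem: tight sets avoiding [z] can be contracted,
    since any set blocking a pair of edges at [z] uncrosses with them. *)
Lemma mader (n : nat) (V : finType) (es : seq (V * V)) (U : {set V}) (z : V) :
  #|V| <= n -> z \notin U -> (forall X, dcut es X <> 1) -> 1 < dcut es [set z] ->
  dcut es [set z] <> 3 ->
  exists s u e1 e2 es', [/\ perm_eq es [:: e1, e2 & es'], edge_at z s e1, edge_at z u e2
    & splits_off es U z s u].
Proof.
elim: n V es U z => [|n IHn] V es U z cV zU nb dz2 dz3.
  by move: cV; rewrite leqn0 => /eqP/card0_eq/(_ z).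
set R := maxreq (lam es) U.
have Rle X : R X <= dcut es X by exact: maxreq_lam_le.
have [/existsP[F /and3P[zF F1 tF]]|] :=
    boolP [exists F : {set V}, [&& z \notin F, 1 < #|F| & dcut es F <= R F]].
  set f := ctr F; set es' := map_edges f es; set U' := f @: U.
  have [||X|||s' [u' [e1' [e2' [l [P s1 s2 so]]]]]] := IHn _ es' U' (f z).
  - by rewrite card_contr; have := cardsC F; lia.
  - by apply/imsetP => -[w wU /(ctr_out zF) e]; rewrite e wU in zU.
  - by rewrite dcut_map; apply: nb.
  - by rewrite dcut_map ctr_preim1.
  - by rewrite dcut_map ctr_preim1.
  have [e1 [l1 [P1 g1 Pl1]]] := perm_map_cons P.
  have [e2 [l2 [P2 g2 Pl2]]] := perm_map_cons Pl1.
  have lift e x : edge_at (f z) x (map_edge f e) -> exists2 y, f y = x & edge_at z y e.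
    case: e => a b /andP[xz]; rewrite /map_edge /= !xpair_eqE.
    case/orP => /andP[/eqP h1 /eqP h2].
      exists b => //; have az : a = z by apply/esym/(ctr_out zF).
      rewrite /edge_at az eqxx andbT; apply: contra xz => /eqP<-; by rewrite h2.
    exists a => //; have bz : b = z by apply/esym/(ctr_out zF).
    rewrite /edge_at bz eqxx orbT andbT; apply: contra xz => /eqP<-; by rewrite h1.
  rewrite -g1 in s1; rewrite -g2 in s2.
  have [s es1 at1] := lift _ _ s1; have [u eu at2] := lift _ _ s2.
  exists s, u, e1, e2, l2; split=> //.
    by rewrite (perm_trans P1) // perm_cons.
  move=> X zX sX uX; rewrite ltnNge; apply/negP => dX; rewrite -/R in dX.
  (* A blocking set that contains [F] or misses it also blocks the pair in the contraction. *)
  have key (X' : {set V}) : F \subset X' \/ [disjoint F & X'] -> z \notin X' ->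
      s \in X' -> u \in X' -> dcut es X' <= (R X').+1 -> False.
    move=> sat zX' sX' uX' dX'.
    have pre := ctr_saturated sat.
    have := so (f @: X'); rewrite dcut_map pre -es1 -eu => /(_ _ _ _)/wrap[|||h].
    - by apply: contra zX' => h; rewrite -pre inE.
    - exact: imset_f.
    - exact: imset_f.
    have := @maxreq_map _ _ f es U (f @: X') id (fun _ _ h => h).
    rewrite pre -/R -/es' -/U' => h'.
    by move: h; rewrite ltnNge => /negP; apply; apply: leq_trans dX' _.
  have := dcut_submodI es X F; have := dcut_submodD es X F => eD eI.
  (* As [F] is tight, the union with [F] or the difference inherits the blocking inequality. In the
     second case no edge joins [z] to the common part, so [s] and [u] remain in the difference. *)
  have [h|h] := maxreq_skew U (lamC es) X F; rewrite -/R in h.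
    apply: (key (X :|: F)).
    - by left; apply: subsetUr.
    - by rewrite inE negb_or zX.
    - by rewrite inE sX.
    - by rewrite inE uX.
    - by have := Rle (X :&: F); nlia.
  have h1 := Rle (X :\: F); have h2 := Rle (F :\: X).
  have out : dbet es (X :&: F) (~: (X :|: F)) = 0 by nlia.
  have notF w e : edge_at z w e -> e \in es -> w \in X -> w \notin F.
    move=> /andP[_ we] ee wX; apply/negP => wF.
    have : 0 < dbet es (X :&: F) (~: (X :|: F)).
      apply: (@dbet_mem _ _ _ _ w z); rewrite ?inE ?wX ?negb_or ?zX //.
      by case/orP: we => /eqP <-; [right|left].
    by rewrite out.
  have m1 : e1 \in es by rewrite (perm_mem P1) mem_head.
  have m2 : e2 \in es by rewrite (perm_mem P1) inE (perm_mem P2) mem_head orbT.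
  apply: (key (X :\: F)).
  - by right; rewrite -setI_eq0; apply/eqP/setP => w; rewrite !inE; case: (w \in F).
  - by rewrite inE (negbTE zX) andbF.
  - by rewrite inE sX (notF s e1).
  - by rewrite inE uX (notF u e2).
  - by nlia.
move/existsPn => notight.
pose dang (X : {set V}) := (z \notin X) && (dcut es X <= (R X).+1).
have so s u : (forall X, dang X -> s \in X -> u \in X -> False) -> splits_off es U z s u.
  move=> h X zX sX uX; rewrite ltnNge; apply/negP => dX.
  by apply: (h X) => //; rewrite /dang zX.
have [/existsP[s /existsP[u /and4P[zs zu su /forallP h]]]|np1] :=
    boolP [exists s, exists u, [&& nbr es z s, nbr es z u, s != u &
      [forall X : {set V}, ~~ [&& dang X, s \in X & u \in X]]]].
  have at_ w : nbr es z w -> exists2 e, e \in es & edge_at z w e.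
    case/andP=> wz /orP[] h'; [exists (z, w)|exists (w, z)] => //;
    by rewrite /edge_at wz eqxx ?orbT.
  have [e1 m1 a1] := at_ _ zs; have [e2 m2 a2] := at_ _ zu.
  have e12 : e2 != e1.
    apply/eqP => e; move: a1 a2; rewrite e /edge_at.
    case/andP=> sz /orP[] /eqP-> /andP[uz]; rewrite !xpair_eqE.
      by rewrite eqxx (negbTE su) /= (negbTE sz) andbF.
    by rewrite eqxx (negbTE su) (negbTE sz).
  exists s, u, e1, e2, (rem e2 (rem e1 es)); split=> //.
    have P1 := perm_to_rem m1; rewrite (perm_trans P1) // perm_cons.
    apply: perm_to_rem; move: m2; rewrite (perm_mem P1) inE (negbTE e12) //.
  apply: so => X dX sX uX; by have := h X; rewrite dX sX uX.
have [/existsP[s /and3P[zs m2 /forallP h]]|np2] :=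
    boolP [exists s, [&& nbr es z s, 1 < dbet es [set z] [set s] &
      [forall X : {set V}, ~~ (dang X && (s \in X))]]].
  have [e1 [e2 [l [P l1 l2]]]] := count_gt1_perm m2.
  have sz : s != z by case/andP: zs.
  have at_ e : linking [set z] [set s] e -> edge_at z s e.
    by case: e => a b; rewrite /linking /edge_at sz /= !inE !xpair_eqE.
  exists s, s, e1, e2, l; split; rewrite ?at_ //.
  apply: so => X dX sX _; by have := h X; rewrite dX sX.
exfalso; apply: (@mader_core V es U z zU nb dz2 dz3).
- move=> F zF tF; rewrite leqNgt; apply/negP => F1.
  by have := notight F; rewrite zF F1 -/R /R -tF leqnn.
- move=> s u zs zu su; move/existsPn: np1 => /(_ s)/existsPn/(_ u).
  rewrite zs zu su /= negb_forall => /existsP[X]; rewrite negbK => /and3P[h1 h2 h3].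
  by exists X.
- move=> s zs ms; move/existsPn: np2 => /(_ s).
  rewrite zs ms /= negb_forall => /existsP[X]; rewrite negbK => /andP[h1 h2].
  by exists X.
Qed.

Lemma half_double_homo : {homo (fun n => n./2.*2) : m n / m <= n}.
Proof. by move=> m n mn; rewrite leq_double half_leq. Qed.

Lemma half_double_le n : n./2.*2 <= n.
Proof. by rewrite -{2}(odd_double_half n) leq_addl. Qed.

(** * Odd-vertex pairings *)

Section Pairing.
Variable V : finType.
Implicit Types (es M : seq (V * V)) (U X Y Z A B Q : {set V}) (x y z s u v w : V).

(** Even demands are what the rounded halves of the orientation theorem ask for, and evenness lets
    parity close gaps of one. *)
Definition ereq es U X := maxreq (fun x y => (lam es x y)./2.*2) U X.

Lemma ereqC es U X : ereq es U (~: X) = ereq es U X.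
Proof. by apply: maxreqC => x y; rewrite lamC. Qed.

Lemma ereq_le es U X : ereq es U X <= dcut es X.
Proof.
apply: maxreq_le => x y _ xX _ yX; apply: leq_trans (half_double_le _) _.
exact: lam_le.
Qed.

Lemma ereq_ge es U X x y : x \in U -> x \in X -> y \in U -> y \notin X ->
  (lam es x y)./2.*2 <= ereq es U X.
Proof. by move=> xU xX yU yX; apply: (maxreq_ge (fun x y => (lam es x y)./2.*2)). Qed.

Lemma ereq_att es U X : ereq es U X = 0 \/
  exists x y, [/\ x \in U, x \in X, y \in U, y \notin X & ereq es U X = (lam es x y)./2.*2].
Proof. exact: maxreq_att. Qed.

Lemma ereq_even es U X : odd (ereq es U X) = false.
Proof. by have [->|[x [y [_ _ _ _ ->]]]] := ereq_att es U X; rewrite ?odd_double. Qed.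

Lemma maxreq_eqU rho U X Y : U :&: X = U :&: Y -> maxreq rho U X = maxreq rho U Y.
Proof.
move=> e; have e' : U :\: X = U :\: Y.
  by apply/setP => w; move/setP/(_ w): e; rewrite !inE; case: (w \in U); rewrite ?andbF //= => ->.
by rewrite /maxreq e e'.
Qed.

Lemma ereqD1 es U A v : v \notin U -> ereq es U (A :\ v) = ereq es U A.
Proof.
move=> vU; apply: maxreq_eqU; apply/setP => w; rewrite !inE.
by case: eqP => [->|//]; rewrite (negbTE vU).
Qed.

(** An odd-vertex pairing in the sense of Nash-Williams, except that only the
    connectivities between terminals in [U] have to be respected. *)
Definition paired es U M := [/\ forall v, odd (dcut M [set v]) = odd (dcut es [set v]),
  forall v, dcut M [set v] <= 1 & forall X, dcut M X + ereq es U X <= dcut es X].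

Lemma dcut_splitD1 es A v : v \in A ->
  dcut es A + 2 * dbet es [set v] (A :\ v) = dcut es [set v] + dcut es (A :\ v).
Proof.
move=> vA; rewrite -{1}(setD1K vA); apply: dcutU_disj.
by rewrite disjoints1 !inE eqxx.
Qed.

Lemma dcut_D1_le M A v : dcut M A <= dcut M [set v] + dcut M (A :\ v).
Proof.
case vA: (v \in A); first by have := dcut_splitD1 M vA; nlia.
by rewrite (setDidPl _) ?leq_addl // disjoint_sym disjoints1 vA.
Qed.

Lemma cut_parity M es :
  (forall v, odd (dcut M [set v]) = odd (dcut es [set v])) ->
  forall X, odd (dcut M X) = odd (dcut es X).
Proof.
move=> h X; have [n] := ubnP #|X|; elim: n X => // n IHn X.
have [->|[v vX]] := set_0Vmem X; first by rewrite !dcut0.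
rewrite (cardsD1 v) vX => /IHn IH.
have := dcut_splitD1 M vX; have := dcut_splitD1 es vX.
move=> /(congr1 odd) e1 /(congr1 odd) e2; move: e1 e2.
rewrite !mul2n !oddD !odd_double !addbF => -> ->.
by rewrite h IH.
Qed.

Lemma sep_edge_at X v a e : edge_at v a e -> sep X e = sep X (v, a).
Proof.
by case: e => p q /andP[_ /orP[] /eqP[-> ->]] //; rewrite /sep /= eq_sym.
Qed.

Lemma sep_set1_edge_at v e : sep [set v] e -> exists a, edge_at v a e.
Proof.
case: e => p q; rewrite /sep /= !inE.
case: (eqVneq p v) => [->|pv]; case: (eqVneq q v) => [->|qv] //= _.
  by exists q; rewrite /edge_at qv eqxx.
by exists p; rewrite /edge_at pv eqxx orbT.
Qed.

Lemma sep_split X v a b : sep X (a, b) = sep X (v, a) (+) sep X (v, b).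
Proof. by rewrite /sep /=; case: (a \in X); case: (b \in X); case: (v \in X). Qed.

(** Two pairing edges [va] and [vb] merge into [ab], which keeps the parity of every cut and raises
    none. So degrees at most one come for free. *)
Lemma normalize_pairing M : exists M', [/\ forall v, dcut M' [set v] <= 1,
  forall X, odd (dcut M' X) = odd (dcut M X) & forall X, dcut M' X <= dcut M X].
Proof.
have [n] := ubnP (size M); elim: n M => // n IHn M sM.
have [/forallP h|/forallPn[v]] := boolP [forall v, dcut M [set v] <= 1]; first by exists M.
rewrite -ltnNge => /count_gt1_perm[e1 [e2 [l [P s1 s2]]]].
have [a ha] := sep_set1_edge_at s1; have [b hb] := sep_set1_edge_at s2.
have sl : size ((a, b) :: l) < n by move: sM; rewrite (perm_size P) /=.
have [M' [h1 h2 h3]] := IHn _ sl.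
have dM X : dcut M X = sep X (v, a) + (sep X (v, b) + dcut l X).
  by rewrite (dcut_perm _ P) /dcut /= (sep_edge_at _ ha) (sep_edge_at _ hb).
exists M'; split=> // X.
  rewrite h2 dM /dcut /= !oddD (sep_split X v) addbA !oddb; congr (_ (+) _).
apply: leq_trans (h3 X) _; rewrite dM /dcut /= (sep_split X v).
by case: (sep X (v, a)); case: (sep X (v, b)) => /=; lia.
Qed.

(** The edge moves from the graph into the pairing, which adds [sep X e] to both sides of each cut
    inequality. The demands do not fall with its deletion because every cut through [e] has room. *)
Lemma paired_del es U e M' : e \in es ->
  (forall X, sep X e -> ereq es U X < dcut es X) ->
  paired (rem e es) U M' -> exists M, paired es U M.
Proof.
move=> ees he [m1 m2 m3]; have P := perm_to_rem ees.
have dE X : dcut es X = sep X e + dcut (rem e es) X by rewrite (dcut_perm _ P).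
have rE X : ereq es U X <= ereq (rem e es) U X.
  apply: maxreq_le => x y xU xX yU yX.
  apply: leq_trans (ereq_ge _ xU xX yU yX).
  have xy : x != y by apply: contraNneq yX => <-.
  rewrite -{1}[(lam es x y)./2]doubleK; apply: half_double_homo.
  apply: lam_ge => // Y xY yY; have := ereq_ge es xU xY yU yY.
  by case sY: (sep Y e); have := dE Y; [have := he _ sY|have := ereq_le es U Y]; rewrite sY; nlia.
have [M [n1 n2 n3]] := normalize_pairing (e :: M').
exists M; split=> [v||X] //.
  by rewrite n2 dE /dcut /= !oddD -/(dcut _ _) m1.
have := n3 X; rewrite {1}/dcut /= -/(dcut _ _) => h1.
by have := m3 X; have := rE X; have := dE X; nlia.
Qed.

(** Splitting off changes each cut by zero or two, which keeps parities, and it lowers no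
    connectivity within [U]. *)
Lemma paired_split es U z s u e1 e2 es' M : z \notin U ->
  perm_eq es [:: e1, e2 & es'] -> edge_at z s e1 -> edge_at z u e2 ->
  splits_off es U z s u -> paired ((s, u) :: es') U M -> paired es U M.
Proof.
move=> zU P at1 at2 so [m1 m2 m3].
have dE X : dcut es X = sep X (z, s) + (sep X (z, u) + dcut es' X).
  by rewrite (dcut_perm _ P) /dcut /= (sep_edge_at _ at1) (sep_edge_at _ at2).
have dE' X : dcut ((s, u) :: es') X = (sep X (z, s) (+) sep X (z, u)) + dcut es' X.
  by rewrite -sep_split.
have le X : maxreq (lam es) U X <= dcut ((s, u) :: es') X.
  have h0 := maxreq_lam_le es U X.
  rewrite dE'; case s1: (sep X (z, s)); case s2: (sep X (z, u));
    have := dE X; rewrite s1 s2 /=; try by nlia.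
  move: s1 s2; rewrite /sep /=.
  case zX: (z \in X) => /= sX uX.
    have h : (maxreq (lam es) U (~: X)).+1 < dcut es (~: X).
      by apply: so; rewrite !inE ?zX //; move: sX uX; case: (s \in X); case: (u \in X).
    by move: h; rewrite dcutC maxreqC; [nlia|exact: lamC].
  have h : (maxreq (lam es) U X).+1 < dcut es X.
    by apply: so; rewrite ?zX //; move: sX uX; case: (s \in X); case: (u \in X).
  by nlia.
have lle x y : x \in U -> y \in U -> x != y -> lam es x y <= lam ((s, u) :: es') x y.
  move=> xU yU xy; apply: lam_ge => // Y xY yY; apply: leq_trans (le Y).
  exact: maxreq_ge.
split=> [v||X] //.
  rewrite m1 dE dE' !oddD addbA; congr (_ (+) _).
  by case: (sep _ (z, s)); case: (sep _ (z, u)).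
have : ereq es U X <= ereq ((s, u) :: es') U X.
  apply: maxreq_le => x y xU xX yU yX; apply: leq_trans (ereq_ge _ xU xX yU yX).
  by apply/half_double_homo/lle => //; apply: contraNneq yX => <-.
have := m3 X; have := dE X; have := dE' X.
by case: (sep X (z, s)); case: (sep X (z, u)) => /=; nlia.
Qed.

(** The situation that splitting off cannot reduce, as degree three is the exception in Mader's
    theorem. *)
Definition cubic_rest es U := forall v, v \notin U ->
  dcut es [set v] = 3 /\ forall s, nbr es v s -> s \in U.

(** Every non-terminal has a majority of its three edges on its own side, so moving it across does
    not lower the cut. *)
Definition aligned es U A := forall v, v \notin U ->
  (v \in A -> 1 < dbet es [set v] (A :\ v)) /\
  (v \notin A -> 1 < dbet es [set v] (~: A :\ v)).

Lemma alignedC es U A : aligned es U A -> aligned es U (~: A).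
Proof.
move=> h v vU; have [h1 h2] := h v vU; split; rewrite inE // negbK => vA.
by rewrite setCK; apply: h1.
Qed.

Lemma alignedP es U A : cubic_rest es U ->
  (forall v, v \notin U -> v \in A -> dcut es A <= dcut es (A :\ v)) ->
  (forall v, v \notin U -> v \notin A -> dcut es A <= dcut es (~: A :\ v)) ->
  aligned es U A.
Proof.
move=> cub h1 h2 v vU; have [d3 _] := cub v vU; split=> vA.
  by have := h1 v vU vA; have := dcut_splitD1 es vA; nlia.
have vA' : v \in ~: A by rewrite inE.
by have := h2 v vU vA; have := dcut_splitD1 es vA'; rewrite dcutC; nlia.
Qed.

(** Two majorities among three edges at [v] share an edge, and its other end is a terminal. *)
Lemma aligned_terminal es U A B v : cubic_rest es U -> aligned es U A -> aligned es U B ->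
  v \in A -> v \in B -> exists w, [/\ w \in U, w \in A & w \in B].
Proof.
move=> cub hA hB vA vB; have [vU|vU] := boolP (v \in U); first by exists v.
have [d3 nb] := cub v vU; have hA1 := (hA v vU).1 vA; have hB1 := (hB v vU).1 vB.
have : dbet es [set v] (A :\ v) + dbet es [set v] (B :\ v)
    <= dbet es [set v] (~: [set v]) + dbet es [set v] ((A :&: B) :\ v).
  rewrite /dbet; elim: (es) => [|[a b] l] //=; rewrite /linking /= !inE.
  case: (a == v); case: (b == v); case: (a \in A); case: (b \in A); case: (a \in B);
  case: (b \in B) => /=; lia.
rewrite dbet_setC d3 => h.
have [||w wAB vw] := @dbet_nbr _ es v ((A :&: B) :\ v); first by rewrite !inE eqxx.
  by nlia.
move: wAB; rewrite !inE => /and3P[_ wA wB].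
by exists w; split=> //; apply: nb.
Qed.

(** Take a violator with the smallest cut. If moving a non-terminal across lowered the cut, the new
    set would still be a violator: its demand is unchanged and the pairing loses at most one
    edge. *)
Lemma min_violator es U M : cubic_rest es U -> (forall v, dcut M [set v] <= 1) ->
  ~ (forall X, dcut M X + ereq es U X <= dcut es X) ->
  exists2 Z, dcut es Z < dcut M Z + ereq es U Z & aligned es U Z.
Proof.
move=> cub m2; pose viol Z := dcut es Z < dcut M Z + ereq es U Z.
have [/existsP[Z0 v0] _|] := boolP [exists Z, viol Z]; last first.
  by move=> /existsPn h []; move=> X; have := h X; rewrite /viol -leqNgt.
have [Z vZ minZ] := @arg_minnP _ Z0 viol (dcut es) v0.
exists Z => //; apply: alignedP => // v vU vZ'; rewrite leqNgt; apply/negP => lt.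
  have : ~~ viol (Z :\ v) by apply: contraL lt => /minZ; rewrite -leqNgt.
  rewrite /viol -leqNgt ereqD1 // => h.
  by have := dcut_D1_le M Z v; have := m2 v; move: vZ; rewrite /viol => h1; nlia.
have : ~~ viol (~: Z :\ v) by apply: contraL lt => /minZ; rewrite -leqNgt.
rewrite /viol -leqNgt ereqD1 // ereqC => h.
have := dcut_D1_le M (~: Z) v; rewrite dcutC; have := m2 v; move: vZ; rewrite /viol => h1.
by nlia.
Qed.

Lemma dbet2_le_dcut M X Z :
  dbet M (X :\: Z) (Z :\: X) + dbet M (X :&: Z) (~: (X :|: Z)) <= dcut M X.
Proof.
rewrite /dbet /dcut; elim: M => [|[a b] l] //=; rewrite /linking /sep /= !inE.
by case: (a \in X); case: (b \in X); case: (a \in Z); case: (b \in Z) => /=; lia.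
Qed.

Lemma dbet_ends M A B : 0 < dbet M A B -> (exists a, a \in A) /\ (exists b, b \in B).
Proof.
rewrite -has_count => /hasP[[a b] _]; rewrite /linking /= => /orP[] /andP[h1 h2].
  by split; [exists a|exists b].
by split; [exists b|exists a].
Qed.

(** If [X] is tight, no pairing edge crosses it and every [Z] can be uncrossed with it. If the cut
    exceeds the demand by one, a single pairing edge crosses [X] and may spoil this. An aligned
    violator then has terminals in both corners joined by that edge, and as the demand of [X] is
    least among pairs of terminals, the demands uncross along just these corners. *)
Lemma glue_feasible es U M X :
  (forall v, odd (dcut M [set v]) = odd (dcut es [set v])) ->
  (forall v, dcut M [set v] <= 1) ->
  (forall Q, Q \subset X \/ Q \subset ~: X -> dcut M Q + ereq es U Q <= dcut es Q) ->
  dcut es X <= (ereq es U X).+1 ->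
  (dcut es X <= ereq es U X \/
   [/\ cubic_rest es U, aligned es U X &
      forall x y, x \in U -> y \in U -> x != y -> ereq es U X <= (lam es x y)./2.*2]) ->
  forall Z, dcut M Z + ereq es U Z <= dcut es Z.
Proof.
move=> par m2 side b1 hyp.
have sX := side X (or_introl (subxx X)).
have q1 Z := side (X :&: Z) (or_introl (subsetIl X Z)).
have q2 Z := side (X :\: Z) (or_introl (subsetDl X Z)).
have q3 Z : dcut M (Z :\: X) + ereq es U (Z :\: X) <= dcut es (Z :\: X).
  by apply: side; right; apply/subsetP => w; rewrite !inE => /andP[].
have q4 Z : dcut M (X :|: Z) + ereq es U (X :|: Z) <= dcut es (X :|: Z).
  by have := side (~: (X :|: Z)); rewrite !dcutC ereqC; apply; right; rewrite setCS subsetUl.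
have uncr Z : dbet M (X :\: Z) (Z :\: X) = 0 -> dbet M (X :&: Z) (~: (X :|: Z)) = 0 ->
    dcut M X + ereq es U X = dcut es X -> dcut M Z + ereq es U Z <= dcut es Z.
  move=> b23 b14 eX.
  have := dcut_submodI M X Z; have := dcut_submodD M X Z.
  have := dcut_submodI es X Z; have := dcut_submodD es X Z => e1 e2 e3 e4.
  have := q1 Z; have := q2 Z; have := q3 Z; have := q4 Z => g1 g2 g3 g4.
  have rhoC x y : (lam es x y)./2.*2 = (lam es y x)./2.*2 by rewrite lamC.
  have [h|h] := maxreq_skew U rhoC X Z; rewrite -!/(ereq _ _ _) in h; nlia.
have [tX Z|nt] := leqP (dcut es X) (ereq es U X).
  have := dbet2_le_dcut M X Z => h.
  by apply: uncr; nlia.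
case: hyp => [h|[cub alX rmin]]; first by nlia.
(* The demand is even, so the cut is odd, and by parity some pairing edge crosses it. *)
have eX : dcut M X + ereq es U X = dcut es X.
  have := cut_parity par X; have ev := ereq_even es U X.
  have -> : dcut es X = (ereq es U X).+1 by nlia.
  rewrite /= ev => o; have : 0 < dcut M X by case: (dcut M X) o.
  by nlia.
have dMX : dcut M X = 1 by nlia.
have claim Y a b : a \in U -> b \in U -> a \in X :\: Y -> b \in Y :\: X ->
    ereq es U X + ereq es U Y <= ereq es U (X :\: Y) + ereq es U (Y :\: X).
  rewrite !inE => aU bU /andP[aY aX] /andP[bX bY].
  have ab : a != b by apply: contraNneq bX => <-.
  have r2 : ereq es U X <= ereq es U (X :\: Y).
    by apply: leq_trans (rmin a b aU bU ab) _; apply: ereq_ge; rewrite ?inE ?aY ?bY.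
  have r3 : ereq es U X <= ereq es U (Y :\: X).
    rewrite eq_sym in ab.
    by apply: leq_trans (rmin b a bU aU ab) _; apply: ereq_ge; rewrite ?inE ?bX ?aX.
  have [->|[p [q [pU pY qU qY eY]]]] := ereq_att es U Y; first by nlia.
  have [le|gt] := leqP (ereq es U Y) (ereq es U X); first by nlia.
  case pX: (p \in X); case qX: (q \in X).
  - have : (lam es q p)./2.*2 <= ereq es U (X :\: Y) by apply: ereq_ge; rewrite ?inE ?qY ?pY.
    by rewrite lamC -eY; nlia.
  - by have := ereq_ge es pU pX qU (negbT qX); rewrite -eY leqNgt gt.
  - by have := ereq_ge es qU qX pU (negbT pX); rewrite lamC -eY leqNgt gt.
  - have : (lam es p q)./2.*2 <= ereq es U (Y :\: X).
      by apply: ereq_ge; rewrite ?inE ?pX ?pY ?(negbTE qY) ?andbF.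
    by rewrite -eY; nlia.
have [/forallP//|nv] := boolP [forall Z, dcut M Z + ereq es U Z <= dcut es Z].
have [|Z vZ alZ] := min_violator cub m2; first by move=> h; case/negP: nv; apply/forallP.
exfalso; move: vZ; rewrite ltnNge => /negP; apply.
have bsum := dbet2_le_dcut M X Z.
have [b23|b23] := posnP (dbet M (X :\: Z) (Z :\: X)); last first.
  have [[a aP] [b bP]] := dbet_ends b23; move: (aP) (bP); rewrite !inE.
  move=> /andP[aZ aX] /andP[bX bZ].
  have [|t2 [t2U t2X t2Z]] := aligned_terminal cub alX (alignedC alZ) aX; first by rewrite inE.
  have [|t3 [t3U t3Z t3X]] := aligned_terminal cub alZ (alignedC alX) bZ; first by rewrite inE.
  rewrite inE in t2Z; rewrite inE in t3X.
  have := claim Z t2 t3 t2U t3U; rewrite !inE t2Z t2X t3X t3Z => /(_ isT isT) cl.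
  have := dcut_submodD M X Z; have := dcut_submodD es X Z; have := q2 Z; have := q3 Z.
  by nlia.
have [b14|b14] := posnP (dbet M (X :&: Z) (~: (X :|: Z))); first by apply: uncr.
have [[a aP] [b bP]] := dbet_ends b14; move: (aP) (bP); rewrite !inE negb_or.
move=> /andP[aX aZ] /andP[bX bZ].
have [t1 [t1U t1X t1Z]] := aligned_terminal cub alX alZ aX aZ.
have [||t4 [t4U t4X t4Z]] := @aligned_terminal es U (~: X) (~: Z) b cub (alignedC alX) (alignedC alZ);
  rewrite ?inE //.
rewrite inE in t4X; rewrite inE in t4Z.
have := claim (~: Z) t1 t4 t1U t4U; rewrite !inE t1Z t1X t4X t4Z => /(_ isT isT).
have -> : X :\: ~: Z = X :&: Z by rewrite setDE setCK.
have -> : ~: Z :\: X = ~: (X :|: Z) by rewrite setDE setCU setIC.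
rewrite !ereqC => cl.
have := dcut_submodI M X Z; have := dcut_submodI es X Z; have := q1 Z; have := q4 Z.
by nlia.
Qed.

(** Only demands caused by [x] alone get lost, so an aligned violator has [x] as its only terminal.
    A further vertex in it would send two edges to [x], and adding it to [{x}] would give a cut
    below the demand of [x]. At [{x}] itself parity decides. *)
Lemma paired_drop es U M x y0 : cubic_rest es U ->
  (forall v s, v \notin U -> nbr es v s -> dcut es [set s] = ereq es U [set s]) ->
  x \in U -> y0 \in U -> x != y0 -> dcut es [set x] = lam es x y0 ->
  (forall a b, a \in U -> b \in U -> a != b -> lam es x y0 <= lam es a b) ->
  paired es (U :\ x) M -> paired es U M.
Proof.
move=> cub tight xU y0U xy0 dx lmin [m1 m2 m3]; split=> // X0.
have [/forallP//|nv] := boolP [forall Z, dcut M Z + ereq es U Z <= dcut es Z].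
have [|Z1 vZ1 alZ1] := min_violator cub m2; first by move=> h; case/negP: nv; apply/forallP.
have [Z [vZ alZ xZ]] : exists Z,
    [/\ dcut es Z < dcut M Z + ereq es U Z, aligned es U Z & x \in Z].
  case xZ: (x \in Z1); first by exists Z1.
  exists (~: Z1); rewrite !dcutC ereqC inE xZ; split=> //; exact: alignedC.
exfalso; move: vZ; rewrite ltnNge => /negP; apply.
have [lt|ge] := ltnP (ereq es (U :\ x) Z) (ereq es U Z); last by have := m3 Z; nlia.
have [e|[p [q [pU pZ qU qZ eZ]]]] := ereq_att es U Z; first by rewrite e in lt.
have qx : q != x by apply: contraNneq qZ => ->.
have px : p = x.
  apply/eqP/negPn/negP => px; move: lt; rewrite eZ ltnNge => /negP; apply.
  by apply: ereq_ge; rewrite ?inE ?px ?qx.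
subst p.
have ZU a : a \in Z -> a \in U -> a = x.
  move=> aZ aU; apply/eqP/negPn/negP => ax; move: lt; rewrite ltnNge => /negP; apply.
  apply: (@leq_trans ((lam es a q)./2.*2)); last by apply: ereq_ge; rewrite ?inE ?ax ?qx.
  rewrite eZ; apply: half_double_homo; apply: (@leq_trans (lam es x y0)).
    by rewrite -dx; apply: lam_le; rewrite inE.
  by apply: lmin => //; apply: contraNneq qZ => <-.
have ZE : Z = [set x].
  apply/eqP; rewrite eqEsubset sub1set xZ andbT; apply/subsetP => v vZ; rewrite inE.
  have [vU|vU] := boolP (v \in U); first by rewrite (ZU v).
  exfalso; have [d3 nb] := cub v vU; have h2 := (alZ v vU).1 vZ.
  have vx : v != x by apply: contraNneq vU => ->.
  have ev : dbet es [set v] (Z :\ v) = dbet es [set v] [set x].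
    have [h|h] := posnP (dbet es [set v] (Z :\ v :\ x)).
      have -> : Z :\ v = [set x] :|: (Z :\ v :\ x) by rewrite setD1K // !inE eq_sym vx.
      by rewrite dbetU ?disjoints1 ?inE ?eqxx ?andbF // h addn0.
    have [|w] := dbet_nbr _ h; first by rewrite !inE eqxx andbF.
    rewrite !inE => /and3P[wx wv wZ] vw.
    by rewrite (ZU w wZ (nb w vw)) eqxx in wx.
  have zx : nbr es v x.
    have [||w] := @dbet_nbr _ es v [set x]; last by rewrite inE => /eqP->.
    - by rewrite inE.
    - by rewrite -ev; nlia.
  have tx := tight v x vU zx.
  have := @dcutU_disj _ es [set v] [set x]; rewrite disjoints1 inE => /(_ vx) eU.
  have [e0|[a [q' [aU]]]] := ereq_att es U [set x]; first by nlia.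
  rewrite inE => /eqP-> q'U; rewrite inE => q'x eq'.
  have : lam es x q' <= dcut es ([set v] :|: [set x]).
    apply: lam_le; rewrite !inE ?eqxx ?orbT // negb_or q'x andbT.
    by apply: contraNneq vU => <-.
  have := half_double_le (lam es x q'); nlia.
rewrite ZE; have := m1 x; have := m2 x; have := ereq_even es U [set x].
have := ereq_le es U [set x].
case: (dcut M [set x]) => [|[|//]] le ev _ par; first by [].
rewrite add1n ltn_neqAle le andbT; apply/eqP => e.
by move: par; rewrite -e ev.
Qed.

End Pairing.

(** * Gluing pairings along a cut *)

Lemma ereq_map (V V' : finType) (f : V -> V') (es : seq (V * V)) (U : {set V})
  (Z : {set V'}) :
  ereq es U (f @^-1: Z) <= ereq (map_edges f es) (f @: U) Z.
Proof. exact: maxreq_map half_double_homo. Qed.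

Section Glue.
Variables (V : finType) (es : seq (V * V)) (U X : {set V}).
Let f1 := ctr X.
Let f2 := ctr (~: X).

(** By parity both pairings have the same number of edges, at most one, at the contracted vertex.
    These two are fused: the edge of [M1] is redirected to the end [w] in [X] of the edge of [M2],
    and the latter is dropped. *)
Lemma glue_pairing M1 M2 x0 : x0 \in X ->
  paired (map_edges f1 es) (f1 @: U) M1 -> paired (map_edges f2 es) (f2 @: U) M2 ->
  exists M, [/\ forall v, odd (dcut M [set v]) = odd (dcut es [set v]),
    forall v, dcut M [set v] <= 1 &
    forall Q : {set V}, Q \subset X \/ Q \subset ~: X -> dcut M Q + ereq es U Q <= dcut es Q].
Proof.
move=> x0X [a1 a2 a3] [b1 b2 b3].
have f1X : f1 @^-1: [set None] = X.
  apply/setP => v; rewrite !inE; have [vX|vX] := boolP (v \in X); first by rewrite /f1 ctr_in.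
  by rewrite /f1 /ctr insubT.
have f2X : f2 @^-1: [set None] = ~: X.
  apply/setP => v; rewrite !inE; have [vX|vX] := boolP (v \in X); last by rewrite /f2 ctr_in ?inE ?vX.
  by rewrite /f2 /ctr insubT // inE negbK.
have c12 : dcut M1 [set None] = dcut M2 [set None].
  have := a1 None; have := b1 None; rewrite !dcut_map f1X f2X dcutC => <-.
  by have := a2 None; have := b2 None; case: (dcut M1 _) => [|[]//]; case: (dcut M2 _) => [|[]].
have f2E v (vX : v \in X) : exists2 b : {b | b \notin ~: X}, f2 v = Some b & val b = v.
  have vX' : v \notin ~: X by rewrite inE negbK.
  by exists (Sub v vX'); rewrite /f2 /ctr ?insubT ?SubK.
have [w wX Hw] : exists2 w, w \in X & forall Q : {set contr (~: X)}, None \notin Q ->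
    count (fun e => sep Q e && sep [set None] e) M2
    = if f2 w \in Q then dcut M2 [set None] else 0.
  have [c0|c0] := posnP (dcut M2 [set None]).
    exists x0 => // Q _; rewrite c0 if_same; apply/eqP; rewrite -leqn0 -c0.
    by apply: sub_count => e /andP[].
  have /hasP[e eM se] : has (sep [set None]) M2 by rewrite has_count.
  have P := perm_to_rem eM.
  have cl : count (sep [set None]) (rem e M2) = 0.
    have := b2 None; rewrite /dcut (permP P) /= se add1n ltnS leqn0 => /eqP//.
  have [a /andP[aN ha]] := sep_set1_edge_at se; case: a aN ha => // a _ ha.
  have aX : val a \in X by have := valP a; rewrite inE negbK.
  have fa : f2 (val a) = Some a.
    have [b -> eb] := f2E _ aX; by congr Some; apply: val_inj.
  exists (val a) => // Q NQ; rewrite (permP P) /= se andbT fa.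
  have -> : count (fun e => sep Q e && sep [set None] e) (rem e M2) = 0.
    by apply/eqP; rewrite -leqn0 -cl; apply: sub_count => e' /andP[].
  have -> : dcut M2 [set None] = 1.
    by apply/eqP; rewrite eqn_leq c0 b2.
  rewrite addn0; case/orP: ha => /eqP->; rewrite /sep /= (negbTE NQ);
  by case: (Some a \in Q).
pose g1 (o : contr X) := if o is Some a then val a else w.
pose g2 (o : contr (~: X)) := if o is Some b then val b else x0.
pose M2' := [seq e <- M2 | ~~ sep [set None] e].
pose M := map_edges g1 M1 ++ map_edges g2 M2'.
have dM (Q : {set V}) : dcut M Q = dcut M1 (g1 @^-1: Q) + dcut M2' (g2 @^-1: Q).
  by rewrite dcut_cat !dcut_map.
have g2X o : g2 o \in X by case: o => [b|] //=; have := valP b; rewrite inE negbK.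
have out (Q : {set V}) : Q \subset ~: X -> dcut M Q = dcut M1 (f1 @: Q).
  move=> /subsetP QX; rewrite dM.
  have -> : g2 @^-1: Q = set0.
    by apply/setP => o; rewrite !inE; apply/negP => /QX; rewrite inE g2X.
  rewrite dcut0 addn0; congr dcut; apply/setP => o; rewrite inE.
  apply/idP/imsetP => [oQ|[v vQ ->]].
    exists (g1 o) => //; case: o oQ => [a|] /=; first by rewrite /f1 /ctr valK.
    by move=> /QX; rewrite inE wX.
  have := QX _ vQ; rewrite inE => vX; by rewrite /f1 /ctr insubT /=.
have inn (Q : {set V}) : Q \subset X -> dcut M Q = dcut M2 (f2 @: Q).
  move=> /subsetP QX; rewrite dM.
  have NQ : None \notin f2 @: Q.
    by apply/imsetP => -[v /QX vX]; have [b ->] := f2E v vX.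
  have memQ v : v \in X -> (f2 v \in f2 @: Q) = (v \in Q).
    move=> vX; apply/imsetP/idP => [[v' v'Q]|vQ]; last by exists v.
    by move=> /ctr_out -> //; rewrite inE negbK.
  have -> : dcut M1 (g1 @^-1: Q) = if w \in Q then dcut M1 [set None] else 0.
    have g1S a : (g1 (Some a) \in Q) = false.
      by apply/negP => /QX; apply/negP; apply: (valP a).
    case wQ: (w \in Q); last first.
      have -> : g1 @^-1: Q = set0; last by rewrite dcut0.
      by apply/setP => -[a|]; rewrite !inE ?g1S.
    congr dcut; apply/setP => -[a|]; rewrite !inE ?g1S //.
  have -> : dcut M2' (g2 @^-1: Q)
      = count (fun e => sep (f2 @: Q) e && ~~ sep [set None] e) M2.
    rewrite /dcut count_filter; apply: eq_in_count => -[p q] _ /=.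
    case sN: (sep [set None] (p, q)); rewrite ?andbF ?andbT //.
    have gS (b : {b | b \notin ~: X}) : (Some b \in f2 @: Q) = (val b \in Q).
      have bX : val b \in X by have := valP b; rewrite inE negbK.
      rewrite -memQ //; have [b' -> /val_inj->] := f2E _ bX; by [].
    move: sN; rewrite /sep /= !inE.
    by case: p => [p|]; case: q => [q|] //= _; rewrite ?gS ?eqxx.
  rewrite c12 [RHS]/dcut.
  have -> : count (sep (f2 @: Q)) M2 = count (fun e => sep (f2 @: Q) e && sep [set None] e) M2
      + count (fun e => sep (f2 @: Q) e && ~~ sep [set None] e) M2.
    elim: (M2) => //= e l ->; by case: (sep _ e); case: (sep _ e) => /=; lia.
  by rewrite Hw // memQ.
have sat1 (Q : {set V}) : Q \subset ~: X -> f1 @^-1: (f1 @: Q) = Q.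
  by move=> QX; apply: ctr_saturated; right; rewrite disjoint_sym -[X]setCK -subsets_disjoint.
have sat2 (Q : {set V}) : Q \subset X -> f2 @^-1: (f2 @: Q) = Q.
  by move=> QX; apply: ctr_saturated; right; rewrite disjoint_sym -subsets_disjoint.
have sing v : ([set v] \subset X) || ([set v] \subset ~: X).
  by rewrite !sub1set inE; case: (v \in X).
exists M; split.
- move=> v; case/orP: (sing v) => h.
    by rewrite inn // imset_set1 b1 dcut_map -imset_set1 sat2.
  by rewrite out // imset_set1 a1 dcut_map -imset_set1 sat1.
- move=> v; case/orP: (sing v) => h; first by rewrite inn // imset_set1.
  by rewrite out // imset_set1.
- move=> Q [] h.
    rewrite inn //; have := b3 (f2 @: Q); rewrite dcut_map sat2 //.
    by have := ereq_map f2 es U (f2 @: Q); rewrite sat2 //; nlia.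
  rewrite out //; have := a3 (f1 @: Q); rewrite dcut_map sat1 //.
  by have := ereq_map f1 es U (f1 @: Q); rewrite sat1 //; nlia.
Qed.

End Glue.

Section Isolated.
Variables (V : finType) (es : seq (V * V)) (U : {set V}) (z y : V).

Lemma dcut_isolated (A : {set V}) : dcut es [set z] = 0 -> dcut es (A :\ z) = dcut es A.
Proof.
move=> dz; case zA: (z \in A); last first.
  by rewrite (setDidPl _) // disjoint_sym disjoints1 zA.
have := dcut_splitD1 es zA.
have : dbet es [set z] (A :\ z) <= dbet es [set z] (~: [set z]).
  by apply: dbet_subset; apply/subsetP => w; rewrite !inE => /andP[].
by rewrite dbet_setC dz; nlia.
Qed.

(** Merging an isolated non-terminal with any other vertex makes the induction measure drop. *)
Lemma paired_isolated M' : z \notin U -> dcut es [set z] = 0 -> y != z ->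
  paired (map_edges (ctr [set z; y]) es) (ctr [set z; y] @: U) M' ->
  exists M, paired es U M.
Proof.
move=> zU dz yz; set F := [set z; y]; set f := ctr F => -[m1 m2 m3].
pose g (o : contr F) := if o is Some a then val a else y.
have zF : z \in F by rewrite !inE eqxx.
have yF : y \in F by rewrite !inE eqxx orbT.
have gf v : v != z -> g (f v) = v.
  move=> vz; have [vF|vF] := boolP (v \in F); last by rewrite /f /ctr insubT.
  by rewrite /f ctr_in //=; move: vF; rewrite !inE (negbTE vz) => /eqP.
have fg o : f (g o) = o.
  by case: o => [a|] /=; [rewrite /f /ctr valK|rewrite /f ctr_in].
have al (A : {set V}) : f @^-1: (g @^-1: A) :\ z = A :\ z.
  by apply/setP => v; rewrite !inE; case: eqP => // /eqP vz; rewrite gf.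
have dal (A : {set V}) : dcut (map_edges f es) (g @^-1: A) = dcut es A.
  by rewrite dcut_map -dcut_isolated // al dcut_isolated.
exists (map_edges g M'); split.
- by move=> v; rewrite dcut_map (cut_parity m1) dal.
- move=> v; rewrite dcut_map; have [->|vz] := eqVneq v z.
    have -> : g @^-1: [set z] = set0; last by rewrite dcut0.
    apply/setP => o; rewrite !inE; apply/eqP => h; have := fg o; rewrite h /f ctr_in // => e.
    by move: h yz; rewrite -e /= => ->; rewrite eqxx.
  have -> : g @^-1: [set v] = [set f v] by apply/setP => o; rewrite !inE; apply/eqP/eqP => [<-|->]; rewrite ?fg ?gf.
  exact: m2.
- move=> A; rewrite dcut_map; have := m3 (g @^-1: A); rewrite dal.
  have := ereq_map f es U (g @^-1: A).
  by rewrite -(ereqD1 _ _ zU) al (ereqD1 _ _ zU); nlia.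
Qed.

End Isolated.

(** Once no edge can be deleted and no tight cut has two vertices on both sides, every edge has a
    tight end. Splitting off then leaves non-terminals of degree three only. Finally a minimum cut
    between the two least connected terminals is glued along or, if it isolates one of them, that
    terminal is dropped; this is why the measure counts terminals. *)
Lemma odd_vertex_pairing_rec (n : nat) (V : finType) (es : seq (V * V)) (U : {set V}) :
  #|V| + size es + #|U| <= n -> exists M, paired es U M.
Proof.
elim: n V es U => [|n IHn] V es U.
  rewrite leqn0 !addn_eq0 => /andP[/andP[/eqP c0 /eqP/size0nil->] _].
  by exists [::]; split=> // X; apply: (ereq_le [::]).
move=> mu.
have [/hasP[e ees /forallP he]|nodel] :=
    boolP (has (fun e => [forall X : {set V}, sep X e ==> (ereq es U X < dcut es X)]) es).
  have [|M' pM'] := IHn V (rem e es) U.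
    by move: mu; rewrite (perm_size (perm_to_rem ees)) /= addnS addSn.
  by apply: (paired_del ees _ pM') => X sX; have := he X; rewrite sX.
have tightcut e : e \in es -> exists2 X : {set V}, sep X e & dcut es X <= ereq es U X.
  move/hasPn: nodel => h /h/forallPn[X]; rewrite negb_imply -leqNgt => /andP[h1 h2].
  by exists X.
have glue (X : {set V}) : 1 < #|X| -> 1 < #|~: X| -> dcut es X <= (ereq es U X).+1 ->
    (dcut es X <= ereq es U X \/ [/\ cubic_rest es U, aligned es U X &
      forall x y, x \in U -> y \in U -> x != y -> ereq es U X <= (lam es x y)./2.*2]) ->
    exists M, paired es U M.
  move=> c1 c2 b1 hyp; have cX := cardsC X.
  have [|M1 p1] := IHn _ (map_edges (ctr X) es) (ctr X @: U).
    by rewrite card_contr size_map; have := leq_imset_card (ctr X) U; nlia.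
  have [|M2 p2] := IHn _ (map_edges (ctr (~: X)) es) (ctr (~: X) @: U).
    by rewrite card_contr setCK size_map; have := leq_imset_card (ctr (~: X)) U; nlia.
  have /card_gt0P[x0 x0X] : 0 < #|X| by nlia.
  have [M [h1 h2 h3]] := glue_pairing x0X p1 p2.
  by exists M; split=> //; apply: glue_feasible h1 h2 h3 b1 hyp.
have [/existsP[X /and3P[c1 c2 tX]]|/existsPn notight] :=
    boolP [exists X : {set V}, [&& 1 < #|X|, 1 < #|~: X| & dcut es X <= ereq es U X]].
  by apply: (glue X) => //; [nlia|left].
pose tight v := dcut es [set v] <= ereq es U [set v].
have sing (X : {set V}) a : #|X| <= 1 -> a \in X -> X = [set a].
  by move=> c aX; apply/esym/eqP; rewrite eqEcard sub1set aX cards1.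
have tend e : e \in es -> sep [set e.1] e && (tight e.1 || tight e.2).
  move=> /tightcut[X sX tX]; have := notight X; rewrite tX andbT negb_and -!leqNgt.
  have sing' (Y : {set V}) : sep Y e -> dcut es Y <= ereq es U Y -> #|Y| <= 1 ->
      sep [set e.1] e && (tight e.1 || tight e.2).
    rewrite /sep => sY tY cY.
    have [e1Y|e1Y] := boolP (e.1 \in Y).
      have eY := sing _ _ cY e1Y; rewrite /tight -eY tY andbT.
      exact: sY.
    have e2Y : e.2 \in Y by move: sY; rewrite (negbTE e1Y); case: (e.2 \in Y).
    have eY := sing _ _ cY e2Y; rewrite /tight -eY tY orbT andbT !inE eqxx.
    by apply/eqP => h; move: e1Y; rewrite eY inE; case: eqP h => // ->; rewrite eqxx.
  case/orP=> c; first exact: (sing' X).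
  apply: (sing' (~: X)); rewrite ?dcutC ?ereqC //.
  by move: sX; rewrite /sep !inE; case: (_ \in X); case: (_ \in X).
have deg_pos e : e \in es -> 0 < dcut es [set e.1] /\ 0 < dcut es [set e.2].
  move=> ees; have /andP[s1 _] := tend e ees; split; rewrite -has_count; apply/hasP; exists e => //.
  by move: s1; rewrite /sep !inE !eqxx [e.2 == _]eq_sym; case: (e.1 == e.2).
(* A bridge has a tight end [a]. If the demand at [a] goes across the bridge, [a] has degree one,
   against evenness. Otherwise adding [a] to the far side [S] gives a cut smaller than the degree of
   [a] that still separates the demanding pair. *)
have nb (X : {set V}) : dcut es X <> 1.
  move=> d1; have /hasP[e ees sX] : has (sep X) es by rewrite has_count -/(dcut _ _) d1.
  have [S [a [b [dS aS bS ta pa]]]] : exists (S : {set V}) a b, [/\ dcut es S = 1, a \notin S, b \in S,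
      tight a & (0 < dbet es [set a] S) && (0 < dcut es [set a])].
    have /andP[s1 tt] := tend e ees; have [p1 p2] := deg_pos e ees.
    have bet (S : {set V}) a b : a \notin S -> b \in S -> (a, b) = e \/ (b, a) = e ->
        0 < dbet es [set a] S.
      move=> aS bS h; apply: (@dbet_mem _ _ _ _ a b); rewrite ?inE //.
      by case: h => ->; [left|right].
    case/orP: tt => tt; case e1X: (e.1 \in X); move: sX; rewrite /sep e1X /=;
      case e2X: (e.2 \in X) => // _.
    - exists (~: X), e.1, e.2; rewrite dcutC !inE e1X e2X; split=> //.
      by rewrite p1 andbT; apply: (bet _ _ e.2); rewrite ?inE ?e1X ?e2X //; left; case: (e).
    - exists X, e.1, e.2; rewrite e1X e2X; split=> //.
      by rewrite p1 andbT; apply: (bet _ _ e.2); rewrite ?inE ?e1X ?e2X //; left; case: (e).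
    - exists X, e.2, e.1; rewrite e1X e2X; split=> //.
      by rewrite p2 andbT; apply: (bet _ _ e.1); rewrite ?inE ?e1X ?e2X //; right; case: (e).
    - exists (~: X), e.2, e.1; rewrite dcutC !inE e1X e2X; split=> //.
      by rewrite p2 andbT; apply: (bet _ _ e.1); rewrite ?inE ?e1X ?e2X //; right; case: (e).
  case/andP: pa => pb pa.
  have [e0|[a' [q [a'U]]]] := ereq_att es U [set a]; first by move: ta; rewrite /tight e0; nlia.
  rewrite inE => /eqP-> qU; rewrite inE => qa eq.
  have le := half_double_le (lam es a q); have ev := ereq_even es U [set a].
  rewrite /tight in ta.
  case qS: (q \in S).
    have h : lam es a q <= dcut es (~: S) by apply: lam_le; rewrite inE ?negbK.
    rewrite dcutC dS in h; have : dcut es [set a] = 1 by nlia.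
    have := ereq_le es U [set a] => h' h1; have eR : ereq es U [set a] = 1 by nlia.
    by rewrite eR in ev.
  have h : lam es a q <= dcut es ([set a] :|: S) by apply: lam_le; rewrite !inE ?eqxx // negb_or qa qS.
  have := @dcutU_disj _ es [set a] S; rewrite disjoints1 => /(_ aS); nlia.
have tightU v : tight v -> 0 < dcut es [set v] -> v \in U.
  move=> tv pv; have [e0|[a [q [aU]]]] := ereq_att es U [set v].
    by move: tv; rewrite /tight e0; nlia.
  by rewrite inE => /eqP<-.
have [/existsP[z /andP[zU dz3]]|/existsPn cub0] :=
    boolP [exists z, (z \notin U) && (dcut es [set z] != 3)].
  have [dz0|dz0] := posnP (dcut es [set z]).
    have [/existsP[y yz]|/existsPn only] := boolP [exists y, y != z]; last first.
      have dT (X : {set V}) : dcut es X = 0.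
        case zX: (z \in X).
          have -> : X = setT by apply/setP => v; rewrite inE; move/negPn/eqP: (only v) => ->.
          exact: dcutT.
        have -> : X = set0 by apply/setP => v; rewrite inE; move/negPn/eqP: (only v) => ->.
        exact: dcut0.
      exists [::]; split=> [v|//|X]; first by rewrite dT.
      by have := ereq_le es U X; rewrite dT.
    have [|M' pM'] := IHn _ (map_edges (ctr [set z; y]) es) (ctr [set z; y] @: U).
      rewrite card_contr size_map; have := leq_imset_card (ctr [set z; y]) U.
      have := cardsC [set z; y]; rewrite cards2 eq_sym yz => h1 h2; nlia.
    exact: paired_isolated pM'.
  have [||s [u [e1 [e2 [es' [P a1 a2 so]]]]]] := @mader #|V| V es U z (leqnn _) zU nb.
  - by have := nb [set z]; nlia.
  - by apply/eqP.
  have [|M pM] := IHn V ((s, u) :: es') U; first by move: mu; rewrite (perm_size P) /=; nlia.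
  by exists M; exact: (paired_split zU P a1 a2 so pM).
have tnbr v s : v \notin U -> nbr es v s -> tight s /\ s \in U.
  move=> vU vs.
  have ps : 0 < dcut es [set s] by case/andP: vs => _ /orP[] /deg_pos[].
  have tvs : tight v || tight s.
    by case/andP: vs => _ /orP[] /tend/andP[_] //=; rewrite orbC.
  have pv : 0 < dcut es [set v] by case/andP: vs => _ /orP[] /deg_pos[].
  case/orP: tvs => [tv|ts]; first by rewrite (tightU v) in vU.
  by split=> //; apply: tightU.
have cub : cubic_rest es U.
  move=> v vU; split; last by move=> s /(tnbr _ _ vU)[].
  by have := cub0 v; rewrite vU negbK => /eqP.
case ees: es => [|e0 es0]; first by exists [::]; split=> // X; apply: (ereq_le [::]).
rewrite -ees; have e0es : e0 \in es by rewrite ees mem_head.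
have [a0 ta0 pa0] : exists2 a, tight a & 0 < dcut es [set a].
  by have /andP[_ /orP[h|h]] := tend _ e0es; have [p1 p2] := deg_pos _ e0es; [exists e0.1|exists e0.2].
have [x1 [y1 [x1U y1U xy1]]] : exists x y, [/\ x \in U, y \in U & x != y].
  have [h0|[a [q [aU]]]] := ereq_att es U [set a0]; first by move: ta0; rewrite /tight h0; nlia.
  by rewrite inE => /eqP ea qU; rewrite inE => qa _; exists a, q; rewrite aU qU ea eq_sym qa.
pose P (p : V * V) := [&& p.1 \in U, p.2 \in U & p.1 != p.2].
have P1 : P (x1, y1) by rewrite /P /= x1U y1U.
have [[x y] /and3P[/= xU yU xy] lmin0] := @arg_minnP _ (x1, y1) P (fun p => lam es p.1 p.2) P1.
have lmin a b : a \in U -> b \in U -> a != b -> lam es x y <= lam es a b.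
  by move=> aU bU ab; apply: (lmin0 (a, b)); rewrite /P /= aU bU.
have tnbr' v s : v \notin U -> nbr es v s -> dcut es [set s] = ereq es U [set s].
  by move=> vU /(tnbr _ _ vU)[ts _]; apply/eqP; rewrite eqn_leq ereq_le andbT; exact: ts.
have [X [xX yX dX]] := lam_att es xy.
have [cX|cX] := leqP #|X| 1.
  have eX := sing _ _ cX xX; rewrite eX in dX.
  have [|M pM] := IHn V es (U :\ x); first by move: mu; rewrite (cardsD1 x) xU; nlia.
  exists M; exact: paired_drop cub tnbr' xU yU xy dX lmin pM.
have [cX'|cX'] := leqP #|~: X| 1.
  have yX' : y \in ~: X by rewrite inE.
  have eX := sing _ _ cX' yX'; rewrite -dcutC eX lamC in dX.
  have [|M pM] := IHn V es (U :\ y); first by move: mu; rewrite (cardsD1 y) yU; nlia.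
  have yx : y != x by rewrite eq_sym.
  exists M; apply: paired_drop cub tnbr' yU xU yx dX _ pM.
  by move=> a b aU bU ab; rewrite lamC; apply: lmin.
have rX : ereq es U X = (lam es x y)./2.*2.
  apply/eqP; rewrite eqn_leq ereq_ge // andbT; apply: maxreq_le => a b aU aX bU bX.
  by apply: half_double_homo; rewrite -dX; apply: lam_le.
apply: (glue X) => //.
  by rewrite dX rX -[X in X <= _]odd_double_half; case: (odd _); nlia.
right; split=> //.
  apply: alignedP => // v vU vX; rewrite dX; last first.
    rewrite lamC; apply: lam_le; rewrite !inE ?xX ?andbF // yX andbT.
    by apply: contraNneq vU => <-.
  apply: lam_le; rewrite !inE ?(negbTE yX) ?andbF // xX andbT.
  by apply: contraNneq vU => <-.
by move=> a b aU bU ab; rewrite rX; apply/half_double_homo/lmin.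
Qed.

(** * Eulerian and strong orientations of finite multigraphs *)

Definition flipped (T : eqType) (e e' : T * T) := (e' == e) || (e' == (e.2, e.1)).

Lemma perm_map_lift (T T' : eqType) (g : T -> T') (z : seq T) (l : seq T') :
  perm_eq l (map g z) -> exists2 z', perm_eq z' z & map g z' = l.
Proof.
elim: l z => [|a l IHl] z; first by case: z => [_|b z /perm_size//]; exists [::].
rewrite perm_sym => /perm_map_cons[b [z1 [P e P1]]].
have [|z' P' <-] := IHl z1; first by rewrite perm_sym.
by exists (b :: z'); rewrite /= ?e // (perm_trans _ (_ : perm_eq (b :: z1) z)) ?perm_cons // perm_sym.
Qed.

(** An orientation is a list parallel to the edge list, so it has to follow when the edges are
    reordered. *)
Lemma all2_perm (T : eqType) (r : rel T) (l0 l l' : seq T) :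
  perm_eq l0 l -> all2 r l l' -> exists2 l0', perm_eq l0' l' & all2 r l0 l0'.
Proof.
move=> P; rewrite all2E => /andP[/eqP sz al].
have [|z Pz ez] := @perm_map_lift _ _ fst (zip l l') l0.
  by rewrite -/(unzip1 _) unzip1_zip ?sz.
exists (unzip2 z).
  by rewrite (perm_trans (perm_map snd Pz)) // -/(unzip2 _) unzip2_zip ?sz.
rewrite all2E -ez !size_map eqxx /=.
have -> : zip (map fst z) (unzip2 z) = z by exact: zip_unzip.
by rewrite (perm_all _ Pz).
Qed.

Definition out (T : finType) (l : seq (T * T)) (X : {set T}) :=
  count (fun e => (e.1 \in X) && (e.2 \notin X)) l.

Lemma out_in_dcut (T : finType) (l : seq (T * T)) X :
  out l X + out l (~: X) = dcut l X.
Proof.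
rewrite /out /dcut; elim: l => //= -[a b] l; rewrite /sep /= !inE.
by case: (a \in X); case: (b \in X) => /=; nlia.
Qed.

Lemma dcut_flipped (T : finType) (l l' : seq (T * T)) X :
  all2 (@flipped T) l l' -> dcut l' X = dcut l X.
Proof.
elim: l l' => [|e l IHl] [|e' l'] //= /andP[fe /IHl].
rewrite /dcut /= => ->; congr (nat_of_bool _ + _).
by case/orP: fe => /eqP-> //; rewrite /sep eq_sym.
Qed.

(** Two edges [ab] and [bc] are replaced by [ac], and loops, which cross no cut, are set apart.
    Balance at all vertex sets instead of single vertices spares the summation. *)
Lemma euler_orientation (T : finType) (l : seq (T * T)) :
  (forall v, ~~ odd (dcut l [set v])) ->
  exists2 l', all2 (@flipped T) l l' & forall X, out l' X = out l' (~: X).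
Proof.
have [n] := ubnP (size l); elim: n l => // n IHn [|[a b] l] sl ev; first by exists [::].
have [ab|ab] := eqVneq a b.
  have [||l' fl bal] := IHn l => //.
    by move=> v; apply: contra (ev v); rewrite /dcut /= {2}/sep /= ab eqxx.
  exists ((a, b) :: l') => [|X]; first by rewrite /= /flipped eqxx.
  rewrite /out /= ab /=; have := bal X; rewrite /out => ->.
  by rewrite !inE; case: (b \in X).
have ob : odd (dcut l [set b]).
  have := ev b; rewrite /dcut /= oddD /sep /= !inE (negbTE ab) eqxx /=.
  by case: (odd _).
have /hasP[e2 e2l sb] : has (sep [set b]) l.
  by rewrite has_count -/(dcut _ _); case: (dcut _ _) ob.
have [c cb] := sep_set1_edge_at sb.
have P := perm_to_rem e2l.
have dl X : dcut l X = sep X (b, c) + dcut (rem e2 l) X.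
  by rewrite (dcut_perm _ P) /dcut /= (sep_edge_at _ cb).
have dab X : dcut ((a, b) :: l) X = sep X (b, a) + (sep X (b, c) + dcut (rem e2 l) X).
  by rewrite -dl /dcut /= /sep /= eq_sym.
have [||l' fl bal] := IHn ((a, c) :: rem e2 l).
- by move: sl; rewrite /= (perm_size P).
- move=> v; have := ev v; rewrite dab /dcut /= (sep_split _ b a c) !oddD.
  by case: (sep _ (b, a)); case: (sep _ (b, c)); case: (odd (count _ _)).
case: l' fl bal => [|e' l'] //= /andP[fe fl] bal.
(* The split edge of the smaller graph orients both edges it replaces. *)
pose o1 := if e' == (a, c) then (a, b) else (b, a).
pose o2 := if e' == (a, c) then (b, c) else (c, b).
have f2 : flipped e2 o2.
  by case/andP: cb => _ /orP[] /eqP->; rewrite /flipped /o2; case: ifP => _; rewrite eqxx ?orbT.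
have f1 : flipped (a, b) o1 by rewrite /flipped /o1; case: ifP => _; rewrite eqxx ?orbT.
have [||l1 P1 fl1] := @all2_perm _ (@flipped T) ((a, b) :: l) [:: (a, b), e2 & rem e2 l] [:: o1, o2 & l'].
- by rewrite perm_cons.
- by rewrite /= f1 f2.
exists l1 => // X; rewrite /out !(permP P1) /=.
have := bal X; rewrite /out /= !inE.
have : e' = (a, c) \/ (e' != (a, c)) /\ e' = (c, a).
  by case/orP: fe => /eqP e; [left|case: (eqVneq e' (a, c)) => h; [left|right]].
case=> [e|[h e]]; [rewrite /o1 /o2 e eqxx /=|rewrite /o1 /o2 (negbTE h) e /=];
by case: (a \in X); case: (b \in X); case: (c \in X) => /=; nlia.
Qed.

(** Nash-Williams' strong orientation theorem: an Eulerian orientation of the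
    graph together with an odd-vertex pairing is balanced at every cut, and
    deleting the pairing only uses up the slack of the cuts. *)
Lemma strong_orientation (T : finType) (es : seq (T * T)) :
  exists2 l, all2 (@flipped T) es l &
    forall (X : {set T}) x y, x \in X -> y \notin X -> (lam es x y)./2 <= out l X.
Proof.
have [M [m1 _ m3]] := @odd_vertex_pairing_rec _ _ es [set: T] (leqnn _).
have [|l' fl bal] := @euler_orientation _ (es ++ M).
  by move=> v; rewrite dcut_cat oddD m1 addbb.
have sz : size es <= size l'.
  by move: fl; rewrite all2E size_cat => /andP[/eqP<- _]; apply: leq_addr.
have el : l' = take (size es) l' ++ drop (size es) l' by rewrite cat_take_drop.
set l1 := take _ _ in el; set l2 := drop _ _ in el.
have s1 : size es = size l1 by rewrite size_takel.
have [f1 f2] : all2 (@flipped T) es l1 /\ all2 (@flipped T) M l2.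
  move: fl; rewrite el !all2E zip_cat // all_cat !size_cat s1 eqn_add2l eqxx /=.
  by case/andP=> /eqP-> /andP[-> ->]; rewrite eqxx.
exists l1 => // X x y xX yX.
have := bal X; rewrite el /out !count_cat -!/(out _ _) => b.
have := out_in_dcut l1 X; rewrite (dcut_flipped X f1); have := out_in_dcut l2 X.
rewrite (dcut_flipped X f2); have := m3 X.
have := @ereq_ge _ es setT X x y; rewrite !inE => /(_ isT xX isT yX).
by rewrite -muln2; nlia.
Qed.

Lemma flipped_map (E T : eqType) (s t : E -> T) (es : seq E) (l : seq (T * T)) : uniq es ->
  all2 (@flipped T) [seq (s e, t e) | e <- es] l ->
  exists sg : E -> bool, l = [seq (if sg e then (s e, t e) else (t e, s e)) | e <- es].
Proof.
elim: es l => [|e es IHes] [|p l] //=; first by exists (fun=> true).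
case/andP=> ees /IHes IH /andP[fp /IH[sg ->]].
exists (fun e' => if e' == e then p == (s e, t e) else sg e').
rewrite eqxx; congr cons; first by case/orP: fp => /eqP h; case: eqP => // h'; rewrite {1}h.
by apply/eq_in_map => e' e'es; case: eqP => // h; rewrite -h e'es in ees.
Qed.

(** The form needed for blocks: a finite list of edges whose ends lie in an arbitrary vertex
    type. *)
Lemma finite_well_balanced (V E : eqType) (s t : E -> V) (es : seq E) : uniq es ->
  exists sg : E -> bool, forall (X : pred V) x y k, X x -> ~~ X y ->
    (forall Y : pred V, Y x -> ~~ Y y -> 2 * k <= count (fun e => Y (s e) != Y (t e)) es) ->
    k <= count (fun e => X (if sg e then s e else t e) && ~~ X (if sg e then t e else s e)) es.
Proof.
case ees: es => [|e0 es0] ues.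
  by exists (fun=> true) => X x y k Xx Xy /(_ X Xx Xy) /=; nlia.
rewrite -ees in ues *.
(* All vertices off the edges share the last index. This is harmless, since for positive [k] both
   [x] and [y] turn out to be ends of edges. *)
pose vs := map s es ++ map t es; pose f v : 'I_(size vs).+1 := inord (index v vs).
have fE v : nat_of_ord (f v) = index v vs by rewrite inordK // ltnS index_size.
have fK v : v \in vs -> nth (s e0) vs (f v) = v by move=> h; rewrite fE nth_index.
have sv e : e \in es -> s e \in vs by move=> h; rewrite mem_cat map_f.
have tv e : e \in es -> t e \in vs by move=> h; rewrite mem_cat (map_f t) ?orbT.
have [l fl hl] := strong_orientation [seq (f (s e), f (t e)) | e <- es].
have [sg el] := flipped_map ues fl.
exists sg => X x y k Xx Xy hY.
have [->//|k0] := posnP k.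
have yx : y != x by apply: contraNneq Xy => ->.
have xvs : x \in vs.
  apply/negPn/negP => h; have := hY (pred1 x); rewrite /= eqxx => /(_ isT yx).
  rewrite (_ : count _ _ = 0); first by nlia.
  apply/eqP; rewrite -leqn0 leqNgt -has_count; apply/hasPn => e ee /=.
  have nx v : v \in vs -> (v == x) = false by move=> vv; apply: contraNF h => /eqP<-.
  by rewrite !nx ?sv ?tv.
have yvs : y \in vs.
  apply/negPn/negP => h; have := hY (predC1 y); rewrite /= eqxx eq_sym => /(_ yx isT).
  rewrite (_ : count _ _ = 0); first by nlia.
  apply/eqP; rewrite -leqn0 leqNgt -has_count; apply/hasPn => e ee /=.
  have nx v : v \in vs -> (v == y) = false by move=> vv; apply: contraNF h => /eqP<-.
  by rewrite !nx ?sv ?tv.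
pose X' := [set i : 'I_(size vs).+1 | X (nth (s e0) vs i)].
have XE v : v \in vs -> (f v \in X') = X v by move=> h; rewrite inE fK.
have fxy : f x != f y.
  by apply: contraNneq Xy => /(congr1 (fun i : 'I_(size vs).+1 => nth (s e0) vs i)); rewrite !fK // => <-.
have lamk : 2 * k <= lam [seq (f (s e), f (t e)) | e <- es] (f x) (f y).
  apply: lam_ge => // Y xY yY; have := hY (fun v => f v \in Y) xY yY.
  by rewrite /dcut count_map.
have := hl X' (f x) (f y); rewrite !XE // => /(_ Xx Xy) ho.
have : k <= out l X' by apply: leq_trans ho; rewrite -[k]doubleK; apply: half_leq; rewrite -mul2n.
rewrite el /out count_map => h; apply: leq_trans h _; apply: eq_leq.
by apply: eq_in_count => e ee /=; case: (sg e) => /=; rewrite !XE ?sv ?tv.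
Qed.

(** * Lower bounds on possibly infinite edge sets *)

Section AtLeast.
Variable E : eqType.

Definition atleast (n : nat) (A : E -> Prop) : Prop :=
  exists l : seq E, [/\ uniq l, size l = n & forall e, e \in l -> A e].

(** The entry to the descent: a set without [n] out-arcs has all its out-arcs in a finite list. *)
Lemma atleast_or_finite A n : atleast n A \/ exists l : seq E, forall e, A e -> e \in l.
Proof.
elim: n => [|n [[l [ul sl hl]]|]]; [by left; exists [::]| |by right].
have [h|/existsNP[e /not_implyP[Ae /negP el]]] := pselect (forall e, A e -> e \in l).
  by right; exists l.
left; exists (e :: l); split; rewrite /= ?el ?sl // => e'; rewrite inE.
by case/orP => [/eqP->|/hl].
Qed.

Lemma atleast_sub A B n : (forall e, A e -> B e) -> atleast n A -> atleast n B.
Proof. by move=> AB [l [h1 h2 h3]]; exists l; split=> // e /h3/AB. Qed.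

Lemma atleast_leq A m n : m <= n -> atleast n A -> atleast m A.
Proof.
move=> mn [l [h1 h2 h3]]; exists (take m l); split; rewrite ?take_uniq //.
  by rewrite size_takel // h2.
by move=> e /mem_take/h3.
Qed.

Lemma atleast_count (p : pred E) (l : seq E) n : uniq l -> n <= count p l ->
  atleast n (fun e => e \in l /\ p e).
Proof.
move=> ul h; apply: atleast_leq h _; exists (filter p l); split; rewrite ?filter_uniq //.
  by rewrite size_filter.
by move=> e; rewrite mem_filter => /andP[].
Qed.

Lemma count_atleast (p : pred E) (l : seq E) n A : atleast n A ->
  (forall e, A e -> e \in l /\ p e) -> n <= count p l.
Proof.
move=> [l' [u' <- h]] Al; rewrite -size_filter; apply: uniq_leq_size => // e /h/Al[el pe].
by rewrite mem_filter pe.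
Qed.

End AtLeast.

(** * Menger's theorem in infinite digraphs *)

Section Menger.
Variables (V E : choiceType) (tl hd : E -> V).
Implicit Types (F : seq E) (X : pred V).

Let outF F X := count (fun e => X (tl e) && ~~ X (hd e)) F.
Let inF F X := count (fun e => ~~ X (tl e) && X (hd e)) F.

(** A unit-capacity flow of value [j] from [x] to [y] with finite support. Conservation is imposed
    on vertex sets, which are used as cuts directly, even when infinite. *)
Let flow F x y j := uniq F /\
  forall X, outF F X + j * X y = inF F X + j * X x.

Let res F : rel V := fun u v => `[< exists e,
  (e \notin F /\ (tl e = u /\ hd e = v)) \/ (e \in F /\ (tl e = v /\ hd e = u)) >].

Let augment p : forall F x, uniq F -> path (res F) x p -> uniq (x :: p) ->
  exists F', uniq F' /\ forall X, outF F' X + inF F X + X (last x p)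
    = inF F' X + outF F X + X x.
Proof.
elim: p => [|v p IHp] F x uF.
  by move=> _ _; exists F; split=> // X; rewrite /= (addnC (outF F X)).
rewrite [path _ _ _]/= => /andP[/asboolP[e he] pp] /andP[xvp uvp].
have xv : x != v by apply: contraNneq xvp => ->; rewrite mem_head.
pose F1 := if e \in F then rem e F else e :: F.
have ends : (tl e == x) || (hd e == x).
  by case: he => -[_ [-> ->]]; rewrite eqxx ?orbT.
have mem1 e' : tl e' != x -> hd e' != x -> (e' \in F1) = (e' \in F).
  move=> h1 h2; have ee : e' != e.
    by apply: contraTneq ends => <-; rewrite negb_or h1.
  rewrite /F1; case: ifP => eF; last by rewrite inE (negbTE ee).
  by rewrite (perm_mem (perm_to_rem eF)) inE (negbTE ee).
have u1 : uniq F1 by rewrite /F1; case: ifP => eF; [apply: rem_uniq|rewrite /= eF].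
have [|F' [uF' hF']] := IHp F1 v u1 _ uvp.
  (* The path is simple, so its later arcs avoid [x] and are not affected by switching [e]. *)
  have: {in x :: v :: p, forall u, (u == x) || (u \in v :: p)} by move=> u; rewrite inE.
  move: pp xvp; elim: p v {IHp uvp xv he} => //= u p IHp v /andP[/asboolP[e' he'] pp].
  rewrite !inE !negb_or => /and3P[xv xu xp] _; apply/andP; split.
    apply/asboolP; exists e'.
    have m : (e' \in F1) = (e' \in F).
      by apply: mem1; case: he' => -[_ [h1 h2]]; rewrite ?h1 ?h2 eq_sym.
    by rewrite m.
  by apply: IHp => //; rewrite !inE ?negb_or ?xu.
exists F'; split=> // X; have := hF' X; rewrite [last x _]/= {1}/inF {2}/outF /F1.
case: ifP => eF.
  have [tv hx] : tl e = v /\ hd e = x by case: he => -[]; rewrite eF.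
  rewrite {2}/outF {1}/inF.
  rewrite -/(inF _ _) -/(outF _ _).
  have := permP (perm_to_rem eF) => P.
  rewrite /outF /inF !P /= tv hx.
  by case: (X x); case: (X v) => /=; nlia.
have [tx hv] : tl e = x /\ hd e = v by case: he => -[]; rewrite eF.
rewrite /outF /inF /= tx hv.
by case: (X x); case: (X v) => /=; nlia.
Qed.

Let reachable (r : rel V) x : pred V := fun v => `[< exists2 p, path r x p & last x p = v >].

Let reach0 r x : reachable r x x.
Proof. by apply/asboolP; exists [::]. Qed.

Let reachS r x u v : reachable r x u -> r u v -> reachable r x v.
Proof.
move=> /asboolP[p pp lp] ruv; apply/asboolP; exists (rcons p v).
  by rewrite rcons_path pp lp.
by rewrite last_rcons.
Qed.

Let reach_uniq r x v : reachable r x v -> exists p, [/\ path r x p, last x p = v & uniq (x :: p)].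
Proof.
by move=> /asboolP[p pp <-]; case/shortenP: pp => p' pp' up' _; exists p'.
Qed.

Let max_flow x y k :
  (forall X, X x -> ~~ X y -> atleast k (fun e => X (tl e) && ~~ X (hd e))) ->
  forall j, j <= k -> exists F, flow F x y j.
Proof.
move=> cuts; elim=> [|j IHj] jk; first by exists [::].
have [F [uF fF]] := IHj (ltnW jk).
pose X := reachable (res F) x.
have Xx : X x := reach0 _ _.
case Xy: (X y).
  have [p [pp lp up]] := reach_uniq Xy.
  have [F' [uF' hF']] := augment uF pp up.
  exists F'; split=> // Z; have := hF' Z; have := fF Z; rewrite lp.
  by case: (Z x); case: (Z y); nlia.
(* All edges leaving the residually reachable set carry flow and no flow enters it, so its net
   outflow would exceed [j]. *)
have := cuts X Xx (negbT Xy) => /(atleast_leq jk) al.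
have : j.+1 <= outF F X.
  apply: count_atleast al _ => e /andP[h1 h2]; split; last by rewrite h1.
  apply/negPn/negP => eF; case/negP: h2; apply: reachS h1 _.
  by apply/asboolP; exists e; left.
have in0 : inF F X = 0.
  apply/eqP; rewrite -leqn0 leqNgt -has_count; apply/hasPn => e eF; apply/negP => /andP[h1 h2].
  by case/negP: h1; apply: reachS h2 _; apply/asboolP; exists e; right.
have := fF X; rewrite Xx Xy in0; nlia.
Qed.

Let dstep e u v := tl e = u /\ hd e = v.

Let walk_of_path F x p : path (fun u v => `[< exists2 e, e \in F & dstep e u v >]) x p ->
  exists q : seq (E * V), [/\ is_walk dstep x q, map snd q = p, map tl (map fst q) = belast x p,
    forall e, e \in map fst q -> e \in F &
    forall X, outF (map fst q) X + X (last x p) = inF (map fst q) X + X x].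
Proof.
elim: p x => [|v p IHp] x /=; first by exists [::].
case/andP=> /asboolP[e eF [te he]] /IHp[q [q1 q2 q3 q4 q5]].
exists ((e, v) :: q); split=> //=; rewrite ?q2 ?q3 ?te //.
  by move=> e'; rewrite inE => /orP[/eqP->|/q4].
move=> X; have := q5 X; rewrite /outF /inF /= he.
by case: (X x); case: (X v) => /=; nlia.
Qed.

(** One path is peeled off at a time; circulations may remain. *)
Let decompose x y j F : flow F x y j ->
  exists P : nat -> seq (E * V), [/\ forall i, i < j -> is_path dstep x y (P i),
    forall i i' e, i < j -> i' < j -> i != i' -> e \in map fst (P i) -> e \notin map fst (P i') &
    forall i e, i < j -> e \in map fst (P i) -> e \in F].
Proof.
elim: j F => [|j IHj] F [uF fF]; first by exists (fun=> [::]); split.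
pose r : rel V := fun u v => `[< exists2 e, e \in F & dstep e u v >].
pose X := reachable r x.
have Xx : X x := reach0 _ _.
have Xy : X y.
  case Xy: (X y) => //; have := fF X; rewrite Xx Xy /= muln0 muln1 addn0 => h.
  have : outF F X = 0; last by rewrite h; nlia.
  apply/eqP; rewrite -leqn0 leqNgt -has_count; apply/hasPn => e eF; apply/negP => /andP[h1 h2].
  by case/negP: h2; apply: reachS h1 _; apply/asboolP; exists e.
have [p [pp lp up]] := reach_uniq Xy.
have [q [q1 q2 q3 q4 q5]] := walk_of_path pp.
have uq : uniq (map fst q).
  apply: (@map_uniq _ _ tl); rewrite q3.
  by have := up; rewrite lastI rcons_uniq => /andP[].
pose F' := [seq e <- F | e \notin map fst q].
have P : perm_eq F (map fst q ++ F').
  apply: uniq_perm => //.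
    rewrite cat_uniq uq filter_uniq // andbT; apply/hasPn => e; rewrite mem_filter.
    by case/andP.
  move=> e; rewrite mem_cat mem_filter; case eq: (e \in map fst q) => //=.
  exact: q4.
have [|Ps [p1 p2 p3]] := IHj F'.
  split; first exact: filter_uniq.
  move=> Z; have := fF Z; rewrite /outF /inF !(permP P) !count_cat.
  have := q5 Z; rewrite /outF /inF lp.
  by case: (Z x); case: (Z y) => /=; nlia.
have inF' i e : i < j -> e \in map fst (Ps i) -> (e \in F) && (e \notin map fst q).
  by move=> ij /(p3 _ _ ij); rewrite mem_filter andbC.
exists (fun i => if i is i'.+1 then Ps i' else q); split.
- move=> [_|i /p1//]; split=> //; rewrite q2 //.
- move=> [|i] [|i'] e //= ij i'j ii' h.
  + by apply/negP => /(inF' _ _ i'j); rewrite h andbF.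
  + by have /andP[] := inF' _ _ ij h.
  + exact: (p2 i i').
- move=> [|i] e ij; first exact: q4.
  by move=> /(inF' _ _ ij)/andP[].
Qed.

Lemma menger x y k :
  (forall X : pred V, X x -> ~~ X y -> atleast k (fun e => X (tl e) && ~~ X (hd e))) ->
  exists P : 'I_k -> seq (E * V),
    edge_disjoint_paths (fun e u v => tl e = u /\ hd e = v) x y P.
Proof.
move=> cuts; have [F fF] := max_flow cuts (leqnn k).
have [P [p1 p2 p3]] := decompose fF.
exists (fun i => P (nat_of_ord i)); split=> [i|i j ij e]; first exact: p1.
exact: p2.
Qed.

End Menger.

(** * Rays and finite cuts *)

Section Graph.
Variables (V E : choiceType) (s t : E -> V).
Implicit Types (A B X : V -> Prop) (x y z u v w : V) (W : seq V).

Definition incident_pair e u v := (s e = u /\ t e = v) \/ (s e = v /\ t e = u).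
Definition adj u v := exists e, incident_pair e u v.
Definition stepin A : rel V := fun u v => `[< A v /\ adj u v >].
Definition conn A x y := A x /\ exists2 p, path (stepin A) x p & last x p = y.
Definition off W x : Prop := x \notin W.
Definition but v x : Prop := x <> v.

Lemma adj_sym u v : adj u v -> adj v u.
Proof. by case=> e [h|h]; exists e; [right|left]. Qed.

Lemma conn_refl A x : A x -> conn A x x.
Proof. by move=> Ax; split=> //; exists [::]. Qed.

Lemma path_stepin_in A x p z : path (stepin A) x p -> z \in p -> A z.
Proof.
elim: p x => //= v p IHp x /andP[/asboolP[Av _] pp]; rewrite inE.
by case/orP=> [/eqP->//|/(IHp _ pp)].
Qed.

Lemma conn_inl A x y : conn A x y -> A x. Proof. by case. Qed.

Lemma conn_inr A x y : conn A x y -> A y.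
Proof.
case=> Ax [p pp <-]; have := mem_last x p; rewrite inE => /orP[/eqP->//|].
exact: path_stepin_in pp.
Qed.

Lemma conn_step A x y z : conn A x y -> A z -> adj y z -> conn A x z.
Proof.
move=> [Ax [p pp lp]] Az yz; split=> //; exists (rcons p z); last by rewrite last_rcons.
by rewrite rcons_path pp lp; apply/asboolP.
Qed.

Lemma conn_ind A (P : V -> Prop) x y : conn A x y -> P x ->
  (forall u v, A u -> A v -> adj u v -> P u -> P v) -> P y.
Proof.
move=> [Ax [p pp <-]] Px h; elim: p x Ax Px pp => //= v p IHp x Ax Px /andP[/asboolP[Av xv] pp].
by apply: IHp => //; apply: h xv Px.
Qed.

Lemma conn_trans A x y z : conn A x y -> conn A y z -> conn A x z.
Proof.
move=> xy yz; apply: (conn_ind (P := conn A x) yz) => // u v _ Av uv xu.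
exact: conn_step uv.
Qed.

Lemma conn_adj A x y : A x -> A y -> adj x y -> conn A x y.
Proof. by move=> Ax Ay; apply: conn_step => //; apply: conn_refl. Qed.

Lemma conn_sym A x y : conn A x y -> conn A y x.
Proof.
move=> xy; apply: (conn_ind (P := fun z => conn A z x) xy).
  exact/conn_refl/(conn_inl xy).
by move=> u v Au Av uv; apply: conn_trans; apply: conn_adj => //; apply: adj_sym.
Qed.

Lemma conn_sub A B x y : (forall z, A z -> B z) -> conn A x y -> conn B x y.
Proof.
move=> AB xy; apply: (conn_ind (P := conn B x) xy); first exact/conn_refl/AB/(conn_inl xy).
by move=> u v _ Av uv xu; apply: conn_step uv => //; apply: AB.
Qed.

Lemma conn_sub_conn A x y : conn A x y -> conn (conn A x) x y.
Proof.
move=> xy; have xx := conn_refl (conn_inl xy).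
have [h1 h2] : conn A x y /\ conn (conn A x) x y; last by [].
apply: (conn_ind (P := fun y => conn A x y /\ conn (conn A x) x y) xy).
  by split=> //; apply: conn_refl.
move=> u v Au Av uv [h1 h2]; have h3 := conn_step h1 Av uv.
by split=> //; apply: conn_step uv.
Qed.

Lemma conn_eq A x y : conn A x y -> conn A x = conn A y.
Proof.
move=> xy; apply/funext => z; apply/propext; split; apply: conn_trans => //.
exact: conn_sym.
Qed.

Lemma conn_uniq A x y : conn A x y ->
  exists p, [/\ path (stepin A) x p, last x p = y & uniq (x :: p)].
Proof. by move=> [_ [p pp <-]]; case/shortenP: pp => p' pp' up' _; exists p'. Qed.

Lemma path_conn A x p : A x -> path (stepin A) x p -> conn A x (last x p).
Proof. by move=> Ax pp; split=> //; exists p. Qed.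

Lemma path_stepin_sub A B x p : (forall z, z \in p -> A z -> B z) ->
  path (stepin A) x p -> path (stepin B) x p.
Proof.
elim: p x => //= v p IHp x AB /andP[/asboolP[Av xv] pp]; apply/andP; split.
  by apply/asboolP; split=> //; apply: AB; rewrite ?mem_head.
by apply: IHp pp => z zp; apply: AB; rewrite inE zp orbT.
Qed.

Lemma path_first A x p : A x -> path (stepin A) x p -> uniq (x :: p) -> p <> [::] ->
  exists a, [/\ a \in p, adj x a, A a & conn (fun z => A z /\ z <> x) a (last x p)].
Proof.
case: p => // a p Ax /= /andP[/asboolP[Aa xa] pp] /andP[xp up] _.
exists a; split=> //; first by rewrite mem_head.
apply: path_conn; first by split=> //; move=> e; rewrite e mem_head in xp.
apply: path_stepin_sub pp => z zp Az; split=> // e.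
by rewrite -e inE zp orbT in xp.
Qed.

Definition is_ray_of (w : nat -> V) (e : nat -> E) :=
  injective w /\ forall n, incident_pair (e n) (w n) (w n.+1).
Definition rayless_ends := ~ exists (w : nat -> V) (e : nat -> E), is_ray_of w e.

Lemma offS W v x : off (v :: W) x <-> off W x /\ x <> v.
Proof.
rewrite /off inE negb_or; split=> [/andP[/eqP]|[h /eqP]] //.
by move=> ->.
Qed.

(** The ray grows vertex by vertex: [W] holds the vertices used, and the current end lies in a
    component of the rest that is still [Big]. This end is deleted, and one step is made towards a
    big component that remains. *)
Lemma ray_builder (Big : (V -> Prop) -> Prop) :
  (exists v, Big (conn (off [::]) v)) ->
  (forall W v w, Big (conn (off W) v) -> conn (off W) v w ->
    exists2 v', conn (off W) v v' & off (w :: W) v' /\ Big (conn (off (w :: W)) v')) ->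
  exists (w : nat -> V) (e : nat -> E), is_ray_of w e.
Proof.
move=> [v0 B0] step.
pose inv (p : seq V * V) := off p.1 p.2 /\ Big (conn (off p.1) p.2).
have nextP p : exists p', inv p -> [/\ inv p', p'.1 = p.2 :: p.1 & adj p.2 p'.2].
  have [[oW BW]|h] := pselect (inv p); last by exists p.
  case: p oW BW => W v /= oW BW.
  have [v' vv' [ov' Bv']] := step W v v BW (conn_refl oW).
  have [p [pp lp up]] := conn_uniq vv'.
  have [|a [_ va oa ca]] := path_first oW pp up.
    by move=> e; move: ov'; rewrite -lp e /= => /offS[].
  have cav : conn (off (v :: W)) a v'.
    by rewrite -lp; apply: conn_sub ca => z h; apply/offS.
  exists (v :: W, a) => _; split=> //; split; first exact: (conn_inl cav).
  by rewrite /= (conn_eq cav).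
have [nxt nxtP] := choice nextP.
pose st n := iter n nxt ([::], v0).
have inv_st n : inv (st n).
  by elim: n => [|n /nxtP[]//]; split.
pose w n := (st n).2.
have W_st n : (st n.+1).1 = w n :: (st n).1 by have [] := nxtP _ (inv_st n).
have adj_st n : adj (w n) (w n.+1) by have [] := nxtP _ (inv_st n).
have mem_st m n : m < n -> w m \in (st n).1.
  elim: n => // n IHn; rewrite ltnS leq_eqVlt W_st inE => /orP[/eqP->|/IHn->].
    by rewrite eqxx.
  by rewrite orbT.
have [e eP] := choice adj_st.
exists w, e; split=> // m n wmn.
have [mn|nm|//] := ltngtP m n.
  by have [/negP[]] := inv_st n; rewrite -/(w n) -wmn; apply: mem_st.
by have [/negP[]] := inv_st m; rewrite -/(w m) wmn; apply: mem_st.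
Qed.

(** The sequence need not be a path. It suffices that it converges to an end: no finite set
    separates its late members. The big components are those containing a tail. *)
Lemma tail_ray (u : nat -> V) :
  (forall W, exists N, forall i, N <= i -> conn (off W) (u i) (u i.+1)) ->
  exists (w : nat -> V) (e : nat -> E), is_ray_of w e.
Proof.
move=> h.
have tail W : exists N, forall i, N <= i -> conn (off W) (u N) (u i).
  have [N hN] := h W; have cN := conn_refl (conn_inl (hN _ (leqnn _))).
  exists N; elim=> [|i IHi]; first by rewrite leqn0 => /eqP e; rewrite e in cN *.
  rewrite leq_eqVlt => /orP[/eqP<-//|]; rewrite ltnS => Ni.
  exact: conn_trans (IHi Ni) (hN _ Ni).
apply: (@ray_builder (fun D => exists N, forall i, N <= i -> D (u i))).
  by have [N hN] := tail [::]; exists (u N), N.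
move=> W v w [N hN] vw; have [N' hN'] := tail (w :: W).
have cN i : maxn N N' <= i -> conn (off W) v (u i) /\ conn (off (w :: W)) (u (maxn N N')) (u i).
  move=> le; split; first by apply: hN; apply: leq_trans le; apply: leq_maxl.
  apply: (@conn_trans _ _ (u N')); first by apply/conn_sym/hN'/leq_maxr.
  by apply: hN'; apply: leq_trans le; apply: leq_maxr.
exists (u (maxn N N')); first by have [] := cN _ (leqnn _).
split; first exact: conn_inl (cN _ (leqnn _)).2.
by exists (maxn N N') => i /cN[].
Qed.

Definition crosses X e := (X (s e) /\ ~ X (t e)) \/ (~ X (s e) /\ X (t e)).
Definition fincut X := exists l : seq E, forall e, crosses X e -> e \in l.
Definition conn_ge k x y := forall X, X x -> ~ X y -> atleast k (crosses X).

Lemma crosses_pair X e u v : incident_pair e u v -> X u -> ~ X v -> crosses X e.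
Proof. by move=> [[<- <-]|[<- <-]]; [left|right]. Qed.

Lemma crossesP X e : crosses X e -> exists u v, [/\ incident_pair e u v, X u & ~ X v].
Proof. by case=> -[h1 h2]; [exists (s e), (t e)|exists (t e), (s e)]; split=> //; [left|right]. Qed.

Lemma crossesC X e : crosses (fun v => ~ X v) e <-> crosses X e.
Proof.
rewrite /crosses; split; case=> -[h1 h2].
- by right; split=> //; apply: contrapT.
- by left; split=> //; apply: contrapT.
- by right; split=> // h.
- by left; split=> // h.
Qed.

Lemma fincutI X Y : fincut X -> fincut Y -> fincut (fun v => X v /\ Y v).
Proof.
move=> [l1 h1] [l2 h2]; exists (l1 ++ l2) => e /crossesP[u [v [uv [Xu Yu] nXY]]].
rewrite mem_cat; have [Xv|Xv] := pselect (X v).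
  by rewrite (h2 e) ?orbT //; apply: crosses_pair uv Yu _ => Yv; apply: nXY.
by rewrite (h1 e) //; apply: crosses_pair uv Xu Xv.
Qed.

Lemma fincut_off x W : (forall w, w \in W -> exists X, [/\ fincut X, X x & ~ X w]) ->
  exists X, [/\ fincut X, X x & forall z, X z -> off W z].
Proof.
elim: W => [|w W IHW] h; first by exists (fun=> True); split=> //; exists [::] => e [[]|[]].
have [|X [fX Xx XW]] := IHW; first by move=> w' w'W; apply: h; rewrite inE w'W orbT.
have [Y [fY Yx Yw]] := h w (mem_head _ _).
exists (fun z => X z /\ Y z); split=> //; first exact: fincutI.
by move=> z [/XW oz Yz]; apply/offS; split=> // e; rewrite e in Yz.
Qed.

Lemma fincutC X : fincut X -> fincut (fun v => ~ X v).
Proof. by move=> [l h]; exists l => e /crossesC/h. Qed.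

Lemma conn_ge_sym k x y : conn_ge k x y -> conn_ge k y x.
Proof.
move=> h X Xy Xx; apply: atleast_sub (h (fun v => ~ X v) Xx _) => [e /crossesC//|].
by apply.
Qed.

Lemma conn_no_cross A X x y : conn A x y -> X x ->
  (forall e u v, incident_pair e u v -> A u -> A v -> X u -> X v) -> X y.
Proof. by move=> xy Xx h; apply: (conn_ind (P := X) xy Xx) => u v Au Av [e uv]; apply: h uv Au Av. Qed.

End Graph.

(** Two vertices are similar if no finite cut separates them. Contracting the
    similarity classes yields a graph in which all local connectivities are
    finite and which is still rayless. *)
Section Similar.
Variables (V E : choiceType) (s t : E -> V).
Implicit Types (X : V -> Prop) (x y z u v : V).

Definition sim x y := forall X, fincut s t X -> X x -> X y.

Lemma sim_refl x : sim x x. Proof. by []. Qed.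

Lemma sim_sym x y : sim x y -> sim y x.
Proof.
move=> xy X fX Xy; apply: contrapT => Xx.
exact: (xy _ (fincutC fX) Xx).
Qed.

Lemma sim_trans x y z : sim x y -> sim y z -> sim x z.
Proof. by move=> xy yz X fX /(xy X fX); apply: yz. Qed.

Definition pi x := choose (fun y => `[< sim x y >]) x.

Lemma sim_pi x : sim x (pi x).
Proof.
apply/asboolP; apply: (@chooseP _ (fun y => `[< sim x y >])).
by apply/asboolP; apply: sim_refl.
Qed.

Lemma pi_eqP x y : pi x = pi y <-> sim x y.
Proof.
split=> [e|xy].
  have h := @sim_pi x; rewrite e in h.
  exact: (sim_trans h (sim_sym (@sim_pi y))).
rewrite /pi (@choose_id _ (fun z => `[< sim x z >]) x y); last 2 first.
- by apply/asboolP; apply: sim_refl.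
- exact/asboolP.
apply: eq_choose => z; apply/asboolP/asboolP => h; first exact: (sim_trans (sim_sym xy) h).
exact: (sim_trans xy h).
Qed.

Lemma pi_id x : pi (pi x) = pi x.
Proof. by apply/pi_eqP; exact: (sim_sym (@sim_pi x)). Qed.

(** The edges leaving the component of [x] within [X] also leave [X], so this component is itself
    bounded by a finite cut. *)
Lemma sim_conn X x y : fincut s t X -> X x -> sim x y -> conn s t X x y.
Proof.
move=> [l fX] Xx xy; apply: (xy _ _ (conn_refl _ _ Xx)); exists l => e /crossesP[u [v [uv xu xv]]].
apply: fX; apply: (crosses_pair uv (conn_inr xu)) => Xv; apply: xv.
by apply: conn_step xu Xv _; exists e.
Qed.

Lemma sim_cut x y : ~ sim x y -> exists X, [/\ fincut s t X, X x & ~ X y].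
Proof. by move=> /existsNP[X /not_implyP[fX /not_implyP[Xx Xy]]]; exists X. Qed.

Lemma sim_cut_off x (W : seq V) : (forall w, w \in W -> ~ sim x w) ->
  exists X, [/\ fincut s t X, X x & forall z, X z -> off W z].
Proof.
by move=> h; apply: fincut_off => w /h/sim_cut.
Qed.

Let sq e := pi (s e).
Let tq e := pi (t e).

Lemma fincut_pi X v : fincut s t X -> X (pi v) <-> X v.
Proof. by move=> fX; split; [exact: (sim_sym (@sim_pi v) fX)|exact: (@sim_pi v X fX)]. Qed.

Lemma fincut_quot X : fincut s t X -> fincut sq tq X.
Proof.
move=> fX; have [l hl] := fX; exists l => e; rewrite /crosses /sq /tq.
by rewrite !(propext (fincut_pi _ fX)); apply: hl.
Qed.

(** The quotient keeps all of [V] as vertices; those representing no class are isolated, so an empty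
    cut separates them. *)
Lemma quot_separable u v : u <> v -> exists X, [/\ fincut sq tq X, X u & ~ X v].
Proof.
move=> uv; have [eu|nu] := pselect (pi u = u); last first.
  exists (fun z => z = u); split=> //; last by move=> e; apply: uv.
  by exists [::] => e; case=> -[h1 h2]; [move: h1|move: h2] => h; case: nu; rewrite -h pi_id.
have [ev|nv] := pselect (pi v = v); last first.
  exists (fun z => z <> v); split=> //.
  by exists [::] => e; case=> -[h1 h2]; [move: h2|move: h1] => /contrapT h; case: nv; rewrite -h pi_id.
have [|X [fX Xu Xv]] := @sim_cut u v; first by move=> /pi_eqP; rewrite eu ev.
by exists X; split=> //; apply: fincut_quot.
Qed.

(** A ray of the quotient visits each class once, so late classes on it miss a finite [W]. Such a
    class is separated from [W] by a finite cut, hence connected outside [W], and the ray lifts to a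
    sequence as in [tail_ray]. *)
Lemma quot_rayless : rayless_ends s t -> rayless_ends sq tq.
Proof.
move=> rl [c [e [inj_c inc]]]; apply: rl; apply: (@tail_ray _ _ s t c) => W.
have pc n : pi (c n) = c n.
  by case: (inc n) => -[h1 h2]; [rewrite -h1|rewrite -h2]; apply: pi_id.
have far : exists N, forall n, N <= n -> forall w, w \in W -> ~ sim (c n) w.
  elim: W => [|w W [N hN]]; first by exists 0.
  have [[m hm]|h] := pselect (exists m, sim (c m) w).
    exists (maxn N m.+1) => n; rewrite geq_max => /andP[Nn mn] w'; rewrite inE.
    case/orP=> [/eqP-> h|/(hN n Nn)//].
    have /pi_eqP : sim (c n) (c m) by exact: (sim_trans h (sim_sym hm)).
    by rewrite !pc => /inj_c h'; rewrite h' ltnn in mn.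
  exists N => n Nn w'; rewrite inE => /orP[/eqP-> h'|/(hN n Nn)//].
  by apply: h; exists n.
have [N hN] := far; exists N => n Nn.
have link m y : N <= m -> pi y = c m -> conn s t (off W) (c m) y.
  move=> Nm ey; have [X [fX Xc XW]] := sim_cut_off (hN m Nm).
  apply: conn_sub XW _; apply: sim_conn => //; apply/pi_eqP.
  by rewrite pc.
have [y [x [ey ex yx]]] : exists y x, [/\ pi y = c n, pi x = c n.+1 & adj s t y x].
  by case: (inc n) => -[h1 h2]; [exists (s (e n)), (t (e n))|exists (t (e n)), (s (e n))];
    split=> //; exists (e n); [left|right].
have c1 := link n y Nn ey; have c2 := link n.+1 x (leqW Nn) ex.
apply: conn_trans (conn_sym c2); apply: conn_step c1 (conn_inr c2) yx.
Qed.

Lemma quot_conn_ge k x y : conn_ge s t k x y -> conn_ge sq tq k (pi x) (pi y).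
Proof. by move=> h X Xx Xy; exact: (h (fun v => X (pi v)) Xx Xy). Qed.

End Similar.

(** * Blocks *)

(** [bset v e] is the component of the graph minus [v] met by the edge
    [e], and two edges lie in the same block if no vertex [v] tells them apart. *)
Section Blocks.
Variables (V E : choiceType) (s t : E -> V).
Implicit Types (A X Y : V -> Prop) (x y z u v w : V) (e f g h : E).
Local Notation cn := (conn s t).
Local Notation ip := (incident_pair s t).

Definition nonloop e := s e <> t e.
Definition end_of e x := s e = x \/ t e = x.
Definition bset v e z :=
  (s e <> v /\ cn (but v) (s e) z) \/ (t e <> v /\ cn (but v) (t e) z).
Definition beq e f := forall v, bset v e = bset v f.
Definition in_block e f := nonloop f /\ beq e f.
Definition block_vertex e x := exists2 f, in_block e f & end_of f x.

Lemma incident_pair_sym e u v : ip e u v -> ip e v u.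
Proof. by case=> -[h1 h2]; [right|left]. Qed.

Lemma end_other e x : end_of e x -> exists y, ip e x y.
Proof. by case=> <-; [exists (t e); left|exists (s e); right]. Qed.

Lemma incident_end e u v : ip e u v -> end_of e u.
Proof. by case=> -[h1 h2]; [left|right]. Qed.

Lemma nonloop_incident e u v : nonloop e -> ip e u v -> u <> v.
Proof. by move=> nl [[<- <-]|[<- <-]] // h; apply: nl. Qed.

Lemma bset_conn v e x : nonloop e -> end_of e x -> x <> v -> bset v e = cn (but v) x.
Proof.
move=> nl ex xv; have [y xy] := end_other ex.
have yE : y <> v -> cn (but v) x = cn (but v) y.
  by move=> yv; apply: conn_eq; apply: conn_adj => //; exists e.
apply/funext => z; apply/propext; rewrite /bset; case: xy => -[-> ->]; split.
- by case=> -[h1 h2] //; rewrite yE.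
- by left.
- by case=> -[h1 h2] //; rewrite yE.
- by right.
Qed.

Lemma block_bset v e x : block_vertex e x -> x <> v -> bset v e = cn (but v) x.
Proof. by move=> [f [nf ef] fx] xv; rewrite ef; apply: bset_conn. Qed.

Lemma in_block_refl e : nonloop e -> in_block e e.
Proof. by split. Qed.

Lemma in_block_sym e f : nonloop e -> in_block e f -> in_block f e.
Proof. by move=> ne [nf h]; split=> // v; rewrite h. Qed.

Lemma in_block_trans e f g : in_block e f -> in_block f g -> in_block e g.
Proof. by move=> [_ h1] [ng h2]; split=> // v; rewrite h1. Qed.

(** For an edge [g] of the path and a vertex [v], one of the two parts of the path on either side of
    [g] avoids [v]. It puts [g] into the same component minus [v] as an end of the path that belongs
    to the block. *)
Lemma path_block_edges e x p : path (stepin s t (fun=> True)) x p -> uniq (x :: p) ->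
  block_vertex e x -> block_vertex e (last x p) ->
  forall p1 b p2 g, p = p1 ++ b :: p2 -> ip g (last x p1) b -> in_block e g.
Proof.
move=> pp up bx bl p1 b p2 g ep gab; move: pp up bl; rewrite {}ep.
rewrite cat_path last_cat [path _ _ (b :: _)]/= => /andP[pp1 /andP[_ pp2]] up bl.
have mem_a : last x p1 \in x :: p1 by apply: mem_last.
have : uniq ((x :: p1) ++ b :: p2) by [].
rewrite cat_uniq => /and3P[_ /hasPn dj _].
have ng : nonloop g.
  move=> h; have ab : last x p1 = b by case: gab => -[<- <-].
  by have := dj b (mem_head _ _); rewrite /= -ab mem_a.
split=> // v; have [vp|vp] := boolP (v \in x :: p1).
  have vnot z : z \in b :: p2 -> z <> v.
    by move=> zp e'; have := dj z zp; rewrite /= e' vp.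
  have bv : b <> v by apply: vnot; rewrite mem_head.
  have lv : last b p2 <> v by apply: vnot; apply: mem_last.
  rewrite (block_bset bl lv) (bset_conn ng (incident_end (incident_pair_sym gab)) bv).
  apply/esym/conn_eq/path_conn => //; apply: path_stepin_sub pp2 => z zp _.
  by apply: vnot; rewrite inE zp orbT.
have vnot z : z \in x :: p1 -> z <> v by move=> zp e'; rewrite -e' zp in vp.
have xv : x <> v by apply: vnot; rewrite mem_head.
rewrite (block_bset bx xv) (bset_conn ng (incident_end gab) (vnot _ mem_a)).
apply/conn_eq/path_conn => //; apply: path_stepin_sub pp1 => z zp _.
by apply: vnot; rewrite inE zp orbT.
Qed.

(** A path between two vertices of a block stays in the block, so properties can be carried along
    its edges alone. *)
Lemma block_conn_ind e A (P : V -> Prop) x y : block_vertex e x -> block_vertex e y ->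
  cn A x y -> P x ->
  (forall g u v, in_block e g -> ip g u v -> A u -> A v -> P u -> P v) -> P y.
Proof.
move=> bx byy cxy Px step; have Ax := conn_inl cxy.
have [p [pp lp up]] := conn_uniq cxy; rewrite -lp in byy *.
have pT : path (stepin s t (fun=> True)) x p by apply: path_stepin_sub pp.
have edges := path_block_edges pT up bx byy.
suff h p1 p2 : p = p1 ++ p2 -> P (last x p1) /\ A (last x p1).
  by have [] := h p [::] (esym (cats0 p)).
elim/last_ind: p1 p2 => [|p1 b IHp] p2 ep //.
rewrite cat_rcons in ep; have [P1 A1] := IHp _ ep; rewrite last_rcons.
move: pp; rewrite ep cat_path /= => /and3P[_ /asboolP[Ab [g gab]] _].
by split=> //; apply: step (edges _ _ _ _ ep gab) gab A1 Ab P1.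
Qed.

(** Attaching to each vertex of the block its component outside the block turns
    a cut of the block into a cut of the graph with the same edges. *)
Lemma block_conn_ge e k x y Y : conn_ge s t k x y -> block_vertex e x -> block_vertex e y ->
  Y x -> ~ Y y -> atleast k (fun f => in_block e f /\ crosses s t Y f).
Proof.
move=> cxy bx byy Yx nYy.
pose E' := {f : E | ~~ `[< in_block e f >]}.
pose cB := conn (fun f : E' => s (val f)) (fun f : E' => t (val f)) (fun=> True).
have cB_eq a b : block_vertex e a -> block_vertex e b -> cB a b -> a = b.
  move=> ba bb cab; have [p [pp lp up]] := conn_uniq cab; rewrite -lp in bb *.
  case: p pp {lp} bb up => [|c p] // pp bb up; exfalso.
  have pT : path (stepin s t (fun=> True)) a (c :: p).
    elim: (c :: p) (a) pp => //= d q IHq a' /andP[/asboolP[_ [f hf]] /IHq->].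
    by rewrite andbT; apply/asboolP; split=> //; exists (val f).
  move: pp => /= /andP[/asboolP[_ [f hf]] _].
  have h := @path_block_edges e a (c :: p) pT up ba bb [::] c p (val f) erefl hf.
  by have /asboolP := valP f.
pose Y' v := exists z, [/\ block_vertex e z, Y z & cB z v].
have Y'x : Y' x by exists x; split=> //; apply: conn_refl.
have Y'y : ~ Y' y by move=> [z [bz Yz zy]]; apply: nYy; rewrite -(cB_eq z y).
apply: atleast_sub (cxy Y' Y'x Y'y) => f /crossesP[u [v [uv [z [bz Yz zu]] nv]]].
have fB : in_block e f.
  apply: contrapT => nf; apply: nv; exists z; split=> //.
  have nf' : ~~ `[< in_block e f >] by apply/asboolP.
  by apply: (conn_step zu) => //; exists (exist _ f nf').
split=> //; have bu : block_vertex e u by exists f => //; apply: incident_end uv.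
apply: (crosses_pair uv); first by rewrite -(cB_eq z u).
move=> Yv; apply: nv; exists v; split=> //; last exact: conn_refl.
by exists f => //; apply: incident_end (incident_pair_sym uv).
Qed.

Lemma block_connected e x y : block_vertex e x -> block_vertex e y -> cn (fun=> True) x y.
Proof.
move=> bx byy; have [f [nf ef] fy] := byy; have [y' yy'] := end_other fy.
have yn : y <> y' := nonloop_incident nf yy'.
have [->|xy'] := pselect (x = y').
  by apply: conn_adj => //; exists f; apply: incident_pair_sym.
have := block_bset bx xy'; rewrite (block_bset byy yn) => h.
have : cn (but y') x y by rewrite -h; apply: conn_refl.
exact: conn_sub.
Qed.

(** Suppose that [g], from [u] to [v], alone crosses [X], and let [h] be another edge of the block.
    A path avoiding [v] leads from [u] to [h] and one avoiding [u] leads from [h] to [v]; neither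
    uses [g], so [X] is never left. *)
Lemma block_conn2 e h1 h2 x y : in_block e h1 -> in_block e h2 -> h1 <> h2 ->
  block_vertex e x -> block_vertex e y -> conn_ge s t 2 x y.
Proof.
move=> b1 b2 h12 bx byy X Xx nXy.
have [g [u [v [bg uv Xu nXv]]]] : exists g u v, [/\ in_block e g, ip g u v, X u & ~ X v].
  apply: contrapT => no; apply: nXy.
  apply: (block_conn_ind bx byy (block_connected bx byy) Xx) => g u v bg uv _ _ Xu.
  by apply: contrapT => nXv; apply: no; exists g, u, v.
have [|only] := pselect (exists2 g', crosses s t X g' & g' <> g).
  move=> [g' cg' g'g]; exists [:: g; g']; split=> //.
    by rewrite /= inE andbT; apply/eqP => h; apply: g'g.
  move=> f; rewrite !inE => /orP[] /eqP-> //.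
  exact: crosses_pair uv Xu nXv.
exfalso; have {}only g' : crosses s t X g' -> g' = g.
  by move=> c; apply: contrapT => h; apply: only; exists g'.
have bu : block_vertex e u by exists g => //; apply: incident_end uv.
have bv : block_vertex e v by exists g => //; apply: incident_end (incident_pair_sym uv).
have uvn : u <> v := nonloop_incident bg.1 uv.
have [h [bh hg]] : exists h, in_block e h /\ h <> g.
  have [e1|] := pselect (h1 = g); last by exists h1.
  by exists h2; split=> // e2; apply: h12; rewrite e1 e2.
have pick w : exists2 a, end_of h a & a <> w.
  have [e1|] := pselect (s h = w); last by exists (s h) => //; left.
  exists (t h); first by right.
  by move=> e2; apply: bh.1; rewrite e1 e2.
have same a b : end_of h a -> end_of h b -> X a -> X b.
  move=> ha hb Xa; apply: contrapT => nXb; apply: hg; apply: only.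
  by case: ha hb Xa nXb => <- [] <- Xa nXb //; [left|right].
have noc w a b : (w = u \/ w = v) -> cn (but w) a b -> X a -> X b.
  move=> hw cab Xa; apply: (conn_no_cross cab Xa) => f p q pq pw qw Xp.
  apply: contrapT => nXq; have fg := only f (crosses_pair pq Xp nXq).
  have pE : p = u /\ q = v.
    rewrite fg in pq; case: (uv) pq => -[h3 h4] [] [h5 h6].
    - by rewrite -h5 -h6.
    - by case: nXv; rewrite -h4 h6.
    - by case: nXv; rewrite -h3 h5.
    - by rewrite -h5 -h6.
  by case: hw => hw; [apply: pw|apply: qw]; rewrite hw; case: pE.
have [a ha au] := pick u; have [b hb bvn] := pick v.
have ba : block_vertex e a by exists h.
have bb : block_vertex e b by exists h.
have cav : cn (but u) a v.
  have vu : v <> u by move=> h'; apply: uvn.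
  by rewrite -(block_bset ba au) (block_bset bv vu); apply: conn_refl.
have cub : cn (but v) u b.
  by rewrite -(block_bset bu uvn) (block_bset bb bvn); apply: conn_refl.
apply: nXv; apply: (noc u a v (or_introl erefl) cav).
by apply: (same b a hb ha); apply: (noc v u b (or_intror erefl) cub).
Qed.

Hypothesis rl : rayless_ends s t.
Hypothesis fs : forall u v, u <> v -> exists X, [/\ fincut s t X, X u & ~ X v].

(** In an infinite block some component keeps infinitely many of its edges after each deletion,
    which makes a ray. For if deleting [w] left only small components, one of them would miss a
    finite cut separating [w] from [W], and such a component turns out to meet every edge of the
    block. *)
Lemma block_finite e : nonloop e -> exists l : seq E, forall f, in_block e f -> f \in l.
Proof.
move=> ne; apply: contrapT => nfin.
have {}nfin (l : seq E) : exists2 f, in_block e f & f \notin l.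
  apply: contrapT => h; apply: nfin; exists l => f bf; apply: contrapT => /negP fl.
  by apply: h; exists f.
apply: rl; apply: (@ray_builder _ _ s t (fun D => forall l : seq E, exists f x,
  [/\ in_block e f, f \notin l, end_of f x & D x])).
  exists (s e) => l; have [f bf fl] := nfin l.
  have : bset (t e) f (s e) by rewrite -bf.2; left; split=> //; apply: conn_refl.
  by case=> -[h1 h2]; [exists f, (s f)|exists f, (t f)]; split=> //;
    [left|apply: conn_sub (conn_sym h2)|right|apply: conn_sub (conn_sym h2)].
move=> W v w BigD Dw; apply: contrapT => no.
have oWw : off W w := conn_inr Dw.
have [X [[L XL] Xw XW]] : exists X, [/\ fincut s t X, X w & forall z, X z -> off W z].
  by apply: fincut_off => w' w'W; apply: fs => h; rewrite h /off w'W in oWw.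
set O := off (w :: W).
have OW z : O z -> off W z by move=> /offS[].
have laP a : exists l : seq E, cn (off W) v a -> O a ->
    forall f x, in_block e f -> end_of f x -> cn O a x -> f \in l.
  apply: contrapT => h; have h' l := contra_not (fun k => ex_intro _ l k) h.
  apply: no; exists a; first by apply: contrapT => n; case: (h' [::]).
  split; first by apply: contrapT => n; case: (h' [::]).
  move=> l; apply: contrapT => n; apply: (h' l) => _ _ f x bf fx ax.
  by apply: contrapT => /negP fl; apply: n; exists f, x.
have [la laE] := choice laP.
(* The edge [f] avoids the cut [L], and it lies in none of the finitely many small components that
   contain ends of edges in [L]. *)
have [f [x0 [bf fl fx0 Dx0]]] := BigD (L ++ flatten [seq la (s g) ++ la (t g) | g <- L]).
move: fl; rewrite mem_cat negb_or => /andP[fL fla].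
have [x [fx Dx xw]] : exists x, [/\ end_of f x, cn (off W) v x & x <> w].
  have [xw|xw] := pselect (x0 = w); last by exists x0.
  have [y xy] := end_other fx0; have xyn := nonloop_incident bf.1 xy.
  exists y; split; first exact: incident_end (incident_pair_sym xy).
    have [yW|yW] := boolP (y \in W).
      have cf : crosses s t X f.
        by apply: (crosses_pair xy); [rewrite xw|move=> /XW; rewrite /off yW].
      by rewrite (XL f cf) in fL.
    by apply: (conn_step Dx0) => //; exists f.
  by move=> h; apply: xyn; rewrite xw h.
have Ox : O x by apply/offS; split=> //; apply: conn_inr Dx.
have bx : block_vertex e x by exists f.
have noL g z : g \in L -> end_of g z -> ~ cn O x z.
  move=> gL gz xz; case/negP: fla.
  have Dz : cn (off W) v z by apply: conn_trans Dx _; apply: conn_sub xz.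
  apply/flatten_mapP; exists g => //; rewrite mem_cat.
  have := laE z Dz (conn_inr xz) f x bf fx (conn_sym xz).
  by case: gz => ->; rewrite ?orbT // => ->; rewrite ?orbT.
have [d [wd xd]] : exists d, adj s t w d /\ cn O x d.
  have cwx : cn (off W) w x := conn_trans (conn_sym Dw) Dx.
  have [p [pp lp up]] := conn_uniq cwx.
  have [|d [_ wd _ cd]] := path_first oWw pp up.
    by move=> h; apply: xw; rewrite -lp h.
  exists d; split=> //; apply: conn_sym; rewrite -lp; apply: conn_sub cd.
  by move=> z [h1 h2]; apply/offS.
have Xd : X d.
  case: wd => g wd; apply: contrapT => nXd.
  apply: (noL g d) xd; last exact: incident_end (incident_pair_sym wd).
  exact: XL (crosses_pair wd Xw nXd).
have XD z : cn O x z -> X z.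
  move=> xz; have dz : cn O d z := conn_trans (conn_sym xd) xz.
  apply: (conn_no_cross (conn_sub_conn dz) Xd) => g p q pq dp dq Xp.
  apply: contrapT => nXq; apply: (noL g p); last exact: conn_trans xd dp.
    exact: XL (crosses_pair pq Xp nXq).
  exact: incident_end pq.
(* The component of [x] stays inside [X], away from [W]. So it is a full component of the graph
   minus [w], and by the definition of blocks every edge of the block meets it. *)
have sub z : cn (but w) x z -> cn O x z.
  move=> xz; apply: (conn_ind (P := cn O x) xz); first exact: conn_refl.
  move=> p q _ qw [g pq] xp; apply: (conn_step xp); last by exists g.
  apply/offS; split=> //; apply: XW; apply: contrapT => nXq.
  apply: (noL g p) => //; last exact: incident_end pq.
  exact: XL (crosses_pair pq (XD p xp) nXq).
apply: no; exists x => //; split=> // l; have [f' bf' f'l] := nfin l.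
have : bset w f' x by rewrite -bf'.2 (block_bset bx xw); apply: conn_refl.
by case=> -[h1 h2]; [exists f', (s f')|exists f', (t f')]; split=> //;
  [left|apply/sub/conn_sym|right|apply/sub/conn_sym].
Qed.

Definition tail_of (sg : E -> bool) f := if sg f then s f else t f.
Definition head_of (sg : E -> bool) f := if sg f then t f else s f.
Definition outarc sg X f := X (tail_of sg f) /\ ~ X (head_of sg f).

Definition good_on_block sg e := forall X x y k, block_vertex e x -> block_vertex e y ->
  X x -> ~ X y -> conn_ge s t (2 * k) x y ->
  atleast k (fun f => in_block e f /\ outarc sg X f).

Lemma block_orientation e : nonloop e -> exists sg, good_on_block sg e.
Proof.
move=> ne; have [l hl] := block_finite ne.
pose l' := undup [seq f <- l | `[< in_block e f >]].
have ml' f : f \in l' <-> in_block e f.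
  rewrite mem_undup mem_filter; split=> [/andP[/asboolP]//|bf].
  by rewrite hl // andbT; apply/asboolP.
have [sg hsg] := finite_well_balanced s t (undup_uniq [seq f <- l | `[< in_block e f >]]).
exists sg => X x y k bx byy Xx nXy cge.
have : k <= count (fun f => `[< X (tail_of sg f) >] && ~~ `[< X (head_of sg f) >]) l'.
  apply: (hsg (fun v => `[< X v >]) x y); [exact/asboolP|exact/asboolP|].
  move=> Y Yx nYy; have al := block_conn_ge (Y := fun v => Y v) cge bx byy Yx (negP nYy).
  apply: count_atleast al _ => f [bf cf]; split; first exact/ml'.
  by case: cf => -[h1 h2]; [rewrite h1; case: (Y (t f)) h2|rewrite h2; case: (Y (s f)) h1].
move=> /(atleast_count (undup_uniq _)); apply: atleast_sub => f [/ml' bf /andP[/asboolP h1 /asboolP h2]].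
by split.
Qed.

(** Loops, which in the quotient are the edges inside a similarity class, stand for themselves and
    can be reversed one by one. *)
Definition block_rep e := if `[< nonloop e >] then choose (fun f => `[< in_block e f >]) e else e.

Lemma block_rep_in e : nonloop e -> in_block e (block_rep e).
Proof.
move=> ne; rewrite /block_rep asboolT //; apply/asboolP.
by apply: (@chooseP _ (fun f => `[< in_block e f >])); apply/asboolP/in_block_refl.
Qed.

Lemma block_rep_eq e f : nonloop e -> in_block e f -> block_rep e = block_rep f.
Proof.
move=> ne bf; have nf := bf.1; rewrite /block_rep !asboolT //.
rewrite (@choose_id _ (fun g => `[< in_block e g >]) e f); last 2 first.
- exact/asboolP/in_block_refl.
- exact/asboolP.
apply: eq_choose => g; apply/asboolP/asboolP; apply: in_block_trans => //.
exact: in_block_sym.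
Qed.

Lemma block_rep_loop e : ~ nonloop e -> block_rep e = e.
Proof. by move=> h; rewrite /block_rep asboolF. Qed.

Lemma block_rep_inv e f : nonloop e -> block_rep f = block_rep e -> in_block e f.
Proof.
move=> ne h; have be := block_rep_in ne.
have [nf|lf] := pselect (nonloop f); last by rewrite -h block_rep_loop // in be; case: be.
apply: in_block_trans be _; rewrite -h; apply: in_block_sym => //.
exact: block_rep_in.
Qed.

Lemma base_orientation : exists sg, forall e, nonloop e -> good_on_block sg e.
Proof.
have hP e : exists sg, nonloop e -> good_on_block sg e.
  have [ne|le] := pselect (nonloop e); last by exists (fun=> true).
  by have [sg h] := block_orientation ne; exists sg.
have [sg hsg] := choice hP; exists (fun f => sg (block_rep f) f) => e ne X x y k bx byy Xx nXy cge.
have be := block_rep_in ne; have eb := in_block_sym ne be.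
have vb z : block_vertex e z -> block_vertex (block_rep e) z.
  by move=> [f bf fz]; exists f => //; apply: in_block_trans eb bf.
have := hsg _ be.1 X x y k (vb _ bx) (vb _ byy) Xx nXy cge.
apply: atleast_sub => f [bf of_]; have bef := in_block_trans be bf.
by split=> //; move: of_; rewrite /outarc /tail_of /head_of (block_rep_eq ne bef).
Qed.

(** Reversed arcs leave [X] exactly when the original ones leave its complement, so the hypothesis
    is applied there with [x] and [y] exchanged. *)
Lemma flip_orientation sg (phi : E -> bool) : (forall e, nonloop e -> good_on_block sg e) ->
  forall e, nonloop e -> good_on_block (fun f => sg f (+) phi (block_rep f)) e.
Proof.
move=> good e ne X x y k bx byy Xx nXy cge.
case ph: (phi (block_rep e)).
  have nnx : ~ ~ X x by move=> h.
  have := good e ne (fun v => ~ X v) y x k byy bx nXy nnx (conn_ge_sym cge).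
  apply: atleast_sub => f [bf of_]; split=> //; move: of_.
  rewrite /outarc /tail_of /head_of -(block_rep_eq ne bf) ph addbT.
  by case: (sg f) => /= -[h1 h2]; split=> //; apply: contrapT.
have := good e ne X x y k bx byy Xx nXy cge.
apply: atleast_sub => f [bf of_]; split=> //; move: of_.
by rewrite /outarc /tail_of /head_of -(block_rep_eq ne bf) ph addbF.
Qed.

(** Restricting a set to the component of [x] minus [z] turns a cut between [x] and [z] into one
    between [x] and [y] without new edges. *)
Lemma separator_conn_ge k x y z : x <> z -> ~ cn (but z) x y -> conn_ge s t k x y ->
  conn_ge s t k x z.
Proof.
move=> xz nxy cge Y Yx nYz.
have nY' : ~ (Y y /\ cn (but z) x y) by case.
have al := cge (fun v => Y v /\ cn (but z) x v) (conj Yx (conn_refl s t (A := but z) xz)) nY'.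
apply: atleast_sub al => e /crossesP[u [v [uv [Yu xu] nv]]]; apply: (crosses_pair uv Yu) => Yv; apply: nv; split=> //.
by apply: (conn_step xu); [move=> h; apply: nYz; rewrite -h|exists e].
Qed.

(** If some [z] separates [x] from [y], one of the pairs [x], [z] and [z], [y] is again split by
    [X], as highly connected, and joined by a shorter path. If there is no such [z], no vertex tells
    the first and the last edge of a path from [x] to [y] apart, so [x] and [y] share a block. *)
Lemma blocks_conn sg : (forall e, nonloop e -> good_on_block sg e) ->
  forall X x y k, X x -> ~ X y -> conn_ge s t (2 * k) x y -> atleast k (outarc sg X).
Proof.
move=> good X x y k Xx nXy cge.
have [->|k0] := posnP k; first by exists [::].
have cxy : cn (fun=> True) x y.
  apply: contrapT => nxy; have := cge (cn (fun=> True) x) (conn_refl _ _ I) nxy.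
  case=> -[|e l]; first by case=> _ /= h; move: h; nlia.
  case=> _ _ /(_ e (mem_head _ _))/crossesP[u [v [uv xu xv]]]; case: xv.
  by apply: (conn_step xu) => //; exists e.
case: cxy => _ [p pp lp].
have [n] := ubnP (size p); elim: n p x y pp lp Xx nXy cge => // n IHn p0 x y.
move=> pp0 lp0 Xx nXy cge sz.
have xy : x <> y by move=> h; apply: nXy; rewrite -h.
have [p [pp lp up szp]] : exists p, [/\ path (stepin s t (fun=> True)) x p, last x p = y,
    uniq (x :: p) & size p <= size p0].
  rewrite -lp0; case/shortenP: pp0 => p pp up sub; exists p; split=> //.
  by apply: uniq_leq_size => //; case/andP: up.
have {}sz : size p <= n by apply: leq_trans szp _.
have [[z [zx zy nsep]]|nosep] :=
    pselect (exists z, [/\ z <> x, z <> y & ~ cn (but z) x y]).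
  have zp : z \in p.
    apply: contrapT => /negP zp; apply: nsep; rewrite -lp; apply: path_conn.
      by move=> h; apply: zx.
    by apply: path_stepin_sub pp => w wp _ h; rewrite -h wp in zp.
  case/splitPr: zp pp lp up sz => p1 p2; rewrite cat_path last_cat /= size_cat /=.
  move=> /and3P[pp1 pz pp2] lp _ sz.
  have [Xz|nXz] := pselect (X z).
    apply: (IHn p2 z y) => //; last by nlia.
    apply: conn_ge_sym; apply: (@separator_conn_ge _ y x z).
    - by move=> h; apply: zy.
    - by move=> h; apply/nsep/conn_sym.
    - exact: conn_ge_sym.
  apply: (IHn (rcons p1 z) x z) => //.
  - by rewrite rcons_path pp1.
  - by rewrite last_rcons.
  - by apply: (separator_conn_ge _ nsep cge) => h; apply: zx.
  - by rewrite size_rcons; case: (p2) lp sz => [|c q] /= lp sz; [case: zy|nlia].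
have {}nosep z : z <> x -> z <> y -> cn (but z) x y.
  by move=> zx zy; apply: contrapT => h; apply: nosep; exists z.
have [|a [_ [e xa] _ ca]] := path_first (I : (fun=> True) x) pp up.
  by move=> h; apply: xy; rewrite -lp h.
have {}ca : cn (but x) a y by rewrite -lp; apply: conn_sub ca => z [].
have [b [f yb] cb] : exists2 b, adj s t y b & cn (but y) x b.
  case/lastP: p pp lp up {sz szp} => [|p c] //.
  rewrite rcons_path last_rcons => /andP[pp /asboolP[_ bc]] cy up; subst c.
  exists (last x p); first exact: adj_sym.
  apply: path_conn => //; apply: path_stepin_sub pp => z zp _ h.
  by move: up; rewrite /= rcons_uniq -h zp andbF.
have ne : nonloop e by move=> h; apply: (conn_inl ca); case: xa => -[<- <-].
have nf : nonloop f by move=> h; apply: (conn_inr cb); case: yb => -[<- <-].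
have bf : in_block e f.
  split=> // v; have [->|vx] := pselect (v = x).
    rewrite (bset_conn ne (incident_end (incident_pair_sym xa)) (conn_inl ca)).
    rewrite (bset_conn nf (incident_end yb)); first exact: conn_eq.
    by move=> h; apply: xy.
  rewrite (bset_conn ne (incident_end xa)); last by move=> h; apply: vx.
  have [->|vy] := pselect (v = y).
    by rewrite (bset_conn nf (incident_end (incident_pair_sym yb)) (conn_inr cb)); apply: conn_eq.
  rewrite (bset_conn nf (incident_end yb)); last by move=> h; apply: vy.
  exact/conn_eq/nosep.
have bx : block_vertex e x by exists e; [apply: in_block_refl|apply: incident_end xa].
have byy : block_vertex e y by exists f => //; apply: incident_end yb.
by apply: atleast_sub (good e ne X x y k bx byy Xx nXy cge) => g [].
Qed.

End Blocks.

(** * Linking a similarity class *)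

Section Reach.
Variable T : Type.
Implicit Types (R : T -> T -> Prop).

Inductive reach R (x : T) : T -> Prop :=
| reach_refl : reach R x x
| reach_step u v : reach R x u -> R u v -> reach R x v.

Lemma reach1 R x y : R x y -> reach R x y.
Proof. by apply: reach_step; apply: reach_refl. Qed.

Lemma reach_trans R x y z : reach R x y -> reach R y z -> reach R x z.
Proof. by move=> xy; elim=> // u v _ xu uv; apply: reach_step uv. Qed.

Lemma reach_sub R R' x y : (forall u v, R u v -> R' u v) -> reach R x y -> reach R' x y.
Proof. by move=> h; elim=> [|u v _ xu /h]; [apply: reach_refl|apply: reach_step]. Qed.

Lemma reach_rev R x y : reach R x y -> reach (fun u v => R v u) y x.
Proof.
elim=> [|u v _ ux uv]; first exact: reach_refl.
by apply: reach_trans ux; apply: reach1.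
Qed.

Lemma reach_cross R (P : T -> Prop) x y : reach R x y -> P x -> ~ P y ->
  exists u v, [/\ R u v, P u & ~ P v].
Proof.
move=> xy Px; elim: xy => // u v _ IH uv nPv.
by have [Pu|/IH//] := pselect (P u); exists u, v.
Qed.

End Reach.

Lemma eventually_all (T : eqType) (P : nat -> T -> Prop) (l : seq T) :
  (forall w, w \in l -> exists N, forall n, N <= n -> P n w) ->
  exists N, forall n, N <= n -> forall w, w \in l -> P n w.
Proof.
elim: l => [|w l IHl] h; first by exists 0.
have [|N1 h1] := IHl; first by move=> w' w'l; apply: h; rewrite inE w'l orbT.
have [N2 h2] := h w (mem_head _ _).
exists (maxn N1 N2) => n; rewrite geq_max => /andP[n1 n2] w'; rewrite inE.
by case/orP => [/eqP->|]; [apply: h2|apply: h1].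
Qed.

(** [lk U u v] says that the unit [U] contains a directed path from [u] to [v].
    Every unit may be reversed as a whole. Raylessness makes it possible to
    choose, for any two vertices of [C], finitely many units outside a given
    finite set which can be reversed so as to link them in both directions. *)
Section Merging.
Variables (V E : choiceType) (s t : E -> V) (C : V -> Prop) (lk : E -> V -> V -> Prop).
Implicit Types (u v w x y a b : V) (F : seq E) (U : E) (R : V -> V -> Prop).

Let und U u v := lk U u v \/ lk U v u.

Hypothesis rl : rayless_ends s t.
Hypothesis lkC : forall U u v, lk U u v -> C u /\ C v.
Hypothesis lk_cut : forall (A : V -> Prop) x y F, C x -> A x -> C y -> ~ A y ->
  exists U u v, [/\ U \notin F, A u, ~ A v & und U u v].
Hypothesis lk_conn : forall W : seq V, exists F, forall U u v, U \notin F -> und U u v ->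
  off W u -> off W v -> conn s t (off W) u v.

Definition garc (g : seq (E * bool)) u v :=
  exists U (b : bool), (U, b) \in g /\ (if b then lk U v u else lk U u v).

Definition group_for F u v g := [/\ uniq (map fst g), forall U, U \in map fst g -> U \notin F,
  reach (garc g) u v & reach (garc g) v u].

Definition linkable u v := [/\ C u, C v & forall F, exists g, group_for F u v g].

Let undC U u v : und U u v -> C u /\ C v.
Proof. by case=> /lkC[]. Qed.

Definition equivC R := [/\ forall u, C u -> R u u, forall u v, R u v -> R v u,
  forall u v w, R u v -> R v w -> R u w & forall u v, R u v -> C u /\ C v].

(** Different classes of such an equivalence are joined by finitely many units only. *)
Definition link_closed R := forall a b, C a -> C b ->
  (forall F, exists U u v, [/\ U \notin F, R a u, R b v & und U u v]) -> R a b.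

Let garc_cat1 g h u v : reach (garc g) u v -> reach (garc (g ++ h)) u v.
Proof.
by apply: reach_sub => x y [U [b [Ug l]]]; exists U, b; rewrite mem_cat Ug.
Qed.

Let garc_cat2 g h u v : reach (garc h) u v -> reach (garc (g ++ h)) u v.
Proof.
by apply: reach_sub => x y [U [b [Ug l]]]; exists U, b; rewrite mem_cat Ug orbT.
Qed.

Let group_cat F (g h : seq (E * bool)) : uniq (map fst g) -> (forall U, U \in map fst g -> U \notin F) ->
  uniq (map fst h) -> (forall U, U \in map fst h -> U \notin F ++ map fst g) ->
  uniq (map fst (g ++ h)) /\ (forall U, U \in map fst (g ++ h) -> U \notin F).
Proof.
move=> ug gF uh hF; rewrite map_cat; split.
  rewrite cat_uniq ug uh andbT; apply/hasPn => U /hF; rewrite mem_cat negb_or.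
  by case/andP.
move=> U; rewrite mem_cat => /orP[/gF//|/hF].
by rewrite mem_cat negb_or => /andP[].
Qed.

Let linkable_equiv : equivC linkable.
Proof.
split.
- move=> u Cu; split=> // F; exists [::]; split=> //; exact: reach_refl.
- by move=> u v [Cu Cv h]; split=> // F; have [g [g1 g2 g3 g4]] := h F; exists g.
- move=> u v w [Cu Cv h1] [_ Cw h2]; split=> // F.
  have [g [g1 g2 g3 g4]] := h1 F; have [h [k1 k2 k3 k4]] := h2 (F ++ map fst g).
  exists (g ++ h); have [c1 c2] := group_cat g1 g2 k1 k2; split=> //.
    exact: reach_trans (garc_cat1 _ g3) (garc_cat2 _ k3).
  exact: reach_trans (garc_cat2 _ k4) (garc_cat1 _ g4).
- by move=> u v [].
Qed.

Let und_arc U u v : und U u v -> exists c : bool, garc [:: (U, c)] u v.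
Proof.
by case=> l; [exists false|exists true]; exists U; [exists false|exists true]; rewrite mem_head.
Qed.

(** One unit is spent on each direction. Its ends are joined to [a] and [b] by groups that avoid all
    units used before. *)
Let linkable_closed : link_closed linkable.
Proof.
move=> a b Ca Cb h; split=> // F.
have [_ sy tr _] := linkable_equiv.
have [U1 [u1 [v1 [U1F au1 bv1 l1]]]] := h F.
have [b1 arc1] := und_arc l1.
have [U2 [u2 [v2 [U2F au2 bv2 l2]]]] := h (U1 :: F).
have {}l2 : und U2 v2 u2 by case: l2; [right|left].
have [b2 arc2] := und_arc l2.
pose g0 := [:: (U1, b1); (U2, b2)].
have U12 : U2 != U1 by move: U2F; rewrite inE negb_or => /andP[].
have u0 : uniq (map fst g0) by rewrite /= inE eq_sym U12.
have f0 U : U \in map fst g0 -> U \notin F.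
  rewrite !inE => /orP[/eqP->//|/eqP->].
  by move: U2F; rewrite inE negb_or => /andP[].
have ext (g : seq (E * bool)) x y : linkable x y -> uniq (map fst g) -> (forall U, U \in map fst g -> U \notin F) ->
    exists h, [/\ uniq (map fst (g ++ h)), forall U, U \in map fst (g ++ h) -> U \notin F,
      reach (garc (g ++ h)) x y & reach (garc (g ++ h)) y x].
  move=> [_ _ l] ug gF; have [k [k1 k2 k3 k4]] := l (F ++ map fst g).
  exists k; have [c1 c2] := group_cat ug gF k1 k2.
  by split=> //; apply: garc_cat2.
have [h1 [c1 d1 p1 q1]] := ext g0 _ _ au1 u0 f0.
have [h2 [c2 d2 p2 q2]] := ext _ _ _ au2 c1 d1.
have [h3 [c3 d3 p3 q3]] := ext _ _ _ bv1 c2 d2.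
have [h4 [c4 d4 p4 q4]] := ext _ _ _ bv2 c3 d3.
exists ((((g0 ++ h1) ++ h2) ++ h3) ++ h4); split=> //.
- apply: (@reach_trans _ _ _ u1); first by do 3!apply: garc_cat1.
  apply: (@reach_trans _ _ _ v1); last by apply: garc_cat1.
  do 4!apply: garc_cat1; apply: reach1.
  by case: arc1 => U [c [Uc lc]]; exists U, c; split=> //; move: Uc; rewrite !inE => ->.
- apply: (@reach_trans _ _ _ v2) => //.
  apply: (@reach_trans _ _ _ u2); last by do 2!apply: garc_cat1.
  do 4!apply: garc_cat1; apply: reach1.
  by case: arc2 => U [c [Uc lc]]; exists U, c; split=> //; move: Uc; rewrite !inE => ->; rewrite orbT.
Qed.

(** The least link-closed equivalence. Minimality is an induction principle, applied first to
    [robust] and finally to [linkable]. *)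
Definition merged u v := forall R, equivC R -> link_closed R -> R u v.

Let merged_equiv : equivC merged.
Proof.
split.
- by move=> u Cu R [h _ _ _] _; apply: h.
- by move=> u v m R eR cR; have [_ sy _ _] := eR; apply: sy; apply: m.
- by move=> u v w m1 m2 R eR cR; have [_ _ tr _] := eR; apply: tr (m1 R eR cR) (m2 R eR cR).
- move=> u v m; apply: (m (fun u v => C u /\ C v)); last by move=> a b.
  by split=> [|x y []|x y z [] ? _ []|].
Qed.

Let merged_closed : link_closed merged.
Proof.
move=> a b Ca Cb h R eR cR; apply: (cR a b Ca Cb) => F.
by have [U [u [v [UF au bv l]]]] := h F; exists U, u, v; split=> //; [apply: au|apply: bv].
Qed.

Let chain u F p q := merged u p /\ merged u q /\ exists2 U, U \notin F & und U p q.

(** Vertices that stay joined within their class after the loss of any finite set of units; this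
    allows the ray to be routed through fresh units. *)
Let robust u v := merged u v /\ forall F, reach (chain u F) u v.

Let chain_class u v F p q : merged u v -> chain u F p q -> chain v F p q.
Proof.
have [_ sy tr _] := merged_equiv.
by move=> uv [h1 [h2 h3]]; split; [|split=> //]; apply: tr (sy _ _ uv) _.
Qed.

Let robust_equiv : equivC robust.
Proof.
have [re sy tr inC] := merged_equiv; split.
- by move=> u Cu; split; [apply: re|move=> F; apply: reach_refl].
- move=> u v [uv h]; split; first exact: sy.
  move=> F; apply: reach_sub (reach_rev (h F)) => p q /(chain_class uv)[h1 [h2 [U UF l]]].
  by split=> //; split=> //; exists U => //; case: l; [right|left].
- move=> u v w [uv h1] [vw h2]; split; first exact: tr uv vw.
  move=> F; apply: reach_trans (h1 F) _; apply: reach_sub (h2 F) => p q.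
  exact: (chain_class (sy _ _ uv)).
- by move=> u v [/inC].
Qed.

Let robust_closed : link_closed robust.
Proof.
move=> a b Ca Cb h; have [re sy tr inC] := merged_equiv; have [_ syR _ _] := robust_equiv.
have ab : merged a b.
  apply: merged_closed => // F; have [U [u [v [UF [au _] [bv _] l]]]] := h F.
  by exists U, u, v.
split=> // F; have [U [u [v [UF au bv l]]]] := h F.
apply: reach_trans (au.2 F) _; apply: (@reach_trans _ _ _ v).
  apply: reach1; split; first exact: au.1.
  by split; [apply: tr ab bv.1|exists U].
apply: reach_sub ((syR _ _ bv).2 F) => p q /(chain_class (sy _ _ bv.1)).
exact: (chain_class (sy _ _ ab)).
Qed.

Let merged_robust u v : merged u v -> robust u v.
Proof. by move=> m; apply: m; [apply: robust_equiv|apply: robust_closed]. Qed.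

Let reach_finite u F v : reach (chain u F) u v ->
  exists F2, reach (fun p q => merged u p /\ merged u q /\
    exists U, [/\ U \notin F, U \in F2 & und U p q]) u v.
Proof.
elim=> [|p q _ [F2 h] [up [uq [U UF l]]]]; first by exists [::]; apply: reach_refl.
exists (U :: F2); apply: (@reach_step _ _ _ p).
  apply: reach_sub h => x y [h1 [h2 [U' [h3 h4 h5]]]]; split=> //; split=> //.
  by exists U'; rewrite inE h4 orbT.
by split=> //; split=> //; exists U; rewrite mem_head.
Qed.

(** The current vertex, the earlier ones, all from other classes of [merged], and the units
    spent. *)
Let state := (V * seq V * seq E)%type.
Let inv (p : state) := C p.1.1 /\ forall w, w \in p.1.2 -> C w /\ ~ merged p.1.1 w.
Let next (p p' : state) := [/\ inv p', p'.1.2 = p.1.1 :: p.1.2, {subset p.2 <= p'.2} &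
  reach (fun x y => exists U, [/\ U \notin p.2, U \in p'.2, und U x y,
    merged p.1.1 x \/ x = p'.1.1 & merged p.1.1 y \/ y = p'.1.1]) p.1.1 p'.1.1].

(** Finitely many units join the class of [u] to the classes visited before. Avoiding these,
    [lk_cut] yields a unit into a new class, and [robust] leads to it through unspent units. *)
Let merged_next x y : C x -> C y -> ~ merged x y -> forall p, inv p -> exists p', next p p'.
Proof.
move=> Cx Cy nxy [[u ps] F] [/= Cu hps]; have [re sy tr inC] := merged_equiv.
have [y' Cy' uy'] : exists2 y', C y' & ~ merged u y'.
  have [ux|] := pselect (merged u x); last by exists x.
  by exists y => // uy; apply: nxy; apply: tr (sy _ _ ux) uy.
have [F1 [sF1 hF1]] : exists F1, {subset F <= F1} /\ forall w, w \in ps -> forall U p q,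
    U \notin F1 -> merged u p -> merged w q -> ~ und U p q.
  elim: ps hps => [|w ps IHps] hps; first by exists F; split.
  have [|F1 [sF1 hF1]] := IHps; first by move=> w' w'ps; apply: hps; rewrite inE w'ps orbT.
  have [Cw nuw] := hps w (mem_head _ _).
  have [Fw hFw] : exists Fw : seq E, forall U p q, U \notin Fw -> merged u p -> merged w q -> ~ und U p q.
    apply: contrapT => h; apply: nuw; apply: (merged_closed Cu Cw) => F'.
    apply: contrapT => h'; apply: h; exists F' => U p q UF up wq l.
    by apply: h'; exists U, p, q.
  exists (F1 ++ Fw); split; first by move=> U /sF1; rewrite mem_cat => ->.
  move=> w'; rewrite inE => /orP[/eqP->|w'ps] U p q; rewrite mem_cat negb_or => /andP[h1 h2].
    exact: hFw.
  exact: hF1.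
have [U0 [p0 [q0 [U0F up0 nq0 l0]]]] := lk_cut F1 Cu (re u Cu) Cy' uy'.
have [Cp0 Cq0] := undC l0.
have [F2 hF2] := reach_finite ((merged_robust up0).2 F).
exists (q0, u :: ps, F ++ U0 :: F2); split=> //=.
- split=> //= w; rewrite inE => /orP[/eqP->|wps].
    by split=> // h; apply: nq0; exact: (sy _ _ h).
  split; first by have [] := hps w wps.
  by move=> h; apply: (hF1 w wps U0 p0 q0 U0F up0 (sy _ _ h)).
- by move=> U UF; rewrite mem_cat UF.
- apply: (@reach_step _ _ _ p0); last first.
    exists U0; split=> //; [|by rewrite mem_cat mem_head orbT|by left|by right].
    by apply: contra U0F; apply: sF1.
  apply: reach_sub hF2 => p q [up [uq [U [UF UF2 l]]]]; exists U; split=> //; [|by left|by left].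
  by rewrite mem_cat inE UF2 !orbT.
Qed.

(** With two different classes the steps would go on forever. Classes and units are always new, so
    every finite [W] is eventually avoided, and [tail_ray] applies. *)
Let merged_total x y : C x -> C y -> merged x y.
Proof.
move=> Cx Cy; apply: contrapT => nxy; have [re sy tr inC] := merged_equiv.
have nextP p : exists p', inv p -> next p p'.
  have [ip|] := pselect (inv p); last by exists p.
  by have [p' h] := merged_next Cx Cy nxy ip; exists p'.
have [nxt nxtP] := choice nextP.
pose st n := iter n nxt ((x, [::]), [::]).
have inv_st n : inv (st n).
  by elim: n => [|n /nxtP[]//]; split.
have st_next n : next (st n) (st n.+1) := nxtP _ (inv_st n).
pose u n := (st n).1.1; pose F n := (st n).2.
have mem_u m n : m < n -> u m \in (st n).1.2.
  elim: n => // n IHn; have [_ -> _ _] := st_next n; rewrite ltnS inE leq_eqVlt.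
  by case/orP => [/eqP->|/IHn->]; rewrite ?eqxx ?orbT.
have distinct m n : m < n -> ~ merged (u n) (u m).
  by move=> /mem_u; have [_ h] := inv_st n => /h[].
have F_mono m n : m <= n -> {subset F m <= F n}.
  elim: n => [|n IHn]; first by rewrite leqn0 => /eqP->.
  rewrite leq_eqVlt => /orP[/eqP->//|]; rewrite ltnS => /IHn h U /h.
  by have [_ _ hs _] := st_next n; apply: hs.
apply: rl; apply: (@tail_ray _ _ s t u) => W.
have [FW hFW] := lk_conn W.
have [N1 h1] : exists N, forall n, N <= n -> forall U, U \in FW -> ~ (U \notin F n /\ U \in F n.+1).
  apply: eventually_all => U _; have [[m Um]|no] := pselect (exists m, U \in F m).
    by exists m => n mn [/negP[]]; apply: F_mono Um.
  by exists 0 => n _ [_ h]; apply: no; exists n.+1.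
have [N2 h2] : exists N, forall n, N <= n -> forall w, w \in W -> ~ merged (u n) w.
  apply: eventually_all => w _; have [[m um]|no] := pselect (exists m, merged (u m) w).
    exists m.+1 => n mn unw; apply: (distinct m n mn).
    exact: tr unw (sy _ _ um).
  by exists 0 => n _ h; apply: no; exists n.
exists (maxn N1 N2) => n; rewrite geq_max => /andP[n1 n2].
have offu m z : N2 <= m -> merged (u m) z -> off W z.
  by move=> hm mz; apply/negP => zW; apply: (h2 m hm z zW).
have self m : merged (u m) (u m) by apply: re; have [] := inv_st m.
have [_ _ _ hr] := st_next n; rewrite -/(u n) -/(u n.+1) in hr.
have off1 z : merged (u n) z \/ z = u n.+1 -> off W z.
  by case=> [|->]; [apply: offu|apply: (offu n.+1) => //; apply: leqW].
elim: hr => [|p q _ IH [U [UF UF' l hp hq]]]; first by apply: conn_refl; apply: off1; left.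
apply: conn_trans IH _; apply: hFW l _ _; [|exact: off1|exact: off1].
by apply/negP => UFW; apply: (h1 n n1 U UFW).
Qed.

Lemma linkable_total u v : C u -> C v -> linkable u v.
Proof.
by move=> Cu Cv; apply: (merged_total Cu Cv); [apply: linkable_equiv|apply: linkable_closed].
Qed.

End Merging.

Section Links.
Variables (V E : choiceType) (s t : E -> V).
Implicit Types (u v w x y z c d p q : V) (e f g : E).
Local Notation pi := (pi s t).
Let sq e := pi (s e).
Let tq e := pi (t e).
Local Notation qc := (conn sq tq).
Local Notation qi := (incident_pair sq tq).
Local Notation gi := (incident_pair s t).
Local Notation rep := (block_rep sq tq).
Local Notation bs := (bset sq tq).
Local Notation nl := (nonloop sq tq).
Local Notation blk := (in_block sq tq).

Hypothesis rl : rayless_ends s t.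
Variable sg0 : E -> bool.
Hypothesis good0 : forall e, nl e -> good_on_block sq tq sg0 e.

Let qrl : rayless_ends sq tq := quot_rayless rl.
Let qfs : forall u v, u <> v -> exists X, [/\ fincut sq tq X, X u & ~ X v] :=
  @quot_separable _ _ s t.

Definition root v := choose (fun u => `[< qc (fun=> True) v u >]) v.

Lemma root_eq u v : qc (fun=> True) u v -> root u = root v.
Proof.
move=> uv; rewrite /root (@choose_id _ (fun z => `[< qc (fun=> True) u z >]) u v); last 2 first.
- by apply/asboolP; apply: conn_refl.
- exact/asboolP.
by apply: eq_choose => z; rewrite (conn_eq uv).
Qed.

Lemma root_conn v : qc (fun=> True) v (root v).
Proof.
apply/asboolP; apply: (@chooseP _ (fun u => `[< qc (fun=> True) v u >])).
by apply/asboolP; apply: conn_refl.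
Qed.

(** The order on the vertices of the block tree rooted at [root c]. *)
Definition below c d := [/\ d <> c, qc (fun=> True) c d & ~ qc (but c) (root c) d].

(** The map contracting every similarity class except [c]. *)
Definition unglue c v := if `[< pi v = c >] then v else pi v.

Definition child_edge c e := exists2 d, qi e c d & below c d.
(** A block of the quotient hanging below [c], or a single edge inside the class of [c]. *)
Definition child_unit c U := exists2 e, rep e = U & (qi e c c \/ (nl e /\ child_edge c e)).

Definition lstep c (sg : E -> bool) U p q := exists e,
  [/\ rep e = U, unglue c (tail_of s t sg e) = p & unglue c (head_of s t sg e) = q].

Definition lk c U u v := [/\ child_unit c U, pi u = c, pi v = c & reach (lstep c sg0 U) u v].

Lemma gi_qi e u v : gi e u v -> qi e (pi u) (pi v).
Proof. by case=> -[<- <-]; [left|right]. Qed.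

Lemma qi_gi e x y : qi e x y -> exists u v, [/\ gi e u v, pi u = x & pi v = y].
Proof. by case=> -[h1 h2]; [exists (s e), (t e)|exists (t e), (s e)]; split=> //; [left|right]. Qed.

Lemma gi_orient sg e u v : gi e u v ->
  (tail_of s t sg e = u /\ head_of s t sg e = v) \/ (tail_of s t sg e = v /\ head_of s t sg e = u).
Proof.
by rewrite /tail_of /head_of => -[[<- <-]|[<- <-]]; case: (sg e); [left|right|right|left].
Qed.

Lemma gi_tail_head sg e : gi e (tail_of s t sg e) (head_of s t sg e).
Proof. by rewrite /tail_of /head_of; case: (sg e); [left|right]. Qed.

Lemma pi_tail sg e : pi (tail_of s t sg e) = tail_of sq tq sg e.
Proof. by rewrite /tail_of; case: (sg e). Qed.

Lemma pi_head sg e : pi (head_of s t sg e) = head_of sq tq sg e.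
Proof. by rewrite /head_of; case: (sg e). Qed.

Lemma unglue_in c v : pi v = c -> unglue c v = v.
Proof. by move=> h; rewrite /unglue asboolT. Qed.

Lemma unglue_out c v : pi v <> c -> unglue c v = pi v.
Proof. by move=> h; rewrite /unglue asboolF. Qed.

Lemma unglue_class c v u : unglue c v = u -> pi u = c -> v = u.
Proof.
rewrite /unglue; case: asboolP => // h vu uc; case: h.
by rewrite -vu pi_id in uc.
Qed.

Lemma block_at e f c : nl e -> nl f -> end_of sq tq e c -> end_of sq tq f c ->
  bs c e = bs c f -> blk e f.
Proof.
move=> ne nf ec fc h; split=> // v; have [->//|vc] := pselect (v = c).
by rewrite !(@bset_conn _ _ sq tq v _ c) // => h'; apply: vc.
Qed.

Lemma unit_finite U : exists l : seq E, forall f, rep f = U -> f \in l.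
Proof.
have [nU|lU] := pselect (nl U).
  have [l hl] := block_finite qrl qfs nU; exists l => f fU.
  have [nf|lf] := pselect (nl f); last by rewrite block_rep_loop // in fU; rewrite fU in lf.
  by apply: hl; apply: in_block_sym => //; rewrite -fU; apply: block_rep_in.
exists [:: U] => f fU; have [nf|lf] := pselect (nl f).
  by case: lU; rewrite -fU; case: (block_rep_in nf).
by rewrite -fU block_rep_loop // mem_head.
Qed.

Lemma child_other c e : nl e -> child_edge c e -> forall x, block_vertex sq tq e x -> x <> c ->
  bs c e x /\ below c x.
Proof.
move=> ne [d ecd bcd] x bx xc; have [dc ccd ncd] := bcd.
have bd : block_vertex sq tq e d.
  by exists e; [apply: in_block_refl|apply: incident_end (incident_pair_sym ecd)].
have dx : qc (but c) d x.
  by rewrite -(block_bset bd dc) (block_bset bx xc); apply: conn_refl.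
split; first by rewrite (block_bset bx xc); apply: conn_refl.
split=> //; first by apply: conn_trans ccd _; apply: conn_sub dx.
by move=> rx; apply: ncd; apply: conn_trans rx (conn_sym dx).
Qed.

Lemma not_child_edge c e d : nl e -> qi e c d -> ~ child_edge c e -> qc (but c) (root c) d.
Proof.
move=> ne ecd nch; apply: contrapT => h; apply: nch; exists d => //; split=> //.
  by move=> dc; apply: (nonloop_incident ne ecd).
by apply: conn_adj => //; exists e.
Qed.

(** Only edges of the finite block leave the branch, so it is bounded by a finite cut, and
    [sim_conn] keeps each of its classes together inside it. *)
Lemma branch_conn c e z1 z2 : nl e -> child_edge c e -> bs c e (pi z1) -> bs c e (pi z2) ->
  conn s t (fun z => bs c e (pi z)) z1 z2.
Proof.
move=> ne ch b1 b2; set P := fun z => bs c e (pi z).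
have [d ecd [dc _ _]] := ch.
have ec : end_of sq tq e c := incident_end ecd.
have bE : bs c e = qc (but c) (pi z1).
  have ed := bset_conn ne (incident_end (incident_pair_sym ecd)) dc.
  by rewrite ed; apply: conn_eq; rewrite -ed.
have fP : fincut s t P.
  have [l hl] := block_finite qrl qfs ne; exists l => f /crossesP[a [b [fab Pa nPb]]].
  apply: hl; rewrite /P bE in Pa nPb.
  have ac : pi a <> c := conn_inr Pa.
  have bc : pi b = c.
    apply: contrapT => bc; apply: nPb; apply: (conn_step Pa) => //.
    by exists f; apply: gi_qi.
  have nf : nl f by move=> h; apply: ac; rewrite -bc; case: fab => -[<- <-].
  have fq := gi_qi fab.
  apply: (@block_at e f c) => //.
    by rewrite -bc; apply: incident_end (incident_pair_sym fq).
  by rewrite (bset_conn nf (incident_end fq) ac) bE; apply: conn_eq.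
have c12 : qc (but c) (pi z1) (pi z2) by rewrite -bE.
have [_] : bs c e (pi z2) /\ forall z, pi z = pi z2 -> conn s t P z1 z; last by apply.
apply: (conn_ind (P := fun y => bs c e y /\ forall z, pi z = y -> conn s t P z1 z) c12).
  by split=> // z /esym/pi_eqP; apply: sim_conn.
move=> y y' yc y'c [f fy] [by_ hy]; have [a [b [fab ay byy]]] := qi_gi fy.
have by' : bs c e y' by rewrite bE in by_ *; apply: (conn_step by_) => //; exists f.
split=> // z zy'; apply: (@conn_trans _ _ _ _ _ _ b).
  by apply: (conn_step (hy a ay)); [rewrite /P byy|exists f].
apply: sim_conn => //; first by rewrite /P byy.
by apply/pi_eqP; rewrite zy' byy.
Qed.

Let und c U u v := lk c U u v \/ lk c U v u.

Lemma lstep_loop c sg U p q : ~ nl U -> lstep c sg U p q ->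
  p = unglue c (tail_of s t sg U) /\ q = unglue c (head_of s t sg U).
Proof.
move=> lU [e [eU <- <-]]; have [ne|le] := pselect (nl e).
  by case: lU; rewrite -eU; case: (block_rep_in ne).
by rewrite block_rep_loop // in eU; rewrite eU.
Qed.

Lemma reach_ends (R : V -> V -> Prop) u v : reach R u v -> u <> v ->
  (exists y, R u y) /\ (exists x, R x v).
Proof.
elim=> // x y ux IH xy uy; split; last by exists x.
have [ux'|ux'] := pselect (u = x); first by exists y; rewrite ux'.
by have [] := IH ux'.
Qed.

(** Different child blocks at [c] have different branches, and a finite [W] meets finitely many of
    them. A link through any other branch can be replaced by a path through that branch. *)
Lemma lk_conn_off c (W : seq V) : exists F : seq E, forall U u v, U \notin F -> und c U u v ->
  off W u -> off W v -> conn s t (off W) u v.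
Proof.
have [F hF] : exists F : seq E, forall w, w \in W -> forall e, nl e -> child_edge c e ->
    bs c e (pi w) -> rep e \in F.
  elim: W => [|w W [F hF]]; first by exists [::].
  have [[e0 [n0 c0 b0]]|no] := pselect (exists e, [/\ nl e, child_edge c e & bs c e (pi w)]).
    exists (rep e0 :: F) => w'; rewrite inE => /orP[/eqP-> e ne ce be|w'W e ne ce be].
      have -> : rep e = rep e0; last by rewrite mem_head.
      have [d ecd [dc _ _]] := ce; have [d0 ecd0 [dc0 _ _]] := c0.
      apply: block_rep_eq => //; apply: (block_at ne n0 (incident_end ecd) (incident_end ecd0)).
      have h := bset_conn ne (incident_end (incident_pair_sym ecd)) dc.
      have h0 := bset_conn n0 (incident_end (incident_pair_sym ecd0)) dc0.
      rewrite h h0 in be b0 *; apply: conn_eq; apply: conn_trans be (conn_sym b0).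
    by rewrite inE (hF w') ?orbT.
  exists F => w'; rewrite inE => /orP[/eqP-> e ne ce be|w'W]; last exact: hF.
  by case: no; exists e.
exists F => U u v UF l ou ov.
have key u' v' : off W u' -> off W v' -> lk c U u' v' -> conn s t (off W) u' v'.
  move=> {l ou ov u v}; move: u' v' => u v ou ov [[e eU ce] uc vc r].
  have [<-|uv] := pselect (u = v); first exact: conn_refl.
  have [[y uy] [x xv]] := reach_ends r uv.
  case: ce => [lc|[ne ce]].
    have lU : ~ nl U.
      have le : ~ nl e by move=> h; apply: (nonloop_incident h lc).
      by rewrite -eU block_rep_loop.
    have [h1 _] := lstep_loop lU uy; have [_ h2] := lstep_loop lU xv.
    have e1 := unglue_class (esym h1) uc; have e2 := unglue_class (esym h2) vc.
    by apply: conn_adj => //; exists U; rewrite -e1 -e2; apply: gi_tail_head.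
  have ends f a b : rep f = U -> gi f a b -> pi a = c -> bs c e (pi b).
    move=> fU fab ac; rewrite -eU in fU; have bf := block_rep_inv ne fU.
    have fq := gi_qi fab; have h := nonloop_incident bf.1 fq.
    have bb : block_vertex sq tq e (pi b).
      by exists f => //; apply: incident_end (incident_pair_sym fq).
    by have [] := child_other ne ce bb; first by move=> h'; apply: h; rewrite ac h'.
  have [f1 [f1U t1 _]] := uy; have {}t1 := unglue_class t1 uc.
  have [f2 [f2U _ t2]] := xv; have {}t2 := unglue_class t2 vc.
  have i1 := gi_tail_head sg0 f1; rewrite t1 in i1.
  have i2 := gi_tail_head sg0 f2; rewrite t2 in i2.
  have b1 := ends _ _ _ f1U i1 uc; have b2 := ends _ _ _ f2U (incident_pair_sym i2) vc.
  have sub z : bs c e (pi z) -> off W z.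
    by move=> bz; apply/negP => zW; move/negP: UF; apply; rewrite -eU; apply: hF bz.
  have c12 := conn_sub sub (branch_conn ne ce b1 b2).
  apply: (@conn_trans _ _ _ _ _ _ (head_of s t sg0 f1)).
    by apply: conn_adj => //; [apply: sub|exists f1].
  apply: (conn_trans c12); apply: conn_adj => //; first exact: sub.
  by exists f2.
by case: l => l; [apply: key|apply/conn_sym/key].
Qed.

Section Chain.
Variables (c : V) (e : E) (a : V -> Prop).
Hypothesis ne : nl e.
Hypothesis ce : child_edge c e.
Hypothesis inv : forall u v, und c (rep e) u v -> a u -> a v.
Variables (f1 f2 : E) (u1 u2 d1 d2 : V).
Hypothesis b1 : blk e f1.
Hypothesis b2 : blk e f2.
Hypothesis i1 : gi f1 u1 d1.
Hypothesis i2 : gi f2 u2 d2.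
Hypothesis c1 : pi u1 = c.
Hypothesis c2 : pi u2 = c.
Hypothesis a1 : a u1.
Hypothesis a2 : ~ a u2.

Let U := rep e.
Let cU : child_unit c U. Proof. by exists e => //; right. Qed.
Let pc : pi c = c. Proof. by rewrite -c1 pi_id. Qed.
Let repU f : blk e f -> rep f = U. Proof. by move=> bf; apply/esym/block_rep_eq. Qed.

Let f12 : f1 <> f2.
Proof.
move=> h; have d1c := nonloop_incident b1.1 (gi_qi i1).
move: i1 i2; rewrite -h => -[[h1 h2]|[h1 h2]] [[h3 h4]|[h3 h4]].
- by apply: a2; rewrite -h3 h1.
- by apply: d1c; rewrite c1 -h2 h4.
- by apply: d1c; rewrite c1 -h1 h3.
- by apply: a2; rewrite -h4 h2.
Qed.

Let bc : block_vertex sq tq e c.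
Proof. by exists f1 => //; rewrite -c1; apply: incident_end (gi_qi i1). Qed.

Let cge x : block_vertex sq tq e x -> conn_ge sq tq (2 * 1) x c.
Proof. by move=> bx; apply: block_conn2 b1 b2 f12 bx bc. Qed.

(** With two edges the block is 2-edge-connected, so an arc of it leaves every set that separates
    [x] from [c], in particular the set reachable from [x] if that misses the class. *)
Let reaches_class x : block_vertex sq tq e x -> x <> c ->
  exists2 u, pi u = c & reach (lstep c sg0 U) x u.
Proof.
move=> bx xc; apply: contrapT => no.
have nr u : pi u = c -> ~ reach (lstep c sg0 U) x u by move=> uc r; apply: no; exists u.
have [[|f l] [_ // _ h]] := good0 ne (X := reach (lstep c sg0 U) x) (k := 1) bx bc
  (reach_refl _ x) (nr c pc) (cge bx).
have [bf [tX hX]] := h f (mem_head _ _); rewrite -pi_tail -pi_head in tX hX.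
have tc : pi (tail_of s t sg0 f) <> c by move=> h'; rewrite h' in tX; apply: (nr c pc tX).
have st : lstep c sg0 U (pi (tail_of s t sg0 f)) (unglue c (head_of s t sg0 f)).
  by exists f; split=> //; [apply: repU|apply: unglue_out].
have r := reach_step tX st; have [hc|hc] := pselect (pi (head_of s t sg0 f) = c).
  by rewrite unglue_in // in r; apply: (nr _ hc).
by rewrite unglue_out // in r.
Qed.

Let reached_from_class x : block_vertex sq tq e x -> x <> c ->
  exists2 u, pi u = c & reach (lstep c sg0 U) u x.
Proof.
move=> bx xc; apply: contrapT => no.
have nr u : pi u = c -> ~ reach (lstep c sg0 U) u x by move=> uc r; apply: no; exists u.
have nnx : ~ ~ reach (lstep c sg0 U) x x by move=> k; apply: k; apply: reach_refl.
have [[|f l] [_ // _ h]] := good0 ne (X := fun z => ~ reach (lstep c sg0 U) z x)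
  (k := 1) bc bx (nr c pc) nnx (conn_ge_sym (cge bx)).
have [bf [tX /contrapT hX]] := h f (mem_head _ _); rewrite -pi_tail -pi_head in tX hX.
have hc : pi (head_of s t sg0 f) <> c by move=> h'; rewrite h' in hX; apply: (nr c pc hX).
have st : lstep c sg0 U (unglue c (tail_of s t sg0 f)) (pi (head_of s t sg0 f)).
  by exists f; split=> //; [apply: repU|apply: unglue_out].
have r := reach_trans (reach1 st) hX; have [tc|tc] := pselect (pi (tail_of s t sg0 f) = c).
  by rewrite unglue_in // in r; apply: (nr _ tc).
by rewrite unglue_out // in r.
Qed.

Let near u x := reach (lstep c sg0 U) u x \/ reach (lstep c sg0 U) x u.
Let S x := exists u, [/\ pi u = c, a u & near u x].

Let lkU u v : pi u = c -> pi v = c -> reach (lstep c sg0 U) u v -> (a u -> a v) /\ (a v -> a u).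
Proof.
by move=> uc vc r; have l : lk c U u v by []; split; apply: inv; [left|right].
Qed.

Let S_all x : block_vertex sq tq e x -> x <> c -> S x -> forall v, pi v = c -> near v x -> a v.
Proof.
move=> bx xc [u [uc au ux]] v vc vx.
have [w wc xw] := reaches_class bx xc; have [w' w'c w'x] := reached_from_class bx xc.
case: ux => ux.
  have aw : a w by apply: (lkU uc wc (reach_trans ux xw)).1.
  case: vx => vx; first by apply: (lkU vc wc (reach_trans vx xw)).2.
  by apply: (lkU uc vc (reach_trans ux vx)).1.
have aw' : a w' by apply: (lkU w'c uc (reach_trans w'x ux)).2.
case: vx => vx; first by apply: (lkU vc uc (reach_trans vx ux)).2.
by apply: (lkU w'c vc (reach_trans w'x vx)).1.
Qed.

Let near_edge f u d : blk e f -> gi f u d -> pi u = c -> pi d <> c -> near u (pi d).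
Proof.
move=> bf fud uc dc; have hu := unglue_in uc; have hd := unglue_out dc.
by case: (gi_orient sg0 fud) => -[h1 h2]; [left|right]; apply: reach1;
  exists f; rewrite h1 h2; split=> //; apply: repU.
Qed.

(** Every vertex of the block other than [c] lies on links, so by [inv] the class vertices near it
    are all in [a] or all outside. This alternative is constant along paths of the block avoiding
    [c], which lead from the neighbour of [u1] to that of [u2]. *)
Lemma link_chain : False.
Proof.
have other f u d : blk e f -> gi f u d -> pi u = c ->
    pi d <> c /\ block_vertex sq tq e (pi d).
  move=> bf fud uc; have fq := gi_qi fud; split.
    by move=> h; apply: (nonloop_incident bf.1 fq); rewrite uc h.
  by exists f => //; apply: incident_end (incident_pair_sym fq).
have [d1c bd1] := other _ _ _ b1 i1 c1; have [d2c bd2] := other _ _ _ b2 i2 c2.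
apply: a2; apply: (S_all bd2 d2c) (c2) (near_edge b2 i2 c2 d2c).
have cd : qc (but c) (pi d1) (pi d2).
  by rewrite -(block_bset bd1 d1c) (block_bset bd2 d2c); apply: conn_refl.
apply: (block_conn_ind bd1 bd2 cd).
  by exists u1; split=> //; apply: near_edge i1 c1 d1c.
move=> g p q bg gpq pc' qc' Sp.
have bp : block_vertex sq tq e p by exists g => //; apply: incident_end gpq.
have [x [y [gxy xp yq]]] := qi_gi gpq.
have [w wc pw] := reaches_class bp pc'; have [w' w'c w'p] := reached_from_class bp pc'.
have aw := S_all bp pc' Sp wc (or_intror pw); have aw' := S_all bp pc' Sp w'c (or_introl w'p).
have xc : pi x <> c by rewrite xp.
have yc : pi y <> c by rewrite yq.
case: (gi_orient sg0 gxy) => -[h1 h2].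
  exists w'; split=> //; left; apply: (reach_step w'p); exists g.
  by rewrite h1 h2 !unglue_out // xp yq repU.
exists w; split=> //; right; apply: reach_trans (reach1 _) pw; exists g.
by rewrite h1 h2 !unglue_out // xp yq repU.
Qed.

End Chain.

(** Without such a link, [A] within the class, together with all branches attached to it by units
    outside [F], would be bounded by finitely many edges: those of units in [F] and of the block
    towards the root. This finite cut would separate two similar vertices. *)
Lemma lk_cut c (A : V -> Prop) x y (F : seq E) : pi x = c -> A x -> pi y = c -> ~ A y ->
  exists U u v, [/\ U \notin F, A u, ~ A v & und c U u v].
Proof.
move=> xc Ax yc nAy; apply: contrapT => no.
have {}no U u v : U \notin F -> und c U u v -> A u -> A v.
  by move=> UF l Au; apply: contrapT => nAv; apply: no; exists U, u, v.
pose X z := (pi z = c /\ A z) \/ (pi z <> c /\ exists e, [/\ nl e, child_edge c e, rep e \notin F,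
  (exists f u d, [/\ blk e f, gi f u d, pi u = c & A u]) & bs c e (pi z)]).
have fX : fincut s t X.
  have [l1 hl1] : exists l : seq E, forall f, rep f \in F -> f \in l.
    elim: F {no X} => [|U F [l hl]]; first by exists [::].
    have [l' hl'] := unit_finite U; exists (l' ++ l) => f; rewrite inE mem_cat.
    by case/orP => [/eqP/hl'->|/hl->]; rewrite ?orbT.
  (* These edges all lie in the one block at [c] that leads towards the root. *)
  have [l2 hl2] : exists l : seq E, forall f d, nl f -> qi f c d -> ~ child_edge c f -> f \in l.
    have [[f0 [d0 [n0 q0 h0]]]|none] := pselect (exists f d, [/\ nl f, qi f c d & ~ child_edge c f]).
      have [l hl] := block_finite qrl qfs n0; exists l => f d nf fq h; apply: hl.
      apply: (block_at n0 nf (incident_end q0) (incident_end fq)).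
      have r0 := not_child_edge n0 q0 h0; have r := not_child_edge nf fq h.
      rewrite (bset_conn n0 (incident_end (incident_pair_sym q0)) (conn_inr r0)).
      rewrite (bset_conn nf (incident_end (incident_pair_sym fq)) (conn_inr r)).
      by apply: conn_eq; apply: conn_trans (conn_sym r0) r.
    by exists [::] => f d nf fq h; case: none; exists f, d.
  exists (l1 ++ l2) => g /crossesP[p [q [gpq Xp nXq]]]; rewrite mem_cat.
  have [gF|gF] := boolP (rep g \in F); first by rewrite hl1.
  have gq := gi_qi gpq; have nA : pi q = c -> ~ A q by move=> h1 h2; apply: nXq; left.
  case: Xp => [[pcc Ap]|[pc [e [ne ce eF [f [u [d [bf fud uc Au]]]] be]]]].
    have [qcc|qc'] := pselect (pi q = c).
      case: (nA qcc); apply: (no (rep g) p) => //.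
      have ch : child_unit c (rep g) by exists g => //; left; rewrite -{1}pcc -qcc.
      by case: (gi_orient sg0 gpq) => -[h1 h2]; [left|right]; split=> //; apply: reach1;
        exists g; rewrite h1 h2 !unglue_in.
    have ng : nl g by move=> h; apply: qc'; rewrite -pcc; case: gpq => -[<- <-].
    rewrite pcc in gq; have [ch|nch] := pselect (child_edge c g); last by rewrite (hl2 g (pi q)) ?orbT.
    case: nXq; right; split=> //; exists g; split=> //.
      by exists g, p, q; split=> //; apply: in_block_refl.
    rewrite (bset_conn ng (incident_end (incident_pair_sym gq)) qc'); exact: conn_refl.
  have [dd ecd [ddc _ _]] := ce.
  have bE := bset_conn ne (incident_end (incident_pair_sym ecd)) ddc.
  have [qcc|qc'] := pselect (pi q = c); last first.
    case: nXq; right; split=> //; exists e; split=> //; first by exists f, u, d.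
    by rewrite bE in be *; apply: (conn_step be) => //; exists g.
  have ng : nl g by move=> h; apply: pc; rewrite -qcc; case: gpq => -[<- <-].
  rewrite qcc in gq.
  have bg : blk e g.
    apply: (block_at ne ng (incident_end ecd) (incident_end (incident_pair_sym gq))).
    by rewrite (bset_conn ng (incident_end gq) pc) bE; apply: conn_eq; rewrite -bE.
  exfalso; apply: (@link_chain c e A ne ce _ f g u q d p bf bg fud (incident_pair_sym gpq) uc qcc Au (nA qcc)).
  by move=> u' v'; apply: no.
have Xx : X x by left.
have xy : sim s t x y by apply/pi_eqP; rewrite xc.
by case: (xy X fX Xx) => [[_ //]|[]].
Qed.

Lemma linkable_class u v : pi u = pi v -> linkable (fun z => pi z = pi u) (lk (pi u)) u v.
Proof.
move=> uv; apply: (linkable_total rl) => //.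
- by move=> U x y [].
- by move=> A x y F xc Ax yc nAy; apply: lk_cut xc Ax yc nAy.
- by move=> W; apply: lk_conn_off.
Qed.

End Links.

(** * Descent in the block tree *)

Section Descent.
Variables (V E : choiceType) (s t : E -> V).
Implicit Types (u v w x y z c d : V).
Local Notation pi := (pi s t).
Let sq e := pi (s e).
Let tq e := pi (t e).
Local Notation qc := (conn sq tq).
Local Notation below := (below s t).
Local Notation root := (root s t).

Lemma below_avoid c d : below c d -> qc (but d) (root c) c.
Proof.
move=> [dc cd ncd]; set r := root c in ncd *.
have rd : qc (fun=> True) r d := conn_trans (conn_sym (root_conn s t c)) cd.
have [p [pp lp up]] := conn_uniq rd.
have cp : c \in r :: p.
  apply: contrapT => /negP cp; apply: ncd; rewrite -lp; apply: path_conn.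
    by move=> h; rewrite h mem_head in cp.
  by apply: path_stepin_sub pp => z zp _ h; rewrite -h inE zp orbT in cp.
case/splitPl: cp pp lp up => p1 p2 lp1; rewrite cat_path last_cat lp1.
move=> /andP[pp1 _] lp up.
have dn z : z \in r :: p1 -> z <> d.
  move=> zp zd; have dp2 : d \in p2.
    by have := mem_last c p2; rewrite lp inE => /orP[/eqP//|].
  move: up; rewrite -cat_cons cat_uniq => /and3P[_ /hasPn/(_ d dp2)].
  by rewrite /= -zd zp.
rewrite -lp1; apply: path_conn; first by apply: dn; rewrite mem_head.
by apply: path_stepin_sub pp1 => z zp _; apply: dn; rewrite inE zp orbT.
Qed.

Lemma below_root c d : below c d -> root c = root d.
Proof. by move=> [_ cd _]; apply: root_eq. Qed.

Lemma below_trans c d e : below c d -> below d e -> below c e.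
Proof.
move=> cd de; have rE := below_root cd; have [dc ccd ncd] := cd; have [ed cde nde] := de.
split; [|exact: conn_trans cde|].
  by move=> ec; apply: nde; rewrite ec -rE; apply: below_avoid.
move=> re; apply: nde; rewrite -rE; apply: conn_sub (conn_sub_conn re) => z rz zd.
by apply: ncd; rewrite -zd.
Qed.

(** On a simple path from the root to [d], all vertices after [c] are below [c], and none is below
    [d], since the path reaches them from the root without [d] or ends there. *)
Lemma below_segment c d : below c d ->
  qc (fun z => (z = c \/ below c z) /\ ~ below d z) c d.
Proof.
move=> cd; have rE := below_root cd; have [dc ccd ncd] := cd; set r := root c in ncd.
have rd : qc (fun=> True) r d := conn_trans (conn_sym (root_conn s t c)) ccd.
have [p [pp lp up]] := conn_uniq rd.
have cp : c \in r :: p.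
  apply: contrapT => /negP cp; apply: ncd; rewrite -lp; apply: path_conn.
    by move=> h; rewrite h mem_head in cp.
  by apply: path_stepin_sub pp => z zp _ h; rewrite -h inE zp orbT in cp.
case/splitPl: cp pp lp up => p1 p2 lp1; rewrite cat_path last_cat lp1.
move=> /andP[pp1 pp2] lp up.
have cp2 : c \notin p2.
  move: up; rewrite -cat_cons cat_uniq => /and3P[_ /hasPn h _].
  by apply/negP => /h; rewrite /= -lp1 mem_last.
rewrite -[X in qc _ _ X]lp; apply: path_conn.
  split; first by left.
  by move=> [_ _]; rewrite -rE; apply; apply: below_avoid.
apply: (path_stepin_sub _ pp2) => z zp _.
case/splitPr: zp pp2 lp up cp2 => q1 q2; rewrite cat_path last_cat [path _ _ (z :: _)]/=.
move=> /and3P[pq1 /asboolP[_ az] pq2] lq up cp2; rewrite [last _ _]/= in lq.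
have notc w : w \in z :: q2 -> w <> c.
  by move=> wq h; move: cp2; rewrite mem_cat -h wq orbT.
have zd : qc (but c) z d.
  rewrite -lq; apply: path_conn; first by apply: notc; rewrite mem_head.
  by apply: path_stepin_sub pq2 => w wq _; apply: notc; rewrite inE wq orbT.
split.
  right; split; first by apply: notc; rewrite mem_head.
    by apply: conn_trans ccd _; apply: conn_sym; apply: conn_sub zd.
  by move=> rz; apply: ncd; apply: conn_trans rz zd.
move=> [znd _]; rewrite -rE; apply.
have dq2 : d \in q2.
  by have := mem_last z q2; rewrite lq inE => /orP[/eqP h|//]; case: znd.
have notd w : w \in r :: p1 ++ rcons q1 z -> w <> d.
  move=> wq wd; move: up; rewrite -cat_rcons catA -cat_cons cat_uniq.
  by move=> /and3P[_ /hasPn/(_ d dq2)]; rewrite /= -wd wq.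
have -> : z = last r (p1 ++ rcons q1 z) by rewrite last_cat last_rcons.
apply: path_conn; first by apply: notd; rewrite mem_head.
have pz : path (stepin sq tq (fun=> True)) r (p1 ++ rcons q1 z).
  by rewrite cat_path pp1 lp1 rcons_path pq1; apply/asboolP.
by apply: path_stepin_sub pz => w wq _; apply: notd; rewrite inE wq orbT.
Qed.

Hypothesis rl : rayless_ends s t.

(** An infinite descending chain converges to an end: its segments run through ever lower parts of
    the block tree, so each vertex lies on finitely many of them. *)
Lemma below_wf (P : V -> Prop) : (forall c, P c -> exists2 d, below c d & P d) ->
  forall c, ~ P c.
Proof.
move=> step c Pc.
have nextP c' : exists d, P c' -> below c' d /\ P d.
  have [h|h] := pselect (P c'); last by exists c'.
  by have [d h1 h2] := step c' h; exists d.
have [nxt nxtP] := choice nextP; pose u n := iter n nxt c.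
have Pu n : P (u n) by elim: n => // n /nxtP[].
have uS n : below (u n) (u n.+1) by have [] := nxtP _ (Pu n).
have ult m n : m < n -> below (u m) (u n).
  elim: n => // n IHn; rewrite ltnS leq_eqVlt => /orP[/eqP->//|/IHn h].
  exact: below_trans h (uS n).
apply: (quot_rayless rl); apply: (@tail_ray _ _ _ _ u) => W.
pose A n z := (z = u n \/ below (u n) z) /\ ~ below (u n.+1) z.
have [N hN] : exists N, forall n, N <= n -> forall w, w \in W -> ~ A n w.
  apply: eventually_all => w _; have [[m [_ mw]]|no] := pselect (exists m, A m w).
    (* Consecutive segments share the vertex [u m.+1], hence two steps. *)
    exists m.+2 => n mn [[wu|nw] _]; apply: mw; first by rewrite wu; apply: ult.
    exact: below_trans (ult _ _ mn) nw.
  by exists 0 => n _ h; apply: no; exists n.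
exists N => n Nn; apply: conn_sub (below_segment (uS n)) => z Az.
by apply/negP => zW; apply: (hN n Nn z zW).
Qed.

End Descent.

(** * Choosing the reversals and combining the blocks *)

Section Assembly.
Variables (V E : choiceType) (s t : E -> V).
Implicit Types (u v w x y z c d p q : V) (e f : E) (U : E).
Local Notation pi := (pi s t).
Let sq e := pi (s e).
Let tq e := pi (t e).
Local Notation rep := (block_rep sq tq).
Local Notation nl := (nonloop sq tq).
Local Notation lstep := (lstep s t).
Local Notation child_unit := (child_unit s t).

Hypothesis rl : rayless_ends s t.
Variable sg0 : E -> bool.
Hypothesis good0 : forall e, nl e -> good_on_block sq tq sg0 e.
Variable enc : V -> nat.
Hypothesis enc_inj : injective enc.

Local Notation lk := (lk s t sg0).

(** Step [n] serves the pair of vertices coded by the exponents of 2 and 3 in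
    [n], so that every pair is served infinitely often. *)
Let serves n u v := logn 2 n = enc u /\ logn 3 n = enc v.

Let serves_inf u v N : exists2 n, N <= n & serves n u v.
Proof.
(* The power of 5 makes the number large without touching the two exponents. *)
exists (2 ^ enc u * 3 ^ enc v * 5 ^ N).
  apply: leq_trans (ltnW (ltn_expl N (isT : 1 < 5))) _.
  by rewrite leq_pmull // muln_gt0 !expn_gt0.
by split; rewrite !lognM ?muln_gt0 ?expn_gt0 // !lognX !logn_prime //=; lia.
Qed.

Lemma disjoint_groups : exists G : nat -> seq (E * bool),
  [/\ forall n, uniq (map fst (G n)),
    forall m n U, m < n -> U \in map fst (G m) -> U \notin map fst (G n) &
    forall u v N, pi u = pi v -> exists n, [/\ N <= n,
      reach (garc (lk (pi u)) (G n)) u v & reach (garc (lk (pi u)) (G n)) v u]].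
Proof.
have gP (p : nat * seq E) : exists g : seq (E * bool), [/\ uniq (map fst g),
    forall U, U \in map fst g -> U \notin p.2 &
    forall u v, serves p.1 u v -> pi u = pi v ->
      reach (garc (lk (pi u)) g) u v /\ reach (garc (lk (pi u)) g) v u].
  case: p => n F /=.
  have [[u [v [[su sv] uv]]]|no] := pselect (exists u v, serves n u v /\ pi u = pi v).
    have [_ _ /(_ F)[g [g1 g2 g3 g4]]] := linkable_class rl good0 uv.
    exists g; split=> // u' v' [su' sv'] _.
    have -> : u' = u by apply: enc_inj; rewrite -su -su'.
    by have -> : v' = v by apply: enc_inj; rewrite -sv -sv'.
  by exists [::]; split=> // u v su uv; case: no; exists u, v.
have [gp gpP] := choice gP.
pose used := fix used n := if n is m.+1 then used m ++ map fst (gp (m, used m)) else [::].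
pose G n := gp (n, used n).
have usedP m n U : m < n -> U \in map fst (G m) -> U \in used n.
  elim: n => // n IHn; rewrite ltnS leq_eqVlt /= mem_cat.
  by case/orP => [/eqP-> ->|/IHn h /h ->]; rewrite ?orbT.
exists G; split.
- by move=> n; have [] := gpP (n, used n).
- move=> m n U mn Um; apply/negP => Un; have [_ h _] := gpP (n, used n).
  by have /negP[] := h U Un; apply: usedP mn Um.
- move=> u v N uv; have [n Nn sn] := serves_inf u v N.
  by exists n; have [_ _ /(_ u v sn uv)[h1 h2]] := gpP (n, used n).
Qed.

Let flip phi e := sg0 e (+) phi (rep e).

Let lstep_flip phi c U p q :
  lstep c (flip phi) U p q <-> if phi U then lstep c sg0 U q p else lstep c sg0 U p q.
Proof.
rewrite /lstep /flip; case ph: (phi U); split; case=> e [eU h1 h2]; exists e;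
  by move: h1 h2; rewrite /tail_of /head_of eU ph; case: (sg0 e).
Qed.

(** Disjointness of the groups makes [phi] consistent with all of them. A finite [F] meets finitely
    many groups, and a later one serves [u] and [v]. *)
Lemma linking_flips : exists phi, forall u v (F : seq E), pi u = pi v ->
  reach (fun p q => exists U, [/\ U \notin F, child_unit (pi u) U &
    reach (lstep (pi u) (flip phi) U) p q]) u v.
Proof.
have [G [uG dG hG]] := disjoint_groups.
pose phi U := `[< exists n, (U, true) \in G n >].
have uniq_fst (g : seq (E * bool)) U : uniq (map fst g) -> (U, true) \in g -> (U, false) \in g -> False.
  elim: g => //= -[U' b] g IHg /andP[U'g ug]; rewrite !inE.
  move=> /orP[/eqP[e1 e2]|h1] /orP[/eqP[e3 e4]|h2]; last exact: IHg.
  - by rewrite -e2 in e4.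
  - by move/negP: U'g; apply; rewrite -e1; apply: (map_f fst h2).
  - by move/negP: U'g; apply; rewrite -e3; apply: (map_f fst h1).
have phiE n U b : (U, b) \in G n -> phi U = b.
  case: b => h; first by apply/asboolP; exists n.
  apply/asboolP => -[m hm]; have h1 := map_f fst h; have h2 := map_f fst hm.
  have [mn|nm|mn] := ltngtP m n.
  - by have := dG _ _ _ mn h2; rewrite h1.
  - by have := dG _ _ _ nm h1; rewrite h2.
  - by rewrite mn in hm; apply: uniq_fst (uG n) hm h.
exists phi => u v F uv.
have [N hN] : exists N, forall n, N <= n -> forall U, U \in F -> U \notin map fst (G n).
  apply: eventually_all => U _.
  have [[m Um]|no] := pselect (exists m, U \in map fst (G m)).
    by exists m.+1 => n mn; apply: dG mn Um.
  by exists 0 => n _; apply/negP => h; apply: no; exists n.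
have [n [Nn r _]] := hG u v N uv.
apply: reach_sub r => p q [U [b [Ub l]]]; exists U; split.
- by apply/negP => UF; have := hN n Nn U UF; rewrite (map_f fst Ub).
- by case: b l {Ub} => -[].
- have ph := phiE _ _ _ Ub; case: b l {Ub} ph => -[_ _ _ r] ph.
    by apply: reach_sub (reach_rev r) => x y h; apply/lstep_flip; rewrite ph.
  by apply: reach_sub r => x y h; apply/lstep_flip; rewrite ph.
Qed.

Lemma child_unit_below c U e d : child_unit c U -> rep e = U -> end_of sq tq e d -> d <> c ->
  below s t c d.
Proof.
move=> [e' <- ce'] ee' ed dc; case: ce' => [lc|[ne' ce']].
  have le' : ~ nl e' by move=> h; apply: (nonloop_incident h lc).
  rewrite [in RHS]block_rep_loop // in ee'; have [ne|le] := pselect (nl e).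
    by case: le'; rewrite -ee'; case: (block_rep_in ne).
  rewrite block_rep_loop // in ee'; case: dc; rewrite ee' in ed.
  by case: lc ed => -[h1 h2] [] <-.
have be := block_rep_inv ne' ee'.
by have [] := child_other ne' ce' (x := d) _ dc; first by exists e.
Qed.

(** The link avoids the units of [L] and leaves [X] along an arc [e], judged by contracted ends. As
    [e] itself is no out-arc of [X], contraction has moved one of its ends across [X], so the class
    of that end is split. *)
Lemma splitting_descends phi X (L : seq E) : (forall u v (F : seq E), pi u = pi v ->
  reach (fun p q => exists U, [/\ U \notin F, child_unit (pi u) U &
    reach (lstep (pi u) (flip phi) U) p q]) u v) ->
  (forall f, outarc s t (flip phi) X f -> f \in L) ->
  forall c, (exists u v, [/\ pi u = c, pi v = c, X u & ~ X v]) ->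
  exists2 d, below s t c d & exists u v, [/\ pi u = d, pi v = d, X u & ~ X v].
Proof.
move=> links outL c [u [v [uc vc Xu nXv]]]; have uv : pi u = pi v by rewrite uc.
have [p [q [[U [UL cU r]] Xp nXq]]] := reach_cross (links u v (map rep L) uv) Xu nXv.
rewrite uc in cU r.
have [x [y [[e [eU ex ey]] Xx nXy]]] := reach_cross r Xp nXq.
have neL : e \notin L.
  by apply: contra UL => eL; rewrite -eU; apply: map_f.
have cross z : unglue s t c z <> z -> pi z <> c /\ unglue s t c z = pi z.
  rewrite /unglue; case: asboolP => // h _; split=> //.
set a := tail_of s t (flip phi) e in ex; set b := head_of s t (flip phi) e in ey.
have [ia ib] : end_of sq tq e (pi a) /\ end_of sq tq e (pi b).
  by rewrite /a /b /tail_of /head_of; case: (flip phi e); split; [left|right|right|left].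
have [Xa|nXa] := pselect (X a).
  have Xb : X b by apply: contrapT => nXb; move/negP: neL; apply; apply: outL.
  have [bc yb] : pi b <> c /\ y = pi b.
    by rewrite -ey; apply: cross => h; apply: nXy; rewrite -ey h.
  exists (pi b); first exact: child_unit_below eU ib bc.
  by exists b, (pi b); split=> //; rewrite ?pi_id // -yb.
have [ac xa] : pi a <> c /\ x = pi a.
  by rewrite -ex; apply: cross => h; apply: nXa; rewrite -h ex.
exists (pi a); first exact: child_unit_below eU ia ac.
by exists (pi a), a; split=> //; rewrite ?pi_id // -xa.
Qed.

(** If all out-arcs of [X] lie in a finite list, the descent shows that [X] splits no class. Then
    [X] is also a cut of the quotient, where the blocks provide the arcs. *)
Lemma orientation_from_base : exists sg : E -> bool,
  forall X x y k, X x -> ~ X y -> conn_ge s t (2 * k) x y -> atleast k (outarc s t sg X).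
Proof.
have [phi links] := linking_flips; exists (flip phi) => X x y k Xx nXy cge.
have [//|[L hL]] := atleast_or_finite (outarc s t (flip phi) X) k.
have nosplit := below_wf rl (splitting_descends links hL).
have sat u : X (pi u) <-> X u.
  split=> h; apply: contrapT => h'; apply: (nosplit (pi u)).
    by exists (pi u), u; rewrite pi_id.
  by exists u, (pi u); rewrite pi_id.
have good := flip_orientation phi good0.
have := blocks_conn good (proj2 (sat x) Xx) (fun h => nXy (proj1 (sat y) h)) (quot_conn_ge cge).
apply: atleast_sub => f [h1 h2]; split; first by apply/sat; rewrite pi_tail.
by move=> /sat; rewrite pi_head.
Qed.

End Assembly.

Lemma rayless_orientation (V E : choiceType) (s t : E -> V) (enc : V -> nat) :
  rayless_ends s t -> injective enc -> exists sg : E -> bool,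
  forall X x y k, X x -> ~ X y -> conn_ge s t (2 * k) x y -> atleast k (outarc s t sg X).
Proof.
move=> rl inj.
have [sg0 good0] := base_orientation (quot_rayless rl) (@quot_separable _ _ s t).
exact: (orientation_from_base rl good0 inj).
Qed.

(** * From cuts back to paths *)

Lemma walk_crosses (V E : choiceType) (step : E -> V -> V -> Prop) (X : V -> Prop) x p :
  is_walk step x p -> X x -> ~ X (last x (map snd p)) ->
  exists e, e \in path_edges p /\ exists u v, [/\ step e u v, X u & ~ X v].
Proof.
elim: p x => [|[e v] p IHp] x //= [xv wp] Xx nX.
have [Xv|nXv] := pselect (X v); last by exists e; split; [rewrite inE eqxx|exists x, v].
by have [e' [e'p h]] := IHp v wp Xv nX; exists e'; rewrite inE e'p orbT.
Qed.

(** The easy half of Menger's theorem, which turns [lambda] into a bound on cuts. *)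
Lemma disjoint_paths_conn_ge (V E : choiceType) (s t : E -> V) (step : E -> V -> V -> Prop) n x y :
  (forall e u v, step e u v -> incident_pair s t e u v) ->
  disjoint_path_numbers step x y n -> conn_ge s t n x y.
Proof.
move=> stepP [P [pP dP]] X Xx nXy.
have eP i : exists e, e \in path_edges (P i) /\ exists u v, [/\ step e u v, X u & ~ X v].
  by have [w l _] := pP i; apply: walk_crosses w Xx _; rewrite l.
have [e he] := choice eP; exists (codom e); split.
- rewrite map_inj_uniq ?enum_uniq // => i j eij; apply: contrapT => /eqP ij.
  by have /negP[] := dP i j ij (e i) (he i).1; rewrite eij; case: (he j).
- by rewrite size_codom card_ord.
- move=> f /codomP[i ->]; have [_ [u [v [/stepP uv Xu nXv]]]] := he i.
  exact: crosses_pair uv Xu nXv.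
Qed.

From mathcomp Require Import classical_sets functions cardinality.
Local Open Scope classical_set_scope.

Lemma set2_eq (T : Type) (a b c d : T) : [set a; b] = [set c; d] ->
  (a = c /\ b = d) \/ (a = d /\ b = c).
Proof.
move=> h.
have ha : [set c; d] a by rewrite -h; left.
have hb : [set c; d] b by rewrite -h; right.
have hc : [set a; b] c by rewrite h; left.
have hd : [set a; b] d by rewrite h; right.
case: ha hb hc hd => /= -> [] /= -> [] /= hc [] /= hd; auto.
Qed.

Lemma enat_le_emax (A : set nat) k : A k -> enat_le (Fin k) (emax A).
Proof.
move=> Ak; case E : (emax A) => [m|] //=.
by have [_] := (emax_fin A m).1 E; apply.
Qed.

Theorem theorem5p9 (G : multigraph) (hcount : countable_graph G)
  (hrayless : rayless G) : exists o : orientation G, well_balanced o.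
Proof.
have [s hs] := choice (@ends_pair G); have [t ht] := choice hs.
have joinsE e u v : joins e u v <-> incident_pair s t e u v.
  rewrite /joins (ht e).2; split=> [h|]; first exact: set2_eq.
  by case=> -[-> ->] //; rewrite setUC.
have rl : rayless_ends s t.
  move=> [w [e [inj h]]]; apply: hrayless; exists w, e; split=> // n.
  exact/joinsE.
have [enc encP] : exists enc : vertex G -> nat, injective enc.
  have [/countable_injP[f fP] _] := hcount; exists f => x y; apply: fP; exact: in_setT.
have [sg hsg] := rayless_orientation rl encP.
have ends_sg e : joins e (tail_of s t sg e) (head_of s t sg e).
  by apply/joinsE; apply: gi_tail_head.
exists (Orientation ends_sg) => x y xy.
have key k n : 2 * k <= n -> disjoint_path_numbers (@joins G) x y n ->
    disjoint_path_numbers (darc (Orientation ends_sg)) x y k.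
  move=> kn dn; apply: menger => X Xx nXy.
  have cge : conn_ge s t (2 * k) x y.
    move=> Y Yx nYy; apply: atleast_leq kn _.
    by apply: (disjoint_paths_conn_ge _ dn) => // e u v /joinsE.
  have := hsg (fun v => X v) x y k Xx (elimN idP nXy) cge.
  by apply: atleast_sub => e [h1 h2]; rewrite /= h1; apply/negP.
case lE : (lambda x y) => [n|].
  have [dn _] := (emax_fin _ _).1 lE; apply: enat_le_emax; apply: (key _ n) => //.
  by lia.
have ub := (emax_infty (ex_intro _ 0 (disjoint_path_numbers0 _ _ _))).1 lE.
apply/(emax_infty (ex_intro _ 0 (disjoint_path_numbers0 _ _ _))) => k.
have [n dn kn] := ub (2 * k.+1); exists k.+1 => //.
exact: key (ltnW kn) dn.
Qed.
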